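(* Let $\mathcal{A}$ be a hyperplane arrangement in $V=\mathbb{K}^\ell$. (1) Let $\ell=4$. Then $\mathcal{A}$ is tame if there is some $H\in\mathcal{A}$ such that $\mathcal{A}\setminus\{H\}$ is tame, and $\mathcal{A}\setminus\{H\}$ is locally free along $H$. (2) Let $\ell\ge5$ and $H\in\mathcal{A}$. Assume that the Ziegler restriction $(\mathcal{A}^H,m^H)$ is tame and that $\mathcal{A}$ is locally free along $H$. Then $\mathcal{A}$ is tame.
   Context: Let $\mathbb{K}$ be a field, $V=\mathbb{K}^\ell$, $S=\mathbb{K}[x_1,\ldots,x_\ell]$ the coordinate ring of $V$. An arrangement $\mathcal{A}$ in $V$ is a finite set of linear hyperplanes of $V$; for each $H\in\mathcal{A}$ fix a linear form $\alpha_H\in V^*$ with $H=\ker\alpha_H$. A multiplicity is a function $m:\mathcal{A}\to\mathbb{Z}_{>0}$, the pair $(\mathcal{A},m)$ is a multiarrangement, and $Q(\mathcal{A},m)=\prod_{H\in\mathcal{A}}\alpha_H^{m(H)}$. Let $\Omega^1_V=\bigoplus_{i=1}^\ell S\,dx_i$ and $\Omega^p_V=\wedge^p\Omega^1_V$. For $0\le p\le\ell$, $$\Omega^p(\mathcal{A},m)=\{\omega\in \tfrac{1}{Q(\mathcal{A},m)}\Omega^p_V \mid Q(\mathcal{A},m)\,d\alpha_H\wedge\omega\in\alpha_H^{m(H)}\Omega^{p+1}_V\ (\forall H\in\mathcal{A})\},$$ and $\Omega^p(\mathcal{A})=\Omega^p(\mathcal{A},1)$ for the constant multiplicity $1$.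 $\mathcal{A}$ is free if $\Omega^1(\mathcal{A})$ is a free $S$-module. $(\mathcal{A},m)$ is tame if $\mathrm{pd}_S\,\Omega^p(\mathcal{A},m)\le p$ for all $p$; $\mathcal{A}$ is tame if $(\mathcal{A},1)$ is. For $x\in V$ let $\mathcal{A}_x=\{L\in\mathcal{A}\mid x\in L\}$; $\mathcal{A}$ is locally free along $X\subset V$ if $\mathcal{A}_x$ is free for all $0\ne x\in X$. For $H\in\mathcal{A}$, $\mathcal{A}^H=\{H\cap L\mid L\in\mathcal{A}\setminus\{H\}\}$, an arrangement in $H\cong\mathbb{K}^{\ell-1}$ with coordinate ring $\overline{S}=S/\alpha_HS$. The Ziegler restriction of $\mathcal{A}$ onto $H$ is the multiarrangement $(\mathcal{A}^H,m^H)$ in $H$ with $m^H(X)=|\{L\in\mathcal{A}\setminus\{H\}\mid L\cap H=X\}|$ for $X\in\mathcal{A}^H$; its tameness is taken over $\overline{S}$. *)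

(* Defs.v *)
From HB Require Import structures.
From mathcomp Require Import all_boot all_order all_algebra.
From mathcomp Require Import finmap mpoly zify.
From mathcomp Require Import boolp.

Set Implicit Arguments.
Unset Strict Implicit.
Unset Printing Implicit Defensive.

Import GRing.Theory.
Local Open Scope fset_scope.
Local Open Scope ring_scope.

Local Notation "x %:F" := (@tofrac _ x) : ring_scope.

Section Modules.
Variable R : nzRingType.

Definition is_projective (P : lmodType R) : Prop :=
  forall (M N : lmodType R) (g : {linear M -> N}) (f : {linear P -> N}),
    (forall y, exists x, g x = y) ->
    exists h : {linear P -> M}, forall x, g (h x) = f x.

(* There is an exact sequence 0 -> P_p -> ... -> P_0 -> M -> 0 with all P_i
   projective. In particular the zero module has projective dimension <= p
   for every p. *)
Definition pd_le (M : lmodType R) (p : nat) : Prop :=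
  exists (P : nat -> lmodType R) (d : forall i, {linear P i.+1 -> P i})
         (eps : {linear P 0%N -> M}),
    [/\ forall i, is_projective (P i),
        forall i, (p < i)%N -> forall x : P i, x = 0,
        forall y, exists x, eps x = y,
        forall x, eps x = 0 <-> exists z, d 0%N z = x
      & forall i x, d i x = 0 <-> exists z, d i.+1 z = x].

Definition is_basis (M : lmodType R) (B : M -> Prop) : Prop :=
  (forall (s : seq M) (c : M -> R), uniq s -> (forall b, b \in s -> B b) ->
     \sum_(b <- s) c b *: b = 0 -> forall b, b \in s -> c b = 0) /\
  (forall x : M, exists (s : seq M) (c : M -> R),
     (forall b, b \in s -> B b) /\ x = \sum_(b <- s) c b *: b).

Definition is_free (M : lmodType R) : Prop := exists B : M -> Prop, is_basis B.

End Modules.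

(* Rational differential forms on K^n: the coordinate of w at I, with
   I = {i_1 < ... < i_p}, is the coefficient of dx_{i_1} /\ ... /\ dx_{i_p}.
   All degrees live in the same type. The alias carries the structure of a
   module over the polynomial ring, rather than over its fraction field. *)
Definition ratform (K : fieldType) (n : nat) : Type :=
  {ffun {set 'I_n} -> {fraction {mpoly K[n]}}}.

Section Forms.
Variables (K : fieldType) (n : nat).
Local Notation S := {mpoly K[n]}.
Local Notation ratform := (ratform K n).

HB.instance Definition _ :=
  GRing.Zmodule.copy ratform {ffun {set 'I_n} -> {fraction S}}.

Definition ratform_scale (f : S) (w : ratform) : ratform :=
  [ffun I => f%:F * w I].

Fact ratform_scaleA f g w :
  ratform_scale f (ratform_scale g w) = ratform_scale (f * g) w.
Proof. by apply/ffunP=> I; rewrite !ffunE rmorphM mulrA. Qed.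

Fact ratform_scale1 : left_id 1 ratform_scale.
Proof. by move=> w; apply/ffunP=> I; rewrite !ffunE rmorph1 mul1r. Qed.

Fact ratform_scaleDr : right_distributive ratform_scale +%R.
Proof. by move=> f u v; apply/ffunP=> I; rewrite !ffunE mulrDr. Qed.

Fact ratform_scaleDl w : {morph ratform_scale^~ w : f g / f + g}.
Proof. by move=> f g; apply/ffunP=> I; rewrite !ffunE rmorphD mulrDl. Qed.

HB.instance Definition _ := GRing.Zmodule_isLmodule.Build S ratform
  ratform_scaleA ratform_scale1 ratform_scaleDr ratform_scaleDl.

(* dx_I /\ dx_J = (-1)^k dx_(I :|: J) for disjoint I and J, where k is the
   number of pairs (i, j) in I x J with j < i. *)
Definition wedge_inv (I J : {set 'I_n}) : nat :=
  #|[set ij : 'I_n * 'I_n | [&& ij.1 \in I, ij.2 \in J & (ij.2 < ij.1)%N]]|.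

Definition wedge (u v : ratform) : ratform :=
  [ffun T : {set 'I_n} => \sum_(I : {set 'I_n} | I \subset T)
     (-1) ^+ wedge_inv I (T :\: I) * u I * v (T :\: I)].

Definition ext_diff (f : S) : ratform :=
  [ffun I : {set 'I_n} => \sum_(i | I == [set i]) (mderiv i f)%:F].

(* Omega^p_V, inside the rational forms. *)
Definition regular_form (p : nat) (w : ratform) : Prop :=
  forall I, exists2 f : S, w I = f%:F & (#|I| != p -> f = 0).

Definition linear_form (a : 'cV[K]_n) : S := \sum_i a i 0 *: 'X_i.

Definition ker_form (a : 'cV[K]_n) : {vspace 'rV[K]_n} :=
  lker (linfun (mulmxr a)).

Definition is_hyperplane (H : {vspace 'rV[K]_n}) : Prop := (\dim H).+1 = n.

Definition alpha_coef (H : {vspace 'rV[K]_n}) : 'cV[K]_n :=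
  if pselect (exists a, ker_form a == H) is left ex then xchoose ex else 0.

Lemma alpha_coefP H : is_hyperplane H -> ker_form (alpha_coef H) = H.
Proof.
rewrite /is_hyperplane /alpha_coef => dH.
case: pselect => [ex|[]]; first exact/eqP/(xchooseP ex).
pose M : 'M[K]_(\dim H, n) := \matrix_i (vbasis H)`_i.
have memM i : row i M \in H by rewrite rowK vbasis_mem ?mem_nth ?size_tuple.
have subH v : v \in H -> exists u, v = u *m M.
  move=> vH; exists (\row_i coord (vbasis H) i v).
  rewrite mulmx_sum_row [LHS](coord_vbasis vH).
  by apply: eq_bigr => i _; rewrite mxE rowK.
have : kermx M^T != 0.
  rewrite -mxrank_eq0 mxrank_ker mxrank_tr -lt0n subn_gt0.
  by apply: (leq_ltn_trans (rank_leq_row M)); move/eq_leq: dH.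
case/rowV0Pn=> u /sub_kermxP uM u0; exists u^T.
have kerE v : (v \in ker_form u^T) = (v *m u^T == 0).
  by rewrite memv_ker lfunE.
have sub : (H <= ker_form u^T)%VS.
  apply/subvP=> v /subH[w ->]; rewrite kerE -mulmxA.
  by rewrite -[M *m _]trmxK trmx_mul trmxK uM trmx0 mulmx0.
rewrite eq_sym eqEdim sub /= -ltnS dH ltnNge; apply: contra u0 => le_n.
have full : ker_form u^T = fullv.
  by apply/eqP; rewrite eqEdim subvf dimvf /dim /= mul1n.
apply/eqP/matrixP=> i j; rewrite ord1 [RHS]mxE.
have /eqP/matrixP/(_ 0 0) : delta_mx 0 j *m u^T == 0 :> 'M_1.
  by rewrite -kerE full memvf.
by rewrite -rowE !mxE.
Qed.

Definition alpha (H : {vspace 'rV[K]_n}) : S := linear_form (alpha_coef H).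

Definition is_arrangement (A : {fset {vspace 'rV[K]_n}}) : Prop :=
  forall H, H \in A -> is_hyperplane H.

(* A multiplicity m on A is a function on all subspaces, of which only the
   values on A matter. *)
Definition defpoly (A : {fset {vspace 'rV[K]_n}}) (m : {vspace 'rV[K]_n} -> nat)
  : S := \prod_(H <- A) alpha H ^+ m H.

Section LogForms.
Variables (A : {fset {vspace 'rV[K]_n}}) (m : {vspace 'rV[K]_n} -> nat).
Variable p : nat.

Definition log_form (w : ratform) : Prop :=
  regular_form p (defpoly A m *: w) /\
  forall H, H \in A -> exists2 e, regular_form p.+1 e &
    defpoly A m *: wedge (ext_diff (alpha H)) w = alpha H ^+ m H *: e.

Definition log_form_pred : {pred ratform} := fun w => `[< log_form w >].

Lemma regular_form0 q : regular_form q 0.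
Proof. by move=> I; exists 0 => //; rewrite ffunE rmorph0. Qed.

Lemma regular_form_lin q f u v :
  regular_form q u -> regular_form q v -> regular_form q (f *: u + v).
Proof.
move=> ru rv I; have [a ua a0] := ru I; have [b vb b0] := rv I.
exists (f * a + b); first by rewrite !ffunE ua vb rmorphD rmorphM.
by move=> Iq; rewrite a0 // b0 // mulr0 addr0.
Qed.

Lemma wedge_lin u f v w : wedge u (f *: v + w) = f *: wedge u v + wedge u w.
Proof.
apply/ffunP=> T; rewrite !ffunE mulr_sumr -big_split /=.
apply: eq_bigr => I _; rewrite !ffunE mulrDr; congr (_ + _).
by rewrite mulrCA.
Qed.

Lemma wedge0 u : wedge u 0 = 0.
Proof.
by apply/ffunP=> T; rewrite !ffunE big1 // => I _; rewrite ffunE mulr0.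
Qed.

Fact log_form_submod : submod_closed log_form_pred.
Proof.
split.
  apply/asboolP; split=> [|H _]; first by rewrite scaler0; exact: regular_form0.
  by exists 0; [exact: regular_form0 | rewrite wedge0 !scaler0].
move=> f u v /asboolP[ru hu] /asboolP[rv hv]; apply/asboolP; split.
  rewrite scalerDr scalerA mulrC -scalerA.
  exact: regular_form_lin.
move=> H HA; have [a ra ea] := hu H HA; have [b rb eb] := hv H HA.
exists (f *: a + b); first exact: regular_form_lin.
by rewrite wedge_lin !scalerDr scalerA mulrC -scalerA ea eb !scalerA mulrC.
Qed.

HB.instance Definition _ :=
  GRing.isSubmodClosed.Build S ratform log_form_pred log_form_submod.

(* Omega^p(A, m), as a module over the polynomial ring. *)
Record Omega : Type :=
  MkOmega { Omega_val :> ratform; _ : Omega_val \in log_form_pred }.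

HB.instance Definition _ := [isSub for Omega_val].
HB.instance Definition _ := [Choice of Omega by <:].
HB.instance Definition _ := [SubChoice_isSubLmodule of Omega by <:].

End LogForms.

Definition multi_tame A m : Prop :=
  forall p, (p <= n)%N -> pd_le (Omega A m p) p.

Definition tame A : Prop := multi_tame A (fun=> 1%N).

Definition arr_free A : Prop := is_free (Omega A (fun=> 1%N) 1).

Definition localization (A : {fset {vspace 'rV[K]_n}}) (x : 'rV[K]_n) :=
  [fset L in A | x \in L].

Definition locally_free_along A (X : {pred 'rV[K]_n}) : Prop :=
  forall x, x != 0 -> x \in X -> arr_free (localization A x).

(* Coordinates K^(dim H) -> H given by a basis of H. The restriction A^H is
   transported along them, so that the coordinate ring of H is a polynomial
   ring in dim H variables. *)
Definition param (H : {vspace 'rV[K]_n}) : 'Hom('rV[K]_(\dim H), 'rV[K]_n) :=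
  linfun (mulmxr (\matrix_i (vbasis H)`_i)).

Definition restrict_hyperplane (H L : {vspace 'rV[K]_n}) :
  {vspace 'rV[K]_(\dim H)} :=
  (param H @^-1: (H :&: L))%VS.

Definition restriction (A : {fset {vspace 'rV[K]_n}}) (H : {vspace 'rV[K]_n}) :
  {fset {vspace 'rV[K]_(\dim H)}} :=
  [fset restrict_hyperplane H L | L in A `\ H].

Definition ziegler_mult (A : {fset {vspace 'rV[K]_n}}) (H : {vspace 'rV[K]_n})
  (X : {vspace 'rV[K]_(\dim H)}) : nat :=
  #|` [fset L in A `\ H | restrict_hyperplane H L == X]|.

End Forms.

Arguments ziegler_mult {K n} A H X.

Lemma restriction_arrangement (K : fieldType) (n : nat)
    (A : {fset {vspace 'rV[K]_n}}) (H : {vspace 'rV[K]_n}) :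
  is_arrangement A -> H \in A -> is_arrangement (restriction A H).
Proof.
move=> arrA HA X /imfsetP[L /= /fsetD1P[LH LA] ->].
rewrite /is_hyperplane /restrict_hyperplane; set f := param H.
have fE r : f r = \sum_i r 0 i *: (vbasis H)`_i.
  rewrite lfunE /= mulmx_sum_row.
  by apply: eq_bigr => i _; rewrite rowK.
have kerf : lker f == 0%VS.
  rewrite -subv0; apply/subvP=> r; rewrite memv_ker fE memv0 => /eqP r0.
  have /freeP/(_ (fun i => r 0 i) r0) rk := basis_free (vbasisP H).
  by apply/eqP/rowP=> i; rewrite rk mxE.
have imf : limg f = H.
  apply/eqP; rewrite eqEdim limg_dim_eq; last by rewrite (eqP kerf) capv0.
  rewrite dimvf /dim /= mul1n leqnn andbT.
  apply/subvP=> _ /memv_imgP[r _ ->]; rewrite fE.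
  by apply: memv_suml => i _; rewrite memvZ ?vbasis_mem ?mem_nth ?size_tuple.
have dimE : \dim (f @^-1: (H :&: L)) = \dim (H :&: L).
  rewrite -[in RHS](_ : f @: (f @^-1: (H :&: L)) = H :&: L)%VS.
    by rewrite limg_dim_eq // (eqP kerf) capv0.
  by apply: lpreimK; rewrite imf capvSl.
have dH : (\dim H).+1 = n := arrA _ HA.
have dL : (\dim L).+1 = n := arrA _ LA.
have dHL : \dim H = \dim L by apply: succn_inj; rewrite dH dL.
have dsum : \dim (H + L) = n.
  apply/eqP; rewrite eqn_leq; apply/andP; split.
    have := dimvS (subvf (H + L)); by rewrite dimvf /dim /= mul1n.
  rewrite -[X in (X <= _)%N]dH ltnNge; apply: contra LH => le.
  have HE : H == (H + L)%VS by rewrite eqEdim addvSl.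
  by rewrite eqEdim [X in (L <= X)%VS](eqP HE) addvSr dHL leqnn.
rewrite dimE; apply: succn_inj; apply/eqP.
have := dimv_sum_cap H L; rewrite dsum -dHL; lia.
Qed.

(* Main.v *)
(* Projective dimension is read off from Koszul cohomology: for a graded module M
   over S = K[x_1, ..., x_l], pd M <= q if and only if H^p(t; M) = 0 for all
   p + q < l, where t generates the maximal ideal. Since Q Omega^p(A) is cut out
   of a free module by divisibility conditions, H^0 and H^1 always vanish, so
   only the forms of degree 1 <= p <= l - 3 require an argument.

   (1) Freeness of the localizations of A \ H and H^2(Omega^1(A \ H)) = 0 give a
   1-form eta_0 whose residue along H is the reduced equation of A^H, and
   Omega^1(A) is then spanned by eta_0 and Omega^1(A \ H).

   (2) Let M be the part of Omega^1(A) killed by the Euler field. Restriction of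
   eta / alpha_H to H embeds M / alpha_H M in Omega^1(A^H, m^H); it is locally
   onto because A is locally free along H, and onto because alpha_H acts
   surjectively on H^2 of M, which vanishes in low degrees. This gives
   pd Omega^1(A) <= 1. For 2 <= p <= l - 3 let N be the module of relations of a
   generating module F of Omega^1(A), which is free. Then Omega^p(A) is the
   quotient of the exterior power of F by N /\ Lambda^(p-1) F, whose cohomology
   is computed by adding the basis vectors of N one at a time; the required
   exactness holds locally along H and extends by depth. *)
Require Import Defs.
From HB Require Import structures.
From mathcomp Require Import all_boot all_order all_algebra.
From mathcomp Require Import finmap mpoly zify ring.
From mathcomp Require freeg.
From mathcomp Require Import boolp.

Set Implicit Arguments.
Unset Strict Implicit.
Unset Printing Implicit Defensive.

Import GRing.Theory.
Local Open Scope fset_scope.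
Local Open Scope ring_scope.


(** * Koszul cohomology *)

(** Local arguments are made without localization: freeness at x yields identities up to the
    multiplier [offprod A x], the product of the alpha_L with x outside L. The field K is arbitrary,
    even finite, and freeness is known at rational points only. That the multipliers still generate
    enough is shown by induction over the flats of A ([radical_offprod]), which stands in for the
    Nullstellensatz. The outcome is always some power y_k^N of fixed coordinates with N out of
    control, so vanishing is needed for all powers of a system of parameters. Two such systems
    occur. [tcoord] begins with alpha_H and has full length l. Where alpha_H is not in the ideal at
    hand nothing is known off H, and only the l - 1 elements [fpar] remain; their depth just
    suffices for forms of degree at most l - 3. Completeness and direct limits are handled through
    the grading: homogeneous cochains allow an induction on the degree. Modules are predicates on
    free modules and forms are replaced by their numerators, so no fraction occurs beyond the
    comparison with [Omega]. *)

Section Koszul.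
Variable R : comNzRingType.

(* koz n V is V tensor the exterior algebra of R^n: a pair (a, b) stands for
   a + e_0 /\ b. Then kd f is the exterior product with f_0 e_0 + f_1 e_1 + ...,
   and Hvan f n p U says that the Koszul cohomology H^p(f; U) is zero. *)
Fixpoint koz (n : nat) (V : lmodType R) : lmodType R :=
  if n is n'.+1 then (koz n' V * koz n' V)%type : lmodType R else V.

Arguments koz : simpl never.

Section Basic.
Variable V : lmodType R.

Fixpoint kd n (f : nat -> R) : koz n V -> koz n V :=
  match n return koz n V -> koz n V with
  | 0 => fun=> 0
  | n'.+1 => fun c =>
      (@kd n' (fun k => f k.+1) c.1, f 0 *: c.1 - @kd n' (fun k => f k.+1) c.2)
  end.

Fixpoint kdeg n (p : nat) : koz n V -> Prop :=
  match n return koz n V -> Prop with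
  | 0 => fun c => p = 0%N \/ c = 0
  | n'.+1 => fun c => @kdeg n' p c.1 /\
      (if p is p'.+1 then @kdeg n' p' c.2 else c.2 = 0)
  end.

(** Degree p - 1, with only 0 in degree -1; hence vanishing of H^0 says that a cocycle of degree 0
    is zero. *)
Definition pdeg n p (c : koz n V) : Prop :=
  if p is p'.+1 then kdeg p' c else c = 0.

Fixpoint kin n (U : V -> Prop) : koz n V -> Prop :=
  match n return koz n V -> Prop with
  | 0 => U
  | n'.+1 => fun c => @kin n' U c.1 /\ @kin n' U c.2
  end.

Definition submod (U : V -> Prop) : Prop :=
  U 0 /\ forall r u v, U u -> U v -> U (r *: u + v).

Definition Hvan (f : nat -> R) n p (U : V -> Prop) : Prop :=
  forall c : koz n V, kin U c -> kdeg p c -> kd f c = 0 ->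
    exists b : koz n V, [/\ kin U b, pdeg p b & kd f b = c].

Lemma submodD U u v : submod U -> U u -> U v -> U (u + v).
Proof. by move=> [_ h] uU vU; rewrite -[u]scale1r; apply: h. Qed.
Lemma submodZ U r u : submod U -> U u -> U (r *: u).
Proof. by move=> [h0 h] uU; rewrite -[_ *: _]addr0; apply: h. Qed.
Lemma submodN U u : submod U -> U u -> U (- u).
Proof. by move=> hU uU; rewrite -scaleN1r; apply: submodZ. Qed.
Lemma submodB U u v : submod U -> U u -> U v -> U (u - v).
Proof. by move=> hU uU vU; apply: submodD => //; apply: submodN. Qed.
Lemma submod_sum U I (r : seq I) (P : pred I) F :
  submod U -> (forall i, P i -> U (F i)) -> U (\sum_(i <- r | P i) F i).
Proof.
move=> hU h; elim/big_ind: _ => //; first by case: hU.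
by move=> u v; apply: submodD.
Qed.

Lemma kd_lin n f : forall r (c c' : koz n V),
  kd f (r *: c + c') = r *: kd f c + kd f c'.
Proof.
elim: n f => [|n IH] f r c c' /=; first by rewrite scaler0 addr0.
congr (_, _) => /=; rewrite !IH //.
rewrite !scalerDr opprD scalerA mulrC -scalerA addrACA.
by rewrite -scalerN.
Qed.

Lemma kd_is_linear n f : linear (@kd n f).
Proof. exact: kd_lin. Qed.

HB.instance Definition _ n f :=
  GRing.isLinear.Build R (koz n V) (koz n V) _ (@kd n f) (@kd_is_linear n f).

Lemma kd_anti n f g (c : koz n V) : kd f (kd g c) = - kd g (kd f c).
Proof.
elim: n f g c => [|n IH] f g c /=; first by rewrite oppr0.
congr (_, _); first exact: IH.
rewrite /= !linearB /= !linearZ /= [kd _ (kd _ c.2)]IH.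
by rewrite !opprK addrCA.
Qed.

Lemma kd_addf n f g (c : koz n V) :
  kd (fun k => f k + g k) c = kd f c + kd g c.
Proof.
elim: n f g c => [|n IH] f g c /=; first by rewrite addr0.
congr (_, _); rewrite /= ?IH //.
by rewrite scalerDl opprD addrACA.
Qed.

Lemma kd_scalef n r f (c : koz n V) : kd (fun k => r * f k) c = r *: kd f c.
Proof.
elim: n f c => [|n IH] f c /=; first by rewrite scaler0.
congr (_, _); rewrite /= ?IH //.
by rewrite scalerBr scalerA.
Qed.

Lemma kd_eqf n f g (c : koz n V) :
  (forall k, (k < n)%N -> f k = g k) -> kd f c = kd g c.
Proof.
elim: n f g c => [|n IH] f g c //= h.
by rewrite h // !(IH _ (fun k => g k.+1)) // => k hk; apply: h.
Qed.

Lemma kd_dd n f (c : koz n V) : kd f (kd f c) = 0.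
Proof.
elim: n f c => [|n IH] f c //=; rewrite IH.
by congr (_, _); rewrite linearB linearZ /= IH subr0 subrr.
Qed.

Lemma kdeg0 n p : kdeg p (0 : koz n V).
Proof.
elim: n p => [|n IH] p /=; first by right.
by split=> //; case: p.
Qed.

Lemma pdeg0 n p : pdeg p (0 : koz n V).
Proof. by case: p => //= p; apply: kdeg0. Qed.

Lemma kdeg_lin n p r (c c' : koz n V) :
  kdeg p c -> kdeg p c' -> kdeg p (r *: c + c').
Proof.
elim: n p c c' => [|n IH] p c c' /=.
  by case=> [->|->]; [left|case=> [->|->]; [left|rewrite scaler0 addr0; right]].
move=> [h1 h2] [h1' h2']; split; first exact: IH.
by case: p h2 h2' {h1 h1'} => [-> ->|p]; [rewrite scaler0 addr0|apply: IH].
Qed.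

Lemma pdeg_lin n p r (c c' : koz n V) :
  pdeg p c -> pdeg p c' -> pdeg p (r *: c + c').
Proof.
by case: p => [-> ->|p]; [rewrite /= scaler0 addr0 | apply: kdeg_lin].
Qed.

Lemma kdegD n p (c c' : koz n V) : kdeg p c -> kdeg p c' -> kdeg p (c + c').
Proof. by move=> h h'; rewrite -[c]scale1r; apply: kdeg_lin. Qed.
Lemma kdegZ n p r (c : koz n V) : kdeg p c -> kdeg p (r *: c).
Proof. by move=> h; rewrite -[_ *: _]addr0; apply: kdeg_lin => //; apply: kdeg0. Qed.
Lemma kdegB n p (c c' : koz n V) : kdeg p c -> kdeg p c' -> kdeg p (c - c').
Proof. by move=> h h'; rewrite addrC -scaleN1r; apply: kdeg_lin. Qed.
Lemma pdegD n p (c c' : koz n V) : pdeg p c -> pdeg p c' -> pdeg p (c + c').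
Proof. by move=> h h'; rewrite -[c]scale1r; apply: pdeg_lin. Qed.
Lemma pdegZ n p r (c : koz n V) : pdeg p c -> pdeg p (r *: c).
Proof. by move=> h; rewrite -[_ *: _]addr0; apply: pdeg_lin => //; apply: pdeg0. Qed.
Lemma pdegB n p (c c' : koz n V) : pdeg p c -> pdeg p c' -> pdeg p (c - c').
Proof. by move=> h h'; rewrite addrC -scaleN1r; apply: pdeg_lin. Qed.

Lemma kdeg_kd n p f (c : koz n V) : kdeg p c -> kdeg p.+1 (kd f c).
Proof.
elim: n p f c => [|n IH] p f c /=; first by right.
move=> [h1 h2]; split; first exact: IH.
apply: kdegB; first exact: kdegZ.
by case: p h2 {h1} => [->|p /IH] //; rewrite linear0; apply: kdeg0.
Qed.

Lemma pdeg_kd n p f (c : koz n V) : pdeg p c -> kdeg p (kd f c).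
Proof. by case: p => [->|p]; [rewrite linear0; apply: kdeg0|apply: kdeg_kd]. Qed.

Lemma kdeg_big n p (c : koz n V) : kdeg p c -> (n < p)%N -> c = 0.
Proof.
elim: n p c => [|n IH] p c /=; first by case=> // ->.
case: c => a b /= [h1 h2] hp.
rewrite (IH _ _ h1) ?(ltn_trans _ hp) //.
by case: p h2 hp {h1} => // p /IH h2 hp; rewrite h2.
Qed.

Lemma kin_lin n U r (c c' : koz n V) : submod U ->
  kin U c -> kin U c' -> kin U (r *: c + c').
Proof.
move=> hU; elim: n c c' => [|n IH] c c' /=; first exact: hU.2.
by move=> [h1 h2] [h1' h2']; split; apply: IH.
Qed.
Lemma kin0 n U : submod U -> kin U (0 : koz n V).
Proof. by move=> hU; elim: n => [|n IH] /=; [case: hU|split]. Qed.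
Lemma kinD n U (c c' : koz n V) : submod U ->
  kin U c -> kin U c' -> kin U (c + c').
Proof. by move=> hU h h'; rewrite -[c]scale1r; apply: kin_lin. Qed.
Lemma kinZ n U r (c : koz n V) : submod U -> kin U c -> kin U (r *: c).
Proof. by move=> hU h; rewrite -[_ *: _]addr0; apply: kin_lin => //; apply: kin0. Qed.
Lemma kinB n U (c c' : koz n V) : submod U ->
  kin U c -> kin U c' -> kin U (c - c').
Proof. by move=> hU h h'; rewrite addrC -scaleN1r; apply: kin_lin. Qed.
Lemma kin_kd n U f (c : koz n V) : submod U -> kin U c -> kin U (kd f c).
Proof.
move=> hU; elim: n f c => [|n IH] f c /=; first by case: hU.
by move=> [h1 h2]; split; [apply: IH|apply: kinB => //; [apply: kinZ|apply: IH]].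
Qed.
Lemma kin_imp n (U U' : V -> Prop) (c : koz n V) :
  (forall u, U u -> U' u) -> kin U c -> kin U' c.
Proof.
by move=> h; elim: n c => [|n IH] c /=; [apply: h|case=> h1 h2; split; apply: IH].
Qed.
Lemma kin_true n (U : V -> Prop) (c : koz n V) : (forall u, U u) -> kin U c.
Proof. by move=> h; elim: n c => //= n IH c; split. Qed.

Lemma Hvan_iff f n p (U U' : V -> Prop) :
  (forall u, U u <-> U' u) -> Hvan f n p U -> Hvan f n p U'.
Proof.
move=> h hv c cU cd c0.
have [|b [b1 b2 b3]] := hv c _ cd c0; first by apply: kin_imp cU => u /h.
by exists b; split=> //; apply: kin_imp b1 => u /h.
Qed.

Lemma Hvan_eqf f g n p (U : V -> Prop) :
  (forall k, (k < n)%N -> f k = g k) -> Hvan f n p U -> Hvan g n p U.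
Proof.
move=> h hv c cU cd; rewrite -(kd_eqf _ h) => c0.
by have [b [b1 b2 b3]] := hv c cU cd c0; exists b; rewrite -(kd_eqf _ h).
Qed.

Definition kcons (a : R) (f : nat -> R) (k : nat) : R :=
  if k is k'.+1 then f k' else a.

(* Top-degree cochains are elements of V, and the coboundaries among them are
   the elements of the submodule generated by f 0, ..., f (n-1). *)
Fixpoint ktop n : koz n V -> V :=
  match n return koz n V -> V with
  | 0 => id
  | n'.+1 => fun c => @ktop n' c.2
  end.

Definition inideal (f : nat -> R) n (U : V -> Prop) (v : V) : Prop :=
  exists2 g : nat -> V, (forall k, U (g k)) & v = \sum_(k < n) f k *: g k.

Lemma ktop_lin n r (c c' : koz n V) : ktop (r *: c + c') = r *: ktop c + ktop c'.
Proof. by elim: n c c' => [|n IH] c c' //=; rewrite IH. Qed.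

Lemma ktop_sub n (c c' : koz n V) : ktop (c - c') = ktop c - ktop c'.
Proof. by rewrite addrC -scaleN1r ktop_lin scaleN1r addrC. Qed.

Lemma ktopZ n r (c : koz n V) : ktop (r *: c) = r *: ktop c.
Proof. by elim: n c => [|n IH] c //=; rewrite IH. Qed.

Lemma ktop_eq0 n (c : koz n V) : kdeg n c -> ktop c = 0 -> c = 0.
Proof.
elim: n c => [|n IH] // -[a b] /= [d1 d2] h.
by rewrite (kdeg_big d1) // (IH _ d2 h).
Qed.

Lemma kin_top n U (c : koz n V) : kin U c -> U (ktop c).
Proof. by elim: n c => [|n IH] c //= [_ /IH]. Qed.

Lemma ktop_surj n (U : V -> Prop) v : submod U -> U v ->
  exists c : koz n V, [/\ kin U c, kdeg n c & ktop c = v].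
Proof.
move=> hU vU; elim: n => [|n [c [c1 c2 c3]]]; first by exists v; split => //; left.
by exists (0, c) => /=; split=> //; split=> //; [apply: kin0|apply: kdeg0].
Qed.

Lemma ktop_kd f n (U : V -> Prop) (c : koz n V) : submod U -> kin U c ->
  inideal f n U (ktop (kd f c)).
Proof.
move=> hU; elim: n f c => [|n IH] f c /=.
  by exists (fun=> 0); [case: hU|rewrite big_ord0].
move=> [h1 h2]; rewrite ktop_sub ktopZ.
have [g gU ->] := IH (fun k => f k.+1) _ h2.
exists (fun k => if k is k'.+1 then - g k' else ktop c.1).
  by case=> [|k]; [apply: kin_top|apply: submodN].
rewrite big_ord_recl /=; congr (_ + _).
by rewrite -sumrN; apply: eq_bigr => i _; rewrite scalerN.
Qed.

Lemma ktop_kd_surj f n (U : V -> Prop) (v : V) : submod U -> inideal f n U v ->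
  exists b : koz n V, [/\ kin U b, pdeg n b, kdeg n (kd f b) & ktop (kd f b) = v].
Proof.
move=> hU [g gU ->]; elim: n f g gU => [|n IH] f g gU /=.
  exists 0; split; [by case: hU|by []|by right|by rewrite big_ord0].
have [|b [b1 b2 b3 b4]] := IH (fun k => f k.+1) (fun k => - g k.+1).
  by move=> k; apply: submodN.
have [a [a1 a2 a3]] := ktop_surj n hU (gU 0%N).
have dab : kdeg n ((a, b) : koz n.+1 V).
  by split=> //; case: n b b2 {IH b1 b3 b4 a a1 a2 a3} => [|n] b.
exists (a, b); split=> //.
  exact: (@kdeg_kd n.+1 n f (a, b) dab).
rewrite ktop_sub ktopZ a3 b4 big_ord_recl /=; congr (_ + _).
by rewrite -sumrN; apply: eq_bigr => i _; rewrite scalerN opprK.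
Qed.

End Basic.
End Koszul.

Lemma kin00 (R : comNzRingType) (V : lmodType R) n (U : V -> Prop) :
  U 0 -> kin U (0 : koz n V).
Proof. by move=> h; elim: n => [|n IH] //=. Qed.

Section KozMap.
Variables (R R' : comNzRingType) (V : lmodType R) (W : lmodType R').

Fixpoint kmap n (phi : V -> W) : koz n V -> koz n W :=
  match n return koz n V -> koz n W with
  | 0 => phi
  | n'.+1 => fun c => (@kmap n' phi c.1, @kmap n' phi c.2)
  end.

(** Additivity on U only: [zieg] contains an exact division and is additive only on forms whose
    values on H are divisible by alpha_H. The base rings differ because restriction leads from S to
    the coordinate ring of H. *)
Definition kadd (U : V -> Prop) (phi : V -> W) : Prop :=
  forall u v, U u -> U v -> phi (u - v) = phi u - phi v.

Lemma kadd0 U phi : submod U -> kadd U phi -> phi 0 = 0.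
Proof. by move=> [h0 _] /(_ 0 0 h0 h0); rewrite subr0 subrr. Qed.

Lemma kmap0 n phi : phi 0 = 0 -> kmap phi (0 : koz n V) = 0.
Proof. by move=> h; elim: n => [|n IH] //=; rewrite IH. Qed.

Lemma kmap_sub n U phi (c c' : koz n V) : kadd U phi ->
  kin U c -> kin U c' -> kmap phi (c - c') = kmap phi c - kmap phi c'.
Proof.
move=> h; elim: n c c' => [|n IH] c c' /=; first exact: h.
by move=> [h1 h2] [h1' h2']; rewrite !IH.
Qed.

Lemma kmap_scale n U phi psi r r' (c : koz n V) :
  (forall u, U u -> psi (r *: u) = r' *: phi u) ->
  kin U c -> kmap psi (r *: c) = r' *: kmap phi c.
Proof.
move=> h; elim: n c => [|n IH] c /=; first exact: h.
by move=> [h1 h2]; rewrite !IH.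
Qed.

(** There are two maps, [phi] before and [psi] after multiplication by f_k, because the component of
    degree d of f_k u is f_k times the component of degree d - e of u when f_k has degree e. *)
Lemma kmap_kd2 n U phi psi f f' (c : koz n V) : submod U -> kadd U psi ->
  (forall k u, (k < n)%N -> U u -> psi (f k *: u) = f' k *: phi u) ->
  kin U c -> kmap psi (kd f c) = kd f' (kmap phi c).
Proof.
move=> hU ha; elim: n f f' c => [|n IH] f f' c hs /=; first by rewrite (kadd0 hU ha).
move=> [h1 h2]; congr (_, _).
  by apply: IH => // k u hk; apply: hs.
rewrite /= (kmap_sub ha) //; last 2 first.
- exact: kinZ.
- exact: kin_kd.
rewrite (IH _ (fun k => f' k.+1)) //; last by move=> k u hk; apply: hs.
by congr (_ - _); apply: (kmap_scale (U := U)) => // u; apply: hs.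
Qed.

Lemma kdeg_kmap n p phi (c : koz n V) : phi 0 = 0 ->
  kdeg p c -> kdeg p (kmap phi c).
Proof.
move=> h0; elim: n p c => [|n IH] p c /=; first by case=> [|->]; [left|right].
move=> [h1 h2]; split; first exact: IH.
by case: p h2 {h1} => [->|p /IH //]; apply: kmap0.
Qed.

Lemma pdeg_kmap n p phi (c : koz n V) : phi 0 = 0 ->
  pdeg p c -> pdeg p (kmap phi c).
Proof. by move=> h; case: p => [->|p]; [apply: kmap0|apply: kdeg_kmap]. Qed.

Lemma kin_kmap n U (U' : W -> Prop) phi (c : koz n V) :
  (forall u, U u -> U' (phi u)) -> kin U c -> kin U' (kmap phi c).
Proof.
by move=> h; elim: n c => [|n IH] c /=; [apply: h|case=> h1 h2; split; apply: IH].
Qed.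

Lemma kmap_eq0 n U phi (c : koz n V) : kin U c -> kmap phi c = 0 ->
  kin (fun u => U u /\ phi u = 0) c.
Proof.
elim: n c => [|n IH] c //= [h1 h2] [e1 e2].
by split; apply: IH.
Qed.

Lemma kmap_lift n p U (U' : W -> Prop) phi (c : koz n W) :
  U 0 -> phi 0 = 0 -> (forall w, U' w -> exists2 u, U u & phi u = w) ->
  kin U' c -> kdeg p c ->
  exists c', [/\ kin U c', kdeg p c' & kmap phi c' = c].
Proof.
move=> h0 p0 h; have z0 m : kin U (0 : koz m V).
  by elim: m => [|m IH] //=.
elim: n p c => [|n IH] p c /=.
  move=> cU [->|->].
    by have [u uU uc] := h _ cU; exists u; split=> //; left.
  by exists 0; split=> //; right.
move=> [h1 h2] [d1 d2]; have [a [a1 a2 a3]] := IH _ _ h1 d1.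
case: p d2 d1 a2 => [c20|p d2] d1 a2.
  exists (a, 0); split => //=; rewrite a3 kmap0 // -c20.
  by case: (c).
have [b [b1 b2 b3]] := IH _ _ h2 d2.
by exists (a, b); split => //=; rewrite a3 b3; case: (c).
Qed.

Lemma kmap_lift_p n p U (U' : W -> Prop) phi (c : koz n W) :
  U 0 -> phi 0 = 0 -> (forall w, U' w -> exists2 u, U u & phi u = w) ->
  kin U' c -> pdeg p c ->
  exists c', [/\ kin U c', pdeg p c' & kmap phi c' = c].
Proof.
move=> h0 p0 h cU; case: p => [->|p] /=; last exact: (kmap_lift h0 p0 h).
exists 0; split=> //; last exact: kmap0.
by elim: n {c cU} => [|m IH] //=.
Qed.

Section LES.
Variables (n : nat) (f : nat -> R) (g : nat -> R').
Variables (U : V -> Prop) (U' : W -> Prop) (phi : V -> W).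
Hypotheses (sU : submod U) (aphi : kadd U phi)
  (sphi : forall k u, (k < n)%N -> U u -> phi (f k *: u) = g k *: phi u)
  (surj : forall w, U' w -> exists2 u, U u & phi u = w)
  (into : forall u, U u -> U' (phi u)).

Definition kker (u : V) : Prop := U u /\ phi u = 0.

Let phi0 : phi 0 = 0. Proof. exact: (kadd0 sU aphi). Qed.

Lemma kmap_kker m (b : koz m V) : kin kker b -> kmap phi b = 0.
Proof.
elim: m b => [|m IH] e /=; first by case.
by move=> [h1 h2]; rewrite !IH.
Qed.

(** The stretch H^p(U) -> H^p(U') -> H^(p+1)(ker) of the long exact sequence, written out on
    cochains since [phi] respects the operations only on U. *)
Lemma Hvan_coker p : Hvan f n p U -> Hvan f n p.+1 kker -> Hvan g n p U'.
Proof.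
move=> hp hk c cU cd c0.
have [a [aU ad ac]] := kmap_lift sU.1 phi0 surj cU cd.
have da0 : kmap phi (kd f a) = 0 by rewrite (kmap_kd2 sU aphi sphi aU) ac.
have [b [bK bd eb]] := hk (kd f a) (kmap_eq0 (kin_kd f sU aU) da0)
  (kdeg_kd f ad) (kd_dd f a).
have bU : kin U b by apply: kin_imp bK => u [].
have dab : kd f (a - b) = 0 by rewrite linearB /= eb subrr.
have [e [eU ed ee]] := hp (a - b) (kinB sU aU bU) (kdegB ad bd) dab.
exists (kmap phi e); split.
- exact: kin_kmap eU.
- exact: pdeg_kmap.
- rewrite -(kmap_kd2 sU aphi sphi eU) ee (kmap_sub aphi) //.
  by rewrite ac (kmap_kker bK) subr0.
Qed.

(** The stretch H^(p-1)(U') -> H^p(ker) -> H^p(U). Quantifying over p' with p = p' + 1 leaves no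
    condition on U' when p = 0. *)
Lemma Hvan_ker p : Hvan f n p U -> (forall p', p = p'.+1 -> Hvan g n p' U') ->
  Hvan f n p kker.
Proof.
move=> hp hp' c cK cd c0.
have cU : kin U c by apply: kin_imp cK => u [].
have [b [bU bd eb]] := hp c cU cd c0.
have db0 : kd g (kmap phi b) = 0.
  by rewrite -(kmap_kd2 sU aphi sphi bU) eb; apply: kmap_kker.
case: p hp hp' cd bd => [|p] hp hp' cd bd.
  exists 0; split=> //; last by rewrite -eb bd.
  by apply: kin00; split=> //; case: sU.
have [e' [eU' ed' ee']] := hp' p erefl _ (kin_kmap into bU) (kdeg_kmap phi0 bd) db0.
have [e [eU ed ee]] := kmap_lift_p sU.1 phi0 surj eU' ed'.
have mde : kmap phi (kd f e) = kmap phi b by rewrite (kmap_kd2 sU aphi sphi eU) ee.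
exists (b - kd f e); split.
- apply: kmap_eq0; first by apply: kinB => //; apply: kin_kd.
  by rewrite (kmap_sub aphi) ?mde ?subrr //; apply: kin_kd.
- by apply: (@pdegB _ _ _ p.+1) => //; apply: pdeg_kd.
- by rewrite linearB /= kd_dd subr0.
Qed.

(* [a] acts injectively on U and U / aU embeds in U' through phi; then the
   cohomology of (a, f) on U is that of f on U', shifted by one. *)
Lemma Hvan_cone a p :
  (forall u, U u -> a *: u = 0 -> u = 0) ->
  (forall u, U u -> phi (a *: u) = 0) ->
  (forall u, U u -> phi u = 0 -> exists2 v, U v & u = a *: v) ->
  (forall p', p = p'.+1 -> Hvan g n p' U') ->
  Hvan (kcons a f) n.+1 p U.
Proof.
move=> reg za kera hp [x y] [xU yU] [xd yd] [dx0 /eqP].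
rewrite -/(kd _ _) subr_eq0 => /eqP /= axy.
have inj m (c : koz m V) : kin U c -> a *: c = 0 -> c = 0.
  elim: m c => [|m IH] c /=; first exact: reg.
  case: c => c c' [h1 h2] [e1 e2]; congr (_, _); exact: IH.
case: p hp xd yd => [|p] hp /= xd yd.
  have x0 : x = 0 by apply: inj => //; rewrite axy yd linear0.
  by exists 0; split=> //; [split; apply: kin0|rewrite x0 yd !linear0 addr0].
have zmap m (c : koz m V) : kin U c -> kmap phi (a *: c) = 0.
  by elim: m c => [|m IH] c /=; [exact: za|move=> [h1 h2]; rewrite !IH].
have lifta m q (c : koz m V) : kin U c -> kdeg q c -> kmap phi c = 0 ->
    exists d, [/\ kin U d, kdeg q d & c = a *: d].
  elim: m q c => [|m IH] q c /=.
    move=> cU [->|-> _]; last by exists 0; split; [case: sU|right|rewrite scaler0].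
    by move=> /(kera _ cU)[v vU ->]; exists v; split => //; left.
  case: c => c c' /= [h1 h2] [d1 d2] [e1 e2].
  have [d [dU dd ->]] := IH q c h1 d1 e1.
  case: q d1 dd d2 => [|q] d1 dd d2.
    by exists (d, 0); split=> //=; [split=> //; apply: kin0|rewrite d2 -[LHS]/(_, _); congr (_, _); rewrite scaler0].
  have [d' [dU' dd' ->]] := IH q c' h2 d2 e2.
  by exists (d, d').
(* Modulo a, the component y is a cocycle on U', so y = d e + a b. Applying d and cancelling a in a
   x = d y gives x = d b. *)
have dy0 : kd g (kmap phi y) = 0.
  by rewrite -(kmap_kd2 sU aphi sphi yU) -axy; apply: zmap.
have [e' [eU' ed' ee']] := hp p erefl _ (kin_kmap into yU) (kdeg_kmap phi0 yd) dy0.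
have [e [eU ed ee]] := kmap_lift_p sU.1 phi0 surj eU' ed'.
have yde : kmap phi (y - kd f e) = 0.
  rewrite (kmap_sub aphi) //; last exact: kin_kd.
  by rewrite (kmap_kd2 sU aphi sphi eU) ee ee' subrr.
have [b [bU bd be]] := lifta _ _ _ (kinB sU yU (kin_kd f sU eU))
  (kdegB yd (pdeg_kd f ed)) yde.
have xdb : x = kd f b.
  apply/eqP; rewrite -subr_eq0; apply/eqP; apply: inj.
    by apply: kinB => //; apply: kin_kd.
  by rewrite scalerBr -linearZ /= -be linearB /= kd_dd subr0 axy subrr.
exists (b, - e); split => //=.
- by split=> //; rewrite -scaleN1r; apply: kinZ.
- by split=> //; rewrite -scaleN1r; exact: (pdegZ (-1) ed).
- rewrite -xdb; congr (_, _).
  by rewrite linearN opprK -be subrK.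
Qed.

End LES.

Lemma Hvan_iso n (f : nat -> R) (g : nat -> R') (U : V -> Prop) (U' : W -> Prop)
    (phi : V -> W) p : submod U -> kadd U phi ->
  (forall k u, (k < n)%N -> U u -> phi (f k *: u) = g k *: phi u) ->
  (forall w, U' w -> exists2 u, U u & phi u = w) ->
  (forall u, U u -> U' (phi u)) ->
  (forall u, U u -> phi u = 0 -> u = 0) ->
  Hvan f n p U -> Hvan g n p U'.
Proof.
move=> sU aphi sphi surj into inj hp; apply: (Hvan_coker sU aphi sphi surj into hp).
apply: (@Hvan_iff _ _ _ _ _ (fun u => u = 0)).
  move=> u; split; first by move=> ->; split; [case: sU|exact: kadd0 aphi].
  by move=> [uU u0]; apply: inj.
move=> c c0 _ _; suff -> : c = 0 by exists 0; split; [apply: kin00|apply: pdeg0|rewrite linear0].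
elim: n c c0 {sphi hp} => [|n IH] //= [a b] [a0 b0].
by move: (IH _ a0) (IH _ b0) => /= -> ->.
Qed.

End KozMap.

(** * Cohomology of modules of finite projective dimension *)

Section HvanFree.
Import freeg.
Variable R : comNzRingType.
Implicit Types (f : nat -> R) (n p : nat).

Lemma submodT (V : lmodType R) : submod (fun _ : V => True).
Proof. by []. Qed.

Lemma Hvan_zero f n p (V : lmodType R) (U : V -> Prop) :
  submod U -> (forall u, U u -> u = 0) -> Hvan f n p U.
Proof.
move=> sU h c cU _ _; exists 0; split; [exact: kin0|exact: pdeg0|].
rewrite linear0; elim: n c cU => [|n IH] c /=; first by move=> /h ->.
by case: c => a b /= [/IH <- /IH <-].
Qed.

Lemma Hvan_ext f n p (V W : lmodType R) (U : V -> Prop) (U' : W -> Prop)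
    (phi : V -> W) : submod U -> kadd U phi ->
  (forall k u, (k < n)%N -> U u -> phi (f k *: u) = f k *: phi u) ->
  (forall w, U' w -> exists2 u, U u & phi u = w) ->
  (forall u, U u -> U' (phi u)) ->
  Hvan f n p (kker U phi) -> Hvan f n p U' -> Hvan f n p U.
Proof.
move=> sU aphi sphi surj into hK hU' c cU cd c0.
have phi0 : phi 0 = 0 by exact: kadd0 aphi.
have d0 : kd f (kmap phi c) = 0.
  by rewrite -(kmap_kd2 sU aphi sphi cU) c0 kmap0.
have [e' [eU' ed' ee']] := hU' _ (kin_kmap into cU) (kdeg_kmap phi0 cd) d0.
have [e [eU ed ee]] := kmap_lift_p sU.1 phi0 surj eU' ed'.
have k0 : kmap phi (c - kd f e) = 0.
  rewrite (kmap_sub aphi) //; last exact: kin_kd.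
  by rewrite (kmap_kd2 sU aphi sphi eU) ee ee' subrr.
have [|||b [bK bd be]] := hK (c - kd f e).
- by apply: kmap_eq0 k0; apply: kinB => //; apply: kin_kd.
- by apply: kdegB => //; apply: pdeg_kd.
- by rewrite linearB /= kd_dd c0 subrr.
exists (b + e); split.
- by apply: kinD => //; apply: kin_imp bK => u [].
- exact: pdegD.
- by rewrite linearD /= be subrK.
Qed.

Lemma Hvan_prod f n p (V W : lmodType R) (U : V -> Prop) (U' : W -> Prop) :
  submod U -> submod U' -> Hvan f n p U -> Hvan f n p U' ->
  Hvan f n p (fun c : (V * W)%type => U c.1 /\ U' c.2).
Proof.
move=> sU sU' h h'.
have sP : submod (fun c : (V * W)%type => U c.1 /\ U' c.2).
  split=> [|r u v [u1 u2] [v1 v2]]; first by split; [case: sU|case: sU'].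
  by split; [apply: sU.2|apply: sU'.2].
apply: (@Hvan_ext _ _ _ _ _ _ U' snd sP) => //.
- by move=> w wU; exists (0, w) => //; split=> //; case: sU.
- by move=> u [].
apply: (@Hvan_iso _ _ V _ n f f U _ (fun u => (u, 0)) p sU) => //.
- by move=> u v _ _; congr (_, _); rewrite subr0.
- by move=> k u _ _; congr (_, _); rewrite scaler0.
- move=> [v w] [[/= vU wU] w0]; exists v => //; congr (_, _); exact: esym.
- by move=> u uU; split=> //; split=> //; case: sU'.
- by move=> u _ [].
Qed.

(* f_0, ..., f_(n-1) generate an ideal of depth at least g, tested on Koszul
   cohomology. *)
Definition good f n g : Prop := forall p, (p < g)%N -> Hvan f n p (fun _ : R^o => True).

Lemma Hvan_rV f n p m : Hvan f n p (fun _ : R^o => True) ->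
  Hvan f n p (fun _ : 'rV[R]_m => True).
Proof.
move=> h; elim: m => [|m IH].
  by apply: Hvan_zero => // u _; rewrite thinmx0.
pose phi (c : (R^o * 'rV[R]_m)%type) : 'rV[R]_m.+1 := row_mx (c.1%:M : 'rV_1) c.2.
apply: (@Hvan_iso _ _ _ _ n f f _ _ phi p _ _ _ _ _ _
  (Hvan_prod (submodT _) (submodT _) h IH)) => //.
- move=> u v _ _; apply/rowP=> i; rewrite /phi !mxE.
  by case: splitP => j _; rewrite !mxE // mulrnBl.
- move=> k u _ _; apply/rowP=> i; rewrite /phi !mxE.
  by case: splitP => j _; rewrite !mxE // mulrnAr.
- move=> w0 _; pose w : 'rV[R]_m.+1 := w0.
  exists (w 0 0, \row_i w 0 (fintype.lift 0 i)) => //; rewrite -/w -[RHS]/w.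
  apply/rowP=> i; rewrite /phi /= mxE; case: splitP => j /= ij.
    by rewrite !ord1 mxE mulr1n; congr (w _ _); apply: val_inj; rewrite /= ij ord1.
  by rewrite mxE; congr (w _ _); apply: val_inj; rewrite /= ij.
- move=> [a b] _; rewrite /phi /= => /(congr1 (fun M : 'M_(1, 1 + m) => (lsubmx M, rsubmx M))).
  rewrite row_mxKl row_mxKr linear0 linear0 => -[/matrixP/(_ 0 0)].
  by rewrite !mxE mulr1n => -> ->.
Qed.

(* Lambda^q of a free module of rank m. *)
Lemma Hvan_kdeg f n p q m : Hvan f n p (fun _ : R^o => True) ->
  Hvan f n p (fun c : koz m R^o => kdeg q c).
Proof.
have sk i j : submod (fun c : koz i R^o => kdeg j c).
  by split; [apply: kdeg0|apply: kdeg_lin].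
move=> h; elim: m q => [|m IH] q.
  case: q => [|q]; last by apply: Hvan_zero => [|u []//]; apply: sk 0%N q.+1.
  by apply: Hvan_iff h => u; split=> // _; left.
case: q => [|q]; last exact: (Hvan_prod (sk m q.+1) (sk m q) (IH q.+1) (IH q)).
have s0 : submod (fun c : koz m R^o => c = 0).
  by split=> // r u v -> ->; rewrite scaler0 addr0.
have h0 : Hvan f n p (fun c : koz m R^o => c = 0) by apply: Hvan_zero.
exact: (Hvan_prod (sk m 0%N) s0 (IH 0%N) h0).
Qed.

Lemma fglift_linear (K : choiceType) (M : lmodType R) (h : K -> M) :
  linear (fglift h : {freeg K / R} -> M).
Proof.
have addh : additive (fglift h : {freeg K / R} -> M) by exact: lift_is_additive.
pose phi := GRing.isZmodMorphism.Build _ _ (fglift h : {freeg K / R} -> M) addh.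
pose F : {additive {freeg K / R} -> M} := HB.pack (fglift h : {freeg K / R} -> M) phi.
move=> r u v; rewrite -[LHS]/(F _) raddfD; congr (_ + _).
rewrite -[in LHS](freeg_sumE u) -[in RHS](freeg_sumE u) scaler_sumr -/(F _).
rewrite -[RHS]/(r *: F _) !raddf_sum; apply: eq_bigr => z _.
have -> : r *: << coeff z u *g z >> = << r * coeff z u *g z >> :> {freeg K / R}.
  by apply/eqP/freeg_eqP => x; rewrite coeffZ !coeffU mulrA.
by rewrite /= !liftU scalerA.
Qed.

(** Infinite rank has to be covered because [pd_le] allows arbitrary projective modules. The
    finitely many components of a cochain have finite supports, so it lives over the free module of
    finite rank on their union [s]. *)
Lemma Hvan_freeg f n p (K : choiceType) : Hvan f n p (fun _ : R^o => True) ->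
  Hvan f n p (fun _ : {freeg K / R} => True).
Proof.
move=> h c _ cd c0.
pose U (s : seq K) (u : {freeg K / R}) := {subset dom u <= s}.
have [s us cs] : exists2 s, uniq s & kin (U s) c.
  have mono m s s' (d : koz m {freeg K / R}) : {subset s <= s'} -> kin (U s) d -> kin (U s') d.
    by move=> ss; apply: kin_imp => u us x /us /ss.
  elim: (n) (c) => [|m IH] d; first by exists (dom d) => //; apply: uniq_dom.
  have [s us h1] := IH d.1; have [s' us' h2] := IH d.2.
  exists (undup (s ++ s')); first exact: undup_uniq.
  by split; [apply: mono h1|apply: mono h2] => x xs; rewrite mem_undup mem_cat xs ?orbT.
pose phi (r : 'rV[R]_(size s)) : {freeg K / R} := \sum_i r 0 i *: << tnth (in_tuple s) i >>.
have cphi r k : coeff k (phi r) = \sum_i r 0 i * (tnth (in_tuple s) i == k)%:R.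
  by rewrite raddf_sum; apply: eq_bigr => i _; rewrite /= coeffZ coeffU mul1r.
have tinj i j : (tnth (in_tuple s) i == tnth (in_tuple s) j) = (i == j).
  by apply: inj_eq; apply/tuple_uniqP.
have cphi' r j : coeff (tnth (in_tuple s) j) (phi r) = r 0 j.
  rewrite cphi (bigD1 j) //= eqxx mulr1 big1 ?addr0 // => i /negPf ij.
  by rewrite tinj ij mulr0.
have [|||||b [bU bd be]] := @Hvan_iso _ _ _ _ n f f _ (U s) phi p (submodT _)
  _ _ _ _ _ (@Hvan_rV f n p (size s) h) c cs cd c0.
- move=> u v _ _; rewrite -sumrB; apply: eq_bigr => i _.
  by rewrite !mxE scalerBl.
- move=> k u _ _; rewrite scaler_sumr; apply: eq_bigr => i _.
  by rewrite !mxE scalerA.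
- move=> w ws; exists (\row_i coeff (tnth (in_tuple s) i) w) => //.
  apply/eqP/freeg_eqP => k; case: (boolP (k \in s)) => ks.
    by have /tnthP[j ->] : k \in in_tuple s by []; rewrite cphi' mxE.
  have kw : coeff k w = 0 by apply: coeff_outdom; apply: contra ks; apply: ws.
  rewrite kw cphi big1 // => i _; case: eqP => [ki|_]; last by rewrite mulr0.
  by case/negP: ks; rewrite -ki; apply: mem_tnth.
- move=> u _ x; apply: contraLR => xs; rewrite mem_dom negbK cphi.
  rewrite big1 // => i _; case: eqP => [ki|_]; last by rewrite mulr0.
  by case/negP: xs; rewrite -ki; apply: mem_tnth.
- by move=> u _ u0; apply/rowP=> j; rewrite -cphi' u0 coeff0 mxE.
by exists b; split=> //; apply: kin_true.
Qed.

(** The free module on the set of elements of P maps onto P, and projectivity splits this map: P is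
    a retract of a module covered by [Hvan_freeg]. *)
Lemma Hvan_projective f n p (P : lmodType R) :
  is_projective P -> Hvan f n p (fun _ : R^o => True) ->
  Hvan f n p (fun _ : P => True).
Proof.
move=> projP h c _ cd c0.
pose g0 : {freeg P / R} -> P := fglift id.
pose gm := GRing.isLinear.Build R {freeg P / R} P _ g0 (fglift_linear id).
pose g : {linear {freeg P / R} -> P} := HB.pack g0 gm.
have [|s sE] := projP {freeg P / R} P g idfun.
  by move=> y; exists << y >>; rewrite /= /g0 liftU scale1r.
have d0 : kd f (kmap s c) = 0.
  rewrite -(@kmap_kd2 _ _ _ _ n (fun=> True) s s f f) //.
  - by rewrite c0; apply: kmap0; rewrite linear0.
  - by move=> u v _ _; rewrite linearB.
  - by move=> k u _ _; rewrite linearZ.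
  - exact: kin_true.
have [b [_ bd be]] := Hvan_freeg h (kin_true _ (fun=> I)) (kdeg_kmap (linear0 _) cd) d0.
exists (kmap g b); split; [exact: kin_true|by apply: pdeg_kmap => //; rewrite linear0|].
rewrite -(@kmap_kd2 _ _ _ _ n (fun=> True) g g f f) //.
- rewrite be; elim: (n) (c) => [|m IH] d /=; first exact: sE.
  by rewrite !IH; case: d.
- by move=> u v _ _; rewrite linearB.
- by move=> k u _ _; rewrite linearZ.
- exact: kin_true.
Qed.

Lemma kerim_submod (M N : lmodType R) (h : {linear M -> N}) :
  submod (fun y => exists x, h x = y).
Proof.
split; first by exists 0; rewrite linear0.
by move=> r u v [x <-] [y <-]; exists (r *: x + y); rewrite linearP.
Qed.

Lemma Hvan_pd_le f n g q (M : lmodType R) : good f n g -> pd_le M q ->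
  forall p, (p + q < g)%N -> Hvan f n p (fun _ : M => True).
Proof.
move=> gf [P [d [eps [projP P0 surj ex0 exS]]]].
have Pv i p : (p < g)%N -> Hvan f n p (fun _ : P i => True).
  by move=> /gf; apply: Hvan_projective.
(* Downward induction from the image of d_q, which is zero because P_(q+1) is. Each step of the
   resolution costs one degree of vanishing. *)
have im_van k : forall i, (i + k = q)%N -> forall p, (p + k <= g)%N ->
    Hvan f n p (fun y => exists x, d i x = y).
  elim: k => [|k IH] i ikq p pg.
    apply: Hvan_zero; first exact: kerim_submod.
    by move=> _ [x <-]; rewrite (P0 i.+1 _ x) ?linear0 //; lia.
  apply: (@Hvan_coker _ _ _ _ n f f _ _ (d i) (submodT _)).
  - by move=> u v _ _; rewrite linearB.
  - by move=> j u _ _; rewrite linearZ.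
  - by move=> _ [x <-]; exists x.
  - by move=> u _; exists u.
  - by apply: Pv; lia.
  - apply: (@Hvan_iff _ _ _ _ _ (fun y => exists x, d i.+1 x = y)).
      by move=> u; split=> [/exS|[_ /exS]].
    by apply: IH; lia.
move=> p pq; apply: (@Hvan_coker _ _ _ _ n f f _ _ eps (submodT _)).
- by move=> u v _ _; rewrite linearB.
- by move=> j u _ _; rewrite linearZ.
- by move=> w _; have [x <-] := surj w; exists x.
- by [].
- by apply: Pv; lia.
- apply: (@Hvan_iff _ _ _ _ _ (fun y => exists x, d 0%N x = y)).
    by move=> u; split=> [/ex0|[_ /ex0]].
  by apply: (im_van q); lia.
Qed.
End HvanFree.

(** * Noetherianity and minimal generators *)

Section Noether.

Definition lspan (R : comNzRingType) (V : lmodType R) (s : seq V) (v : V) : Prop :=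
  exists c : nat -> R, v = \sum_(i < size s) c i *: s`_i.

Definition fgsub (R : comNzRingType) (V : lmodType R) (U : V -> Prop) : Prop :=
  exists2 s : seq V, (forall v, v \in s -> U v) & (forall v, U v -> lspan s v).

Definition noetherian (R : comNzRingType) : Prop :=
  forall I : R^o -> Prop, submod I -> fgsub I.

Section Span.
Variables (R : comNzRingType) (V : lmodType R).
Implicit Types (s : seq V) (U : V -> Prop).

Lemma lspan_submod s : submod (lspan s).
Proof.
split; first by exists (fun=> 0); rewrite big1 // => i _; rewrite scale0r.
move=> r u v [c ->] [d ->]; exists (fun i => r * c i + d i).
rewrite scaler_sumr -big_split; apply: eq_bigr => i _ /=.
by rewrite scalerDl scalerA.
Qed.

Lemma lspan_mem s v : v \in s -> lspan s v.
Proof.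
move=> vs; have lt : (index v s < size s)%N by rewrite index_mem.
exists (fun i => (i == index v s)%:R).
rewrite (bigD1 (Ordinal lt)) //= eqxx scale1r nth_index // big1 ?addr0 // => i.
by rewrite -val_eqE /= => /negPf ->; rewrite scale0r.
Qed.

Lemma lspan_min s U v : submod U -> (forall u, u \in s -> U u) -> lspan s v -> U v.
Proof.
move=> sU sub [c ->]; apply: submod_sum => // i _; apply: submodZ => //.
by apply: sub; apply: mem_nth.
Qed.

End Span.

Lemma noetherian_surj (R R' : comNzRingType) (phi : {rmorphism R -> R'}) :
  (forall y, exists x, phi x = y) -> noetherian R -> noetherian R'.
Proof.
move=> surj nR I sI.
have [|s sI' sg] := nR (fun x : R^o => I (phi x)).
  split; first by rewrite rmorph0; case: sI.
  by move=> r u v hu hv; rewrite rmorphD rmorphM; apply: sI.2.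
exists (map phi s); first by move=> _ /mapP[x /sI' ? ->].
move=> y yI; have [x xy] := surj y.
have [|c xc] := sg x; first by rewrite xy.
exists (fun i => phi (c i)); rewrite -xy xc rmorph_sum size_map.
by apply: eq_bigr => i _; rewrite (nth_map 0) // rmorphM.
Qed.

Lemma noetherian_field (K : fieldType) : noetherian K.
Proof.
move=> I sI; case: (pselect (exists2 x : K, I x & x != 0)) => [[x xI x0]|nI].
  exists [:: (x : K^o)]; first by move=> v; rewrite inE => /eqP ->.
  move=> v _; exists (fun=> v / x); rewrite big_ord_recl big_ord0 addr0 /=.
  by rewrite /GRing.scale /= divfK.
exists [::] => // v vI; exists (fun=> 0); rewrite big_ord0; apply/eqP.
by apply/negPn/negP => v0; apply: nI; exists v.
Qed.

(** Hilbert's basis theorem. If I is not finitely generated, let [P_ k] have least size among the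
    elements of I outside the span of its predecessors. The ideal J of the leading coefficients is
    finitely generated, hence spanned by those of P_0, ..., P_(m-1) for some m; cancelling the
    leading term of [P_ m] then gives a smaller element of I outside the same span. *)
Lemma noetherian_poly (R : comNzRingType) : noetherian R -> noetherian {poly R}.
Proof.
move=> nR I sI; case: (pselect (fgsub I)) => // nfg; exfalso.
have next (s : seq {poly R}) : exists p : {poly R}, (forall v, v \in s -> I v) ->
    [/\ I p, ~ lspan (s : seq {poly R}^o) p &
      forall q : {poly R}, I q -> ~ lspan (s : seq {poly R}^o) q -> (size p <= size q)%N].
  case: (pselect (forall v, v \in s -> I v)) => [sI'|?]; last by exists 0.
  have hd : exists d, `[< exists p : {poly R}, [/\ I p, ~ lspan (s : seq {poly R}^o) p & size p = d] >].
    case: (pselect (exists p : {poly R}, I p /\ ~ lspan (s : seq {poly R}^o) p)) => [[p [pI ps]]|h].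
      by exists (size p); apply/asboolP; exists p.
    case: nfg; exists s => // v vI; case: (pselect (lspan (s : seq {poly R}^o) v)) => // ns.
    by case: h; exists v.
  case: (ex_minnP hd) => m /asboolP[p [pI ps pm]] mmin.
  exists p => _; split=> // q qI qs; rewrite pm; apply: mmin.
  by apply/asboolP; exists q.
have [nx nxP] := choice next.
pose S_ k := iter k (fun s => rcons s (nx s)) [::].
pose P_ k := nx (S_ k).
have SI k : forall v, v \in S_ k -> I v.
  elim: k => [|k IH] v //=; rewrite mem_rcons inE => /orP[/eqP ->|/IH //].
  by have [] := nxP _ IH.
have PI k : I (P_ k) by have [] := nxP _ (SI k).
have PS k : ~ lspan (S_ k : seq {poly R}^o) (P_ k) by have [] := nxP _ (SI k).
have Pmin k q : I q -> ~ lspan (S_ k : seq {poly R}^o) q -> (size (P_ k) <= size q)%N.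
  by have [_ _ h] := nxP _ (SI k); apply: h.
have Ssize k : size (S_ k) = k by elim: k => //= k; rewrite size_rcons => ->.
have Snth k i : (i < k)%N -> (S_ k)`_i = P_ i.
  elim: k => // k IH; rewrite /= nth_rcons Ssize ltnS leq_eqVlt.
  by case: ltnP => [/IH ->|_ /orP[/eqP ->|//]]; rewrite ?eqxx.
have Smon k i : (i < k)%N -> (size (P_ i) <= size (P_ k))%N.
  move=> ik; apply: (Pmin i) => // -[c e]; apply: (PS k).
  have {}e : P_ k = \sum_(j < i) c j * P_ j.
    rewrite [LHS]e Ssize; apply: eq_bigr => j _; rewrite Snth //.
  exists (fun j => if (j < i)%N then c j else 0); rewrite [LHS]e !Ssize.
  rewrite (big_ord_widen_cond k xpredT (fun j => c j * P_ j)) ?(ltnW ik) //=.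
  rewrite big_mkcond; apply: eq_bigr => j _; rewrite Snth //.
  by case: ifP => ji; rewrite ?scale0r.
pose J (x : R^o) := exists k, exists c : nat -> R, x = \sum_(i < k) c i * lead_coef (P_ i).
have Jwiden x k m : (exists c : nat -> R, x = \sum_(i < k) c i * lead_coef (P_ i)) ->
    (k <= m)%N -> exists c : nat -> R, x = \sum_(i < m) c i * lead_coef (P_ i).
  move=> [c ->] km; exists (fun j => if (j < k)%N then c j else 0).
  rewrite (big_ord_widen_cond m xpredT (fun j => c j * lead_coef (P_ j))) //=.
  by rewrite big_mkcond; apply: eq_bigr => j _; case: ifP => //; rewrite mul0r.
have sJ : submod J.
  split; first by exists 0%N, (fun=> 0); rewrite big_ord0.
  move=> r u v [k hk] [m hm]; exists (maxn k m).
  have [c ->] := Jwiden _ _ _ hk (leq_maxl k m).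
  have [d ->] := Jwiden _ _ _ hm (leq_maxr k m).
  exists (fun i => r * c i + d i); rewrite scaler_sumr -big_split.
  by apply: eq_bigr => i _ /=; rewrite mulrDl -mulrA.
have [s sJ' sg] := nR J sJ.
have [m hm] : exists m, forall v, v \in s -> exists c : nat -> R, v = \sum_(i < m) c i * lead_coef (P_ i).
  elim: s sJ' {sg} => [|x s IH] h; first by exists 0%N.
  have [|m hm] := IH; first by move=> v vs; apply: h; rewrite inE vs orbT.
  have [k hk] := h x (mem_head _ _); exists (maxn k m) => v.
  rewrite inE => /orP[/eqP ->|/hm hv]; first exact: Jwiden hk (leq_maxl k m).
  exact: Jwiden hv (leq_maxr k m).
have [c lc] : exists c : nat -> R, lead_coef (P_ m) = \sum_(i < m) c i * lead_coef (P_ i).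
  have Jm : J (lead_coef (P_ m)).
    by exists m.+1, (fun i => (i == m)%:R); rewrite (bigD1 ord_max) //= eqxx mul1r
      big1 ?addr0 // => i; rewrite -val_eqE /= => /negPf ->; rewrite mul0r.
  have [d ->] := sg _ Jm.
  pose T (v : R^o) := exists c : nat -> R, v = \sum_(i < m) c i * lead_coef (P_ i).
  have sT : submod T.
    split; first by exists (fun=> 0); rewrite big1 // => i _; rewrite mul0r.
    move=> r u v [e ->] [g ->]; exists (fun i => r * e i + g i).
    rewrite scaler_sumr -big_split; apply: eq_bigr => i _ /=.
    by rewrite mulrDl -mulrA.
  have Ts : T (\sum_(i < size s) d i *: s`_i).
    apply: (@submod_sum R R^o T 'I_(size s) _ xpredT (fun i => d i *: s`_i) sT) => i _.
    by apply: submodZ => //; apply: hm; apply: mem_nth.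
  exact: Ts.
pose q := \sum_(i < m) c i *: (P_ i * 'X^(size (P_ m) - size (P_ i))).
have qS : lspan (S_ m : seq {poly R}^o) q.
  exists (fun i => (c i)%:P * 'X^(size (P_ m) - size (P_ i))).
  rewrite Ssize; apply: eq_bigr => i _; rewrite Snth // [RHS]/GRing.scale /=.
  by rewrite [RHS]mulrAC -mul_polyC mulrA.
have Pm0 : P_ m != 0.
  by apply/eqP => e; apply: (PS m); rewrite e; case: (lspan_submod (S_ m : seq {poly R}^o)).
have sz0 : (0 < size (P_ m))%N by rewrite size_poly_gt0.
have qI : I q by apply: (lspan_min sI _ qS); apply: SI.
have := Pmin m (P_ m - q) (submodB sI (PI m) qI).
have nS : ~ lspan (S_ m : seq {poly R}^o) (P_ m - q).
  move=> h; apply: (PS m); rewrite -[P_ m](subrK q).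
  exact: (submodD (lspan_submod _) h qS).
move/(_ nS); apply/negP; rewrite -ltnNge.
suff: (size (P_ m - q)%R <= (size (P_ m)).-1)%N by rewrite -ltnS prednK.
apply/leq_sizeP => j hj; rewrite coefB.
have cq : q`_j = \sum_(i < m) c i * (P_ i)`_(j - (size (P_ m) - size (P_ i))).
  rewrite coef_sum; apply: eq_bigr => i _; rewrite coefZ coefMXn.
  have := Smon m i (ltn_ord i) => hi; case: ltnP => // hj'.
  suff: (0 < size (P_ i))%N by lia.
  rewrite size_poly_gt0; apply/eqP => e; apply: (PS i); rewrite e.
  by case: (lspan_submod (S_ i : seq {poly R}^o)).
move: hj; rewrite leq_eqVlt => /orP[/eqP hj|hj].
  rewrite cq -{1}hj -[(P_ m)`_ _]/(lead_coef (P_ m)) lc; apply/eqP; rewrite subr_eq0; apply/eqP.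
  apply: eq_bigr => i _; congr (_ * _`_ _); have := Smon m i (ltn_ord i).
  have : (0 < size (P_ i))%N; last by lia.
  rewrite size_poly_gt0; apply/eqP => e; apply: (PS i); rewrite e.
  by case: (lspan_submod (S_ i : seq {poly R}^o)).
have {}hj : (size (P_ m) <= j)%N by rewrite -(prednK sz0).
have -> : (P_ m)`_j = 0 by rewrite nth_default.
rewrite cq big1 ?subr0 // => i _; rewrite nth_default ?mulr0 //.
move: hj (Smon m i (ltn_ord i)); move: (size (P_ m)) (size (P_ i)) => a b; lia.
Qed.

Lemma noetherian_mpoly (K : fieldType) n : noetherian {mpoly K[n]}.
Proof.
elim: n => [|n IH].
  apply: (@noetherian_surj _ _ (@mpolyC 0 K)); last exact: noetherian_field.
  move=> y; exists y@_0; apply/mpolyP => m; rewrite mcoeffC.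
  have -> : m = 0%MM by apply/mnmP; case.
  by rewrite eqxx mulr1.
pose phi : {rmorphism {poly {mpoly K[n]}} -> {mpoly K[n.+1]}} :=
  (horner_eval 'X_ord_max \o map_poly (@mwiden n K))%FUN.
apply: (@noetherian_surj _ _ phi); last exact: noetherian_poly.
pose P y := exists x, phi x = y.
have PM y z : P y -> P z -> P (y * z).
  by move=> [a <-] [b <-]; exists (a * b); rewrite rmorphM.
have PX i : P 'X_i.
  case: (unliftP ord_max i) => [j|] ->.
    exists ('X_j)%:P; rewrite /phi /= map_polyC /= /horner_eval hornerC.
    rewrite mwidenX mnmwiden1; congr 'X_[U_(_)]; apply: val_inj => /=.
    by rewrite /bump leqNgt ltn_ord.
  by exists 'X; rewrite /phi /= map_polyX /horner_eval hornerX.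
have PC c : P c%:MP.
  by exists (c%:MP)%:P; rewrite /phi /= map_polyC /= /horner_eval hornerC mwidenC.
move=> y; rewrite (mpolyE y); elim/big_ind: _.
- by exists 0; rewrite rmorph0.
- by move=> u v [a <-] [b <-]; exists (a + b); rewrite rmorphD.
- move=> m _; rewrite -mul_mpolyC; apply: (PM) => //; rewrite mpolyXE_id.
  elim/big_ind: _ => //; first exact: (PC 1).
  by move=> i _; elim: (m i) => [|k hk]; [exact: (PC 1)|rewrite exprS; apply: PM].
Qed.

(** Induction along 0 -> R^m -> R^(m+1) -> R -> 0: lifts of generators [s1] of the ideal of first
    coordinates, together with generators [s0] of the part with first coordinate zero. *)
Lemma fgsub_rV (R : comNzRingType) m (U : 'rV[R]_m -> Prop) :
  noetherian R -> submod U -> fgsub U.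
Proof.
move=> nR; elim: m U => [|m IH] U sU.
  exists [::] => // v _; exists (fun=> 0).
  by rewrite big_ord0; apply/rowP; case.
pose I (x : R^o) := exists2 u, U u & u 0 0 = x.
have sI : submod I.
  split; first by exists 0; [case: sU|rewrite mxE].
  move=> r x y [u uU <-] [v vU <-]; exists (r *: u + v); last by rewrite !mxE.
  exact: sU.2.
have [s1 s1I s1g] := nR I sI.
pose R0 (w : 'rV[R]_m) : 'rV[R]_m.+1 :=
  \row_j (if unlift 0 j is Some k then w 0 k else 0).
have R0l r u v : R0 (r *: u + v) = r *: R0 u + R0 v.
  by apply/rowP=> j; rewrite !mxE; case: unlift => [k|]; rewrite ?mxE ?mulr0 ?addr0.
have R00 : R0 0 = 0 by apply/rowP=> j; rewrite !mxE; case: unlift => [k|]; rewrite ?mxE.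
pose U0 (w : 'rV[R]_m) := U (R0 w).
have sU0 : submod U0.
  split; first by rewrite /U0 R00; case: sU.
  by move=> r u v hu hv; rewrite /U0 R0l; apply: sU.2.
have [s0 s0U s0g] := IH U0 sU0.
have [h hP] : exists h : R -> 'rV[R]_m.+1, forall x, I x -> U (h x) /\ h x 0 0 = x.
  have /choice[h hP] : forall x : R, exists u : 'rV[R]_m.+1, I x -> U u /\ u 0 0 = x.
    move=> x; case: (pselect (I x)) => [[u u1 u2]|?]; last by exists 0.
    by exists u.
  by exists h.
pose s := [seq h x | x <- s1] ++ [seq R0 w | w <- s0].
exists s.
  move=> v; rewrite mem_cat => /orP[/mapP[x /s1I xI ->]|/mapP[w /s0U wU ->]] //.
  by have [] := hP x xI.
move=> v vU; have [c vc] := s1g (v 0 0) (ex_intro2 _ _ v vU erefl).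
pose u := \sum_(i < size s1) c i *: h s1`_i.
have us : lspan s u.
  refine (@submod_sum R 'rV[R]_m.+1 (lspan s) 'I_(size s1) _ xpredT
    (fun i => c i *: h s1`_i) (lspan_submod s) _) => i _.
  apply: submodZ; first exact: lspan_submod.
  by apply: lspan_mem; rewrite mem_cat map_f ?mem_nth.
have uU : U u.
  refine (@submod_sum R 'rV[R]_m.+1 U 'I_(size s1) _ xpredT
    (fun i => c i *: h s1`_i) sU _) => i _.
   apply: submodZ => //.
  by have [] := hP _ (s1I _ (mem_nth 0 (ltn_ord i))).
have u0 : u 0 0 = v 0 0.
  rewrite vc summxE; apply: eq_bigr => i _; rewrite mxE.
  by have [_ ->] := hP _ (s1I _ (mem_nth 0 (ltn_ord i))).
pose w : 'rV[R]_m := \row_i (v - u) 0 (fintype.lift 0 i).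
have vuw : v - u = R0 w.
  apply/rowP => j; rewrite [RHS]mxE; case: unliftP => [k|] ->; first by rewrite !mxE.
  by rewrite !mxE u0 subrr.
have wU : U0 w by rewrite /U0 -vuw; apply: submodB.
have [d wd] := s0g w wU.
rewrite -[v](subrK u); apply: (submodD (lspan_submod s)) => //.
rewrite vuw wd.
have sR : submod (fun y => lspan s (R0 y)).
  split; first by rewrite R00; case: (lspan_submod s).
  by move=> r x y hx hy; rewrite R0l; apply: (lspan_submod s).2.
refine (@submod_sum R 'rV[R]_m (fun y => lspan s (R0 y)) 'I_(size s0) _ xpredT
  (fun i => d i *: s0`_i) sR _) => i _.
apply: (@submodZ R 'rV[R]_m (fun y => lspan s (R0 y))) => //; apply: lspan_mem.
by rewrite mem_cat; apply/orP; right; apply: map_f; apply: mem_nth.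
Qed.

End Noether.

Section ConsGen.
Variables (R : comNzRingType) (V : lmodType R).

(** The stretch H^(p-1)(f) -> H^p(a, f) -> H^p(f), followed by multiplication by a. The condition on
    x and y says that a acts injectively on H^p(f). *)
Lemma Hvan_cons_gen a f n p (U : V -> Prop) : submod U ->
  (forall x y : koz n V, kin U x -> kin U y -> kdeg p x -> kd f x = 0 ->
     a *: x = kd f y -> exists x', [/\ kin U x', pdeg p x' & kd f x' = x]) ->
  (forall p', p = p'.+1 -> Hvan f n p' U) ->
  Hvan (kcons a f) n.+1 p U.
Proof.
move=> hU hp hp' [x y] /= [xU yU] [dx dy] [dx0] /eqP; rewrite subr_eq0 => /eqP axy.
have [x' [x'U dx' ex]] := hp x y xU yU dx dx0 axy.
case: p dx dx' dy hp hp' => [|p] /= dx dx' dy hp hp'.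
  rewrite dx' in ex; exists 0; split; [by split; apply: kin0|by []|].
  by rewrite dy -ex !linear0 addr0.
have dd0 : kd f (a *: x' - y) = 0 by rewrite linearB linearZ /= ex axy subrr.
have [z [zU dz ez]] := hp' p erefl (a *: x' - y)
  (kinB hU (kinZ a hU x'U) yU) (kdegB (kdegZ a dx') dy) dd0.
exists (x', z); split => //=.
by rewrite ex ez; congr (_, _); rewrite opprB addrC subrK.
Qed.

Lemma inideal_submod f n (U : V -> Prop) : submod U -> submod (inideal f n U).
Proof.
move=> sU; split.
  by exists (fun=> 0); [case: sU|rewrite big1 // => i _; rewrite scaler0].
move=> r u v [g gU ->] [h hU ->]; exists (fun k => r *: g k + h k).
  by move=> k; apply: sU.2.
rewrite scaler_sumr -big_split; apply: eq_bigr => i _ /=.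
by rewrite scalerDr !scalerA mulrC.
Qed.

End ConsGen.

Definition natf (R : nzRingType) n (F : 'I_n -> R) (k : nat) : R :=
  if insub k is Some i then F i else 0.

Lemma natfE (R : nzRingType) n (F : 'I_n -> R) (i : 'I_n) : natf F i = F i.
Proof. by rewrite /natf valK. Qed.

(** * Powers of the variables form a regular sequence *)

Section Monomial.
Variables (K : fieldType) (n N : nat).
Local Notation S := {mpoly K[n]}.

Definition Xn (k : nat) : S := natf (fun i => 'X_i) k ^+ N.

Let mon j m (mu : 'X_{1..n}) : Prop :=
  exists i : 'I_n, [/\ (j <= i)%N, (i < j + m)%N & (N <= mu i)%N].

Let coefXN (i : 'I_n) (g : S) (mu : 'X_{1..n}) :
  (mu i < N)%N -> ('X_i ^+ N * g)@_mu = 0.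
Proof.
move=> hi; rewrite mcoeffM big1 // => k /eqP mk.
rewrite mcoeffXn; case: eqP => [e|_]; last by rewrite mul0r.
have : (N <= mu i)%N by rewrite mk mnmDE -e mulmnE mnm1E eqxx mul1n leq_addr.
by rewrite leqNgt hi.
Qed.

(** An ideal generated by powers of variables is monomial, so membership is decided coefficient by
    coefficient. *)
Let inideal_mon j m (v : S^o) : (j + m <= n)%N ->
  inideal (fun k => Xn (j + k)) m (fun _ : S^o => True) v <->
  (forall mu, ~ mon j m mu -> (v : S)@_mu = 0).
Proof.
move=> jm; split.
  move=> [g _ ->] mu nm; rewrite raddf_sum big1 // => k _.
  have jk : (j + k < n)%N by rewrite (leq_trans _ jm) // ltn_add2l.
  rewrite /= /Xn (natfE _ (Ordinal jk)); apply: coefXN.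
  rewrite ltnNge; apply/negP => h; apply: nm; exists (Ordinal jk).
  by split=> //=; rewrite ?leq_addr // ltn_add2l.
move=> h; rewrite [v]mpolyE big_seq.
have sI := inideal_submod (fun k => Xn (j + k)) m (submodT (S^o)).
refine (@submod_sum S S^o _ _ _ (fun mu => mu \in msupp (v : S))
  (fun mu => (v : S)@_mu *: 'X_[mu] : S) sI _) => mu muv.
have [i [ji im Ni]] : mon j m mu.
  case: (pselect (mon j m mu)) => // /h e; move: muv.
  by rewrite mcoeff_msupp e eqxx.
rewrite -mul_mpolyC; apply: (@submodZ S S^o _ _ _ sI).
have im' : (i - j < m)%N by lia.
exists (fun k => if k == (i - j)%N then 'X_[(mu - U_(i) *+ N)%MM] else 0) => //.
rewrite (bigD1 (Ordinal im')) //= eqxx big1 ?addr0; last first.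
  by move=> k; rewrite -val_eqE /= => /negPf ->; rewrite scaler0.
rewrite /Xn subnKC // natfE /GRing.scale /= mpolyXn -mpolyXD; congr 'X_[_].
apply/mnmP => k; rewrite mnmDE mnmBE mulmnE mnm1E.
by case: eqP => [<-|_]; rewrite ?mul1n ?mul0n ?subn0 ?subnKC.
Qed.

(** The shift j serves the induction, which puts X_j in front of the later variables. Below top
    degree the induction hypothesis applies; in top degree the cohomology is S modulo a monomial
    ideal in the later variables, where X_j^N is injective. *)
Lemma good_Xn_shift m : forall j, (j + m <= n)%N -> good (fun k => Xn (j + k)) m m.
Proof.
elim: m => [|m IH] j jm p pm //.
have jm' : (j.+1 + m <= n)%N by rewrite addSnnS.
have jn : (j < n)%N by lia.
apply: (@Hvan_eqf _ _ (kcons (Xn j) (fun k => Xn (j.+1 + k)))).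
  by case=> [|k] _ /=; rewrite ?addn0 ?addSnnS.
apply: Hvan_cons_gen => //; last first.
  by move=> p' pp; apply: IH => //; rewrite pp in pm.
move=> x y xU yU xd dx0 e.
move: pm; rewrite ltnS leq_eqVlt => /orP[/eqP pm|pm]; last first.
  by have [b [b1 b2 b3]] := IH j.+1 jm' p pm x xU xd dx0; exists b.
subst p; have := ktop_kd (fun k => Xn (j.+1 + k)) (submodT S^o) yU.
rewrite -e ktopZ => /(inideal_mon _ jm') h.
have : inideal (fun k => Xn (j.+1 + k)) m (fun _ : S^o => True) (ktop x).
  apply/(inideal_mon _ jm') => mu nm.
  have := h (mu + U_(Ordinal jn) *+ N)%MM.
  rewrite /GRing.scale /= /Xn (natfE _ (Ordinal jn)) mpolyXn mulrC addmC mcoeffMX.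
  rewrite addmC; apply=> -[i [ji im Ni]]; apply: nm; exists i; split=> //.
  move: Ni; rewrite mnmDE mulmnE mnm1E; case: eqP => [ij|_]; last by rewrite mul0n addn0.
  by move: ji; rewrite -ij ltnn.
move/(ktop_kd_surj (submodT _)) => [b [b1 b2 b3 b4]]; exists b; split=> //.
apply/eqP; rewrite -subr_eq0; apply/eqP; apply: ktop_eq0; first exact: kdegB.
by rewrite ktop_sub b4 subrr.
Qed.

Lemma good_Xn m : (m <= n)%N -> good Xn m m.
Proof. exact: (@good_Xn_shift m 0). Qed.

End Monomial.

(** * Free covers and splicing of resolutions *)

Section PdConstruct.
Variable R : comNzRingType.

Lemma rV_lincomb_linear (M : lmodType R) k (m : 'I_k -> M) :
  linear (fun c : 'rV[R]_k => \sum_j c 0 j *: m j).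
Proof.
move=> r u v; rewrite scaler_sumr -big_split; apply: eq_bigr => j _.
by rewrite !mxE scalerDl scalerA.
Qed.

Definition lincomb (M : lmodType R) k (m : 'I_k -> M) (c : 'rV[R]_k) : M :=
  \sum_j c 0 j *: m j.
HB.instance Definition _ (M : lmodType R) k (m : 'I_k -> M) :=
  GRing.isLinear.Build R 'rV[R]_k M _ (lincomb m) (rV_lincomb_linear m).

Lemma lincombP (M : lmodType R) k (m : 'I_k -> M) r u v :
  lincomb m (r *: u + v) = r *: lincomb m u + lincomb m v.
Proof. exact: rV_lincomb_linear. Qed.

Lemma lincombD1 (M : lmodType R) k (m : 'I_k.+1 -> M) b j0 :
  lincomb m b = b 0 j0 *: m j0 +
    lincomb (fun j => m (lift j0 j)) (\row_j b 0 (lift j0 j)).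
Proof.
rewrite /lincomb (bigD1_ord j0) //=; congr (_ + _).
by apply: eq_bigr => j _; rewrite mxE.
Qed.

Lemma lincomb_delta (M : lmodType R) k (m : 'I_k -> M) j :
  lincomb m (delta_mx 0 j) = m j.
Proof.
rewrite /lincomb (bigD1 j) //= mxE !eqxx scale1r big1 ?addr0 // => i ij.
by rewrite mxE eqxx (negPf ij) scale0r.
Qed.

Lemma rV_lincombE (M : lmodType R) k (h : {linear 'rV[R]_k -> M}) c :
  h c = lincomb (fun j => h (delta_mx 0 j)) c.
Proof.
rewrite {1}(row_sum_delta c) linear_sum; apply: eq_bigr => j _.
by rewrite linearZ.
Qed.

Lemma rV_projective k : is_projective 'rV[R]_k.
Proof.
move=> M N g f surj; have /choice[m mP] := fun j : 'I_k => surj (f (delta_mx 0 j)).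
exists (lincomb m) => c; rewrite (rV_lincombE f) linear_sum; apply: eq_bigr => j _.
by rewrite linearZ /= mP.
Qed.

Lemma pd_le_free (M : lmodType R) k (psi : {linear 'rV[R]_k -> M}) :
  (forall m, exists c, psi c = m) -> (forall c, psi c = 0 -> c = 0) -> pd_le M 0.
Proof.
move=> surj inj.
pose P (i : nat) : lmodType R := if i is i'.+1 then 'rV[R]_0 else 'rV[R]_k.
pose d (i : nat) : {linear P i.+1 -> P i} := \0%R.
exists P, d, psi; split=> //.
- by case=> [|i]; apply: rV_projective.
- by case=> // i _ x; apply: thinmx0.
- move=> x; split=> [/inj ->|[z <-]]; first by exists 0; rewrite linear0.
  by rewrite /d /= linear0.
- move=> i x; split=> // _; exists 0; rewrite linear0.
  by apply/esym; apply: thinmx0.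
Qed.

Lemma pd_le_step (M L : lmodType R) k q (psi : {linear 'rV[R]_k -> M})
    (kap : {linear L -> 'rV[R]_k}) :
  (forall m, exists c, psi c = m) ->
  (forall x, kap x = 0 -> x = 0) ->
  (forall c, psi c = 0 <-> exists x, kap x = c) ->
  pd_le L q -> pd_le M q.+1.
Proof.
move=> surj inj ker [P [d [eps [pP P0 sP e0 eS]]]].
pose P' (i : nat) : lmodType R := if i is i'.+1 then P i' else 'rV[R]_k.
pose d' (i : nat) : {linear P' i.+1 -> P' i} :=
  match i return {linear P' i.+1 -> P' i} with
  | 0 => (kap \o eps)%FUN : {linear P 0 -> 'rV[R]_k}
  | i'.+1 => d i'
  end.
exists P', d', psi; split=> //.
- by case=> [|i]; [apply: rV_projective|apply: pP].
- by case=> // i iq; apply: P0.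
- move=> x; rewrite ker; split=> [[y <-]|[z <-]]; last by exists (eps z).
  by have [z <-] := sP y; exists z.
- case=> [|i] x; last exact: eS.
  rewrite -e0 /d' /=; split=> [/inj //|->]; exact: linear0.
Qed.

End PdConstruct.

Section SubModule.
Variables (R : comNzRingType) (V : lmodType R) (U : V -> Prop) (sU : submod U).

Definition sm_pred of submod U : {pred V} := fun v => `[< U v >].

Fact sm_pred_submod : submod_closed (sm_pred sU).
Proof.
split; first by apply/asboolP; case: sU.
by move=> r u v /asboolP hu /asboolP hv; apply/asboolP; apply: sU.2.
Qed.

HB.instance Definition _ := GRing.isSubmodClosed.Build R V (sm_pred sU) sm_pred_submod.

(** A predicate made into a module, so that a module of relations can have a resolution of its
    own. *)
Record subm : Type := SubM { sm_val :> V; _ : sm_val \in sm_pred sU }.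

HB.instance Definition _ := [isSub for sm_val].
HB.instance Definition _ := [Choice of subm by <:].
HB.instance Definition _ := [SubChoice_isSubLmodule of subm by <:].

Lemma sm_val_linear : linear sm_val.
Proof. by move=> r u v; rewrite -[sm_val]/(val) linearP. Qed.
HB.instance Definition _ := GRing.isLinear.Build R subm V _ sm_val sm_val_linear.

Lemma subm_exP v : (exists x : subm, sm_val x = v) <-> U v.
Proof.
split=> [[[w /= /asboolP ?] <-]//|h].
have vU : v \in sm_pred sU by apply/asboolP.
by exists (SubM vU).
Qed.

Lemma subm_inj (x : subm) : sm_val x = 0 -> x = 0.
Proof. by move=> h; apply: val_inj; rewrite /= h. Qed.

End SubModule.

(** * Minimal homogeneous generators and their relations *)

Section Graded.
Variables (K : fieldType) (n : nat).
Local Notation S := {mpoly K[n]}.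
Local Notation pih := (pihomog mdeg).

Lemma pihomog_bound d (p : S) k : (msize p <= k)%N -> (k <= d)%N -> pih d p = 0.
Proof.
move=> pk kd; rewrite (pihomogwE _ _ pk) big1 // => m /eqP hm.
by have := bmdeg m; rewrite hm ltnNge kd.
Qed.

Lemma mcoeff_pihomog d (p : S) m : (pih d p)@_m = if mdeg m == d then p@_m else 0.
Proof.
case: eqP => [md|/eqP md]; last exact: (dhomog_nemf_coeff (pihomogP _ _ _) md).
set k := maxn (msize p) d.+1.
rewrite [p in RHS](@pihomog_partitionE _ _ mdeg k p); last exact: leq_maxl.
have dk : (d < k)%N by rewrite /k leq_max ltnSn orbT.
rewrite [RHS]raddf_sum (bigD1 (Ordinal dk)) //= big1 ?addr0 // => i.
rewrite -val_eqE /= => id; apply: (dhomog_nemf_coeff (pihomogP _ _ _)).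
by apply: contra id => /eqP <-; apply/eqP.
Qed.

Lemma pihomogM d e (p q : S) : q \is e.-homog for mdeg ->
  pih d (p * q) = if (e <= d)%N then pih (d - e) p * q else 0.
Proof.
move=> hq; rewrite [p in LHS](pihomog_partitionE (leqnn (msize p))) mulr_suml raddf_sum /=.
have hom k : pih k p * q \is (k + e).-homog for mdeg.
  by apply: dhomogM => //; apply: pihomogP.
case: leqP => ed; last first.
  rewrite big1 // => i _; apply: (pihomog_ne0 _ (hom i)).
  by rewrite neq_ltn (leq_trans ed (leq_addl _ _)) orbT.
case: (ltnP (d - e) (msize p)) => hd.
  rewrite (bigD1 (Ordinal hd)) //= big1 ?addr0.
    by rewrite pihomog_dE //; have := hom (d - e)%N; rewrite subnK.
  move=> i; rewrite -val_eqE /= => hi; apply: (pihomog_ne0 _ (hom i)).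
  by apply: contra hi => /eqP <-; rewrite addnK.
rewrite (pihomog_bound (leqnn _) hd) mul0r big1 // => i _.
apply: (pihomog_ne0 _ (hom i)); rewrite neq_ltn; apply/orP; left.
by move: (ltn_ord i); lia.
Qed.

Lemma pihomog0C (p : S) : pih 0 p = (p@_0)%:MP.
Proof.
apply/mpolyP => m; rewrite mcoeff_pihomog mcoeffC mdeg_eq0 eq_sym.
by rewrite [0%MM == m]eq_sym; case: eqP => [->|_]; rewrite ?mulr1 ?mulr0.
Qed.

Section HC.
Variables (r : nat) (w : 'I_r -> nat).

(** The component of degree d in the graded free module whose i-th basis vector has degree [w i].
    The test is needed because truncated subtraction would otherwise leave a constant term when
    [w i] exceeds d. *)
Definition hc d (u : 'rV[S]_r) : 'rV[S]_r :=
  \row_i (if (w i <= d)%N then pih (d - w i) (u 0 i) else 0).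

Lemma hc_additive d : additive (hc d).
Proof.
move=> u v; apply/rowP => i; rewrite !mxE; case: ifP => _; last by rewrite subrr.
by rewrite raddfB.
Qed.
HB.instance Definition _ d := GRing.isZmodMorphism.Build 'rV[S]_r 'rV[S]_r (hc d) (hc_additive d).

Lemma hc_id d u : hc d (hc d u) = hc d u.
Proof.
by apply/rowP=> i; rewrite !mxE; case: (leqP (w i) d) => // _; rewrite pihomog_id.
Qed.

Lemma hc_scale d e (c : S) (v : 'rV[S]_r) : hc e v = v ->
  hc d (c *: v) = (if (e <= d)%N then pih (d - e) c else 0) *: v.
Proof.
move=> hv; apply/rowP => i; rewrite !mxE.
have vi : v 0 i = if (w i <= e)%N then pih (e - w i) (v 0 i) else 0.
  by rewrite -{1}hv mxE.
case: (leqP (w i) e) vi => we vi; last first.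
  by rewrite vi !mulr0 raddf0 if_same.
have hh : v 0 i \is (e - w i)%N.-homog for mdeg by rewrite vi; apply: pihomogP.
case: leqP => wd; last first.
  by rewrite ifN ?mul0r // -ltnNge; lia.
rewrite (pihomogM _ _ hh) leq_sub2rE //; case: leqP => ed; last by rewrite mul0r.
by congr (pih _ _ * _); lia.
Qed.

Lemma hc_scaleS d e (c : S) (v : 'rV[S]_r) : c \is e.-homog for mdeg ->
  hc (d + e) (c *: v) = c *: hc d v.
Proof.
move=> hcc; apply/rowP => i; rewrite !mxE mulrC.
case: (leqP (w i) d) => wd.
  rewrite (leq_trans wd (leq_addr _ _)) (pihomogM _ _ hcc) mulrC.
  have -> : (e <= d + e - w i)%N by lia.
  by congr (_ * pih _ _); lia.
rewrite mulr0; case: ifP => // wde; rewrite (pihomogM _ _ hcc) ifN // -ltnNge; lia.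
Qed.

Lemma hc_scaleS_lt d e (c : S) (v : 'rV[S]_r) : c \is e.-homog for mdeg ->
  (d < e)%N -> hc d (c *: v) = 0.
Proof.
move=> hcc de; apply/rowP => i; rewrite !mxE mulrC.
by case: ifP => // wd; rewrite (pihomogM _ _ hcc) ifN // -ltnNge; lia.
Qed.

Definition hbound (u : 'rV[S]_r) : nat := (\sum_i (msize (u 0%R i) + w i))%N.

Lemma hc_partition (u : 'rV[S]_r) D : (hbound u <= D)%N -> u = \sum_(d < D) hc d u.
Proof.
move=> hD; apply/rowP => i; rewrite summxE.
under eq_bigr do rewrite mxE.
have hi : (msize (u 0%R i) + w i <= D)%N.
  by apply: leq_trans hD; rewrite /hbound (bigD1 i) //= leq_addr.
rewrite -(big_mkord xpredT (fun d => if (w i <= d)%N then pih (d - w i) (u 0 i) else 0)).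
transitivity (\sum_(w i <= d < D) pih (d - w i) (u 0 i)); last first.
  by rewrite (big_nat_widenl (w i) 0) //= big_mkcond.
rewrite -{1}[w i]add0n big_addn big_mkord.
rewrite {1}(@pihomog_partitionE _ _ mdeg (D - w i) (u 0 i)); last by lia.
by apply: eq_bigr => k _; rewrite addnK.
Qed.

Definition graded (N : 'rV[S]_r -> Prop) : Prop := forall d u, N u -> N (hc d u).

End HC.

Lemma hc_lincomb r (w : 'I_r -> nat) k (v : 'I_k -> 'rV[S]_r) (dl : 'I_k -> nat) d c :
  (forall j, hc w (dl j) (v j) = v j) ->
  hc w d (lincomb v c) = lincomb v (hc dl d c).
Proof.
move=> hv; rewrite raddf_sum; apply: eq_bigr => j _ /=.
by rewrite (hc_scale _ _ (hv j)) mxE.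
Qed.

(** Among homogeneous generating families one of least size is taken. A relation in which some
    coefficient has a non-zero constant term would allow the corresponding generator to be
    eliminated. *)
Lemma graded_gens r (w : 'I_r -> nat) (N : 'rV[S]_r -> Prop) :
  submod N -> graded w N ->
  exists k (v : 'I_k -> 'rV[S]_r) (dl : 'I_k -> nat),
    [/\ forall j, N (v j), forall j, hc w (dl j) (v j) = v j,
        forall u, N u -> exists c, u = lincomb v c
      & forall c, lincomb v c = 0 -> forall j, (c 0 j)@_0 = 0].
Proof.
move=> sN gN.
pose Q k := exists (v : 'I_k -> 'rV[S]_r) (dl : 'I_k -> nat),
    [/\ forall j, N (v j), forall j, hc w (dl j) (v j) = v j &
        forall u, N u -> exists c, u = lincomb v c].
have exQ : exists k, `[< Q k >].
  have [s sNs sg] := fgsub_rV (@noetherian_mpoly K n) sN.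
  pose D := (\sum_(v <- s) hbound w v)%N.
  pose s' := [seq (hc w d v, d) | v <- s, d <- iota 0 D].
  exists (size s'); apply/asboolP.
  exists (fun j => (tnth (in_tuple s') j).1), (fun j => (tnth (in_tuple s') j).2).
  have mem' j : exists v d, [/\ v \in s & tnth (in_tuple s') j = (hc w d v, d)].
    have : tnth (in_tuple s') j \in s' by apply: mem_tnth.
    by case/allpairsP => -[v d] /= [vs _ ->]; exists v, d.
  split.
  - by move=> j; have [v [d [vs ->]]] := mem' j; apply: gN; apply: sNs.
  - by move=> j; have [v [d [vs ->]]] := mem' j; rewrite /= hc_id.
  have sL : submod (fun u => exists c, u = lincomb (fun j => (tnth (in_tuple s') j).1) c).
    split; first by exists 0; rewrite linear0.
    by move=> a u v [c ->] [d ->]; exists (a *: c + d); rewrite lincombP.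
  move=> u uN; have [c ->] := sg u uN.
  refine (@submod_sum S _ _ _ _ xpredT (fun i : 'I_(size s) => c i *: s`_i) sL _) => i _.
  apply: (submodZ _ sL).
  rewrite [s`_i](@hc_partition _ w _ D); last first.
    have := mem_nth 0 (ltn_ord i); rewrite /D => h.
    by rewrite (big_rem _ h) /= leq_addr.
  refine (@submod_sum S _ _ _ _ xpredT (fun d : 'I_D => hc w d s`_i) sL _) => d _.
  have hm : (hc w d s`_i, nat_of_ord d) \in s'.
    apply/allpairsP; exists (s`_i, nat_of_ord d); split=> //=; first exact: mem_nth.
    by rewrite mem_iota /= add0n.
  have hi : (index (hc w d s`_i, nat_of_ord d) s' < size s')%N by rewrite index_mem.
  exists (delta_mx 0 (Ordinal hi)); rewrite lincomb_delta.
  by rewrite (tnth_nth (0, 0%N)) /= nth_index.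
case: (ex_minnP exQ) => k /asboolP[v [dl [vN hv vg]]] kmin.
exists k, v, dl; split=> // c c0 j0; apply/eqP/negPn/negP => cj0.
case: k v dl vN hv vg kmin c c0 j0 cj0 => [|k] v dl vN hv vg kmin c c0 j0 cj0; first by case: j0 cj0.
(* In degree [dl j0] the j0-th coefficient of the relation is reduced to its constant term, which is
   a unit. *)
have := congr1 (hc w (dl j0)) c0; rewrite (hc_lincomb _ _ hv) raddf0 => e0.
set g := hc dl (dl j0) c in e0.
have gj0 : g 0 j0 = ((c 0 j0)@_0)%:MP by rewrite mxE leqnn subnn pihomog0C.
set a := (c 0 j0)@_0 in cj0 gj0.
have [B vj0] : exists B, v j0 = lincomb (fun j => v (lift j0 j)) B.
  exists (\row_j (- (a^-1)%:MP * g 0 (lift j0 j))).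
  move: e0; rewrite /lincomb (bigD1_ord j0) //= gj0 => /eqP; rewrite addr_eq0 => /eqP e0.
  rewrite -[LHS]scale1r -[1](_ : (a^-1)%:MP * a%:MP = _); last by rewrite -mpolyCM mulVf.
  rewrite -scalerA e0 scalerN -scaleNr scaler_sumr; apply: eq_bigr => j _.
  by rewrite scalerA [X in _ = X *: _]mxE.
suff : (k.+1 <= k)%N by rewrite ltnn.
apply: kmin; apply/asboolP; exists (fun j => v (lift j0 j)), (fun j => dl (lift j0 j)).
split=> // u /vg[b ->].
exists (b 0 j0 *: B + \row_j b 0 (lift j0 j)); rewrite lincombP -vj0.
exact: lincombD1.
Qed.

Definition ord_ge (k : nat) (p : S) : Prop := forall m, (mdeg m < k)%N -> p@_m = 0.

Lemma ord_geD k p q : ord_ge k p -> ord_ge k q -> ord_ge k (p + q).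
Proof. by move=> hp hq m mk; rewrite mcoeffD hp // hq // addr0. Qed.

Lemma ord_geM k p q : p@_0 = 0 -> ord_ge k q -> ord_ge k.+1 (p * q).
Proof.
move=> p0 hq m mk; rewrite mcoeffM big1 // => ij /eqP mE.
case: (eqVneq (ij.1 : 'X_{1..n}) 0%MM) => [->|i0]; first by rewrite p0 mul0r.
rewrite hq ?mulr0 //; have := congr1 mdeg mE; rewrite mdegD => e.
have i1 : (0 < mdeg (ij.1 : 'X_{1..n}))%N by rewrite lt0n mdeg_eq0.
have lt2 : (mdeg (ij.2 : 'X_{1..n}) < mdeg (ij.1 : 'X_{1..n}) + mdeg (ij.2 : 'X_{1..n}))%N.
  by rewrite -add1n leq_add2r.
by rewrite -e in lt2; apply: leq_trans lt2 mk.
Qed.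

Section KZ.
Variables (l : nat) (t : nat -> S).
Hypotheses (l0 : (0 < l)%N) (tgood : good t l l) (t0 : forall k, (t k)@_0 = 0)
  (tgen : forall p : S, p@_0 = 0 -> inideal t l (fun _ : S^o => True) p).

(** The entries of a relation c lie in the maximal ideal, so c is the top component of d b with b of
    degree l - 1. The image of b in the span of [v] is a cocycle; writing it as a coboundary
    corrects b so that its components are relations. Hence each relation is a combination of
    relations with coefficients t_i, and by iteration its entries vanish to every order at the
    origin. This takes the place of Nakayama's lemma. *)
Lemma min_gens_free r k (v : 'I_k -> 'rV[S]_r) :
  (forall c, lincomb v c = 0 -> forall j, (c 0 j)@_0 = 0) ->
  Hvan t l l.-1 (fun u => exists c, u = lincomb v c) ->
  forall c, lincomb v c = 0 -> c = 0.
Proof.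
move=> hmin hv.
pose Rel (c : 'rV[S]_k) := lincomb v c = 0.
have sT := submodT 'rV[S]_k.
have sR : submod Rel.
  split; first exact: linear0.
  by move=> a u w hu hw; rewrite /Rel lincombP hu hw scaler0 addr0.
pose N u := exists c, u = lincomb v c.
have sN : submod N.
  split; first by exists 0; rewrite linear0.
  by move=> a u w [c ->] [d ->]; exists (a *: c + d); rewrite lincombP.
have step c : Rel c -> inideal t l Rel c.
  move=> rc.
  have cI : inideal t l (fun _ : 'rV[S]_k => True) c.
    have /choice[g gP] : forall j, exists g : nat -> S, c 0 j = \sum_(i < l) t i * g i.
      by move=> j; have [g _ gE] := tgen (hmin c rc j); exists g.
    exists (fun i => \row_j g j i) => //; apply/rowP => j; rewrite gP summxE.
    by apply: eq_bigr => i _; rewrite !mxE.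
  have [b [_ b2 b3 b4]] := ktop_kd_surj sT cI.
  have ha : kadd (fun _ : 'rV[S]_k => True) (lincomb v) by move=> x y _ _; rewrite linearB.
  have hs i (u : 'rV[S]_k) : (i < l)%N -> True -> lincomb v (t i *: u) = t i *: lincomb v u.
    by move=> _ _; rewrite linearZ.
  have l00 : lincomb v 0 = 0 by rewrite linear0.
  have bT : kin (fun _ : 'rV[S]_k => True) b by apply: kin_true.
  have db0 : kd t (kmap (lincomb v) b) = 0.
    rewrite -(kmap_kd2 sT ha hs bT); apply: ktop_eq0; first exact: kdeg_kmap.
    have -> : ktop (kmap (lincomb v) (kd t b)) = lincomb v (ktop (kd t b)).
      by elim: (l) (kd t b) => [|m IH] d //=.
    by rewrite b4.
  have bN : kin N (kmap (lincomb v) b).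
    by apply: kin_kmap bT => u _; exists u.
  have bd' : kdeg l.-1 (kmap (lincomb v) b).
    have pk m (e : koz m 'rV[S]_k) p : (0 < p)%N -> pdeg p e -> kdeg p.-1 e by case: p.
    by apply: kdeg_kmap => //; apply: pk.
  have [s [sN' sd se]] := hv _ bN bd' db0.
  have surjN w : N w -> exists2 u : 'rV[S]_k, True & lincomb v u = w.
    by move=> [u ->]; exists u.
  have [s' [_ sd' se']] := kmap_lift_p I l00 surjN sN' sd.
  have sT' : kin (fun _ : 'rV[S]_k => True) s' by apply: kin_true.
  have bR : kin Rel (b - kd t s').
    have h0 : kmap (lincomb v) (b - kd t s') = 0.
      rewrite (kmap_sub ha bT); last exact: kin_true.
      by rewrite (kmap_kd2 sT ha hs sT') se' se subrr.
    by apply: kin_imp (kmap_eq0 (kin_true _ (fun=> I)) h0) => u [].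
  have := ktop_kd t sR bR.
  by rewrite linearB /= kd_dd subr0 b4.
have ordR m : forall c, Rel c -> forall j, ord_ge m (c 0 j).
  elim: m => [|m IH] c rc j; first by [].
  have [g gR ->] := step c rc; rewrite summxE.
  elim/big_ind: _ => [||i _]; first by move=> ? ?; rewrite mcoeff0.
    exact: ord_geD.
  by rewrite mxE; apply: ord_geM => //; apply: IH.
move=> c rc; apply/rowP => j; rewrite mxE; apply/mpolyP => m.
by rewrite mcoeff0; apply: (ordR (mdeg m).+1 c rc).
Qed.

(* Minimal homogeneous generators reduce q to 0, where the relations R satisfy
   R = m R by the vanishing of H^(l-1). *)
Lemma pd_le_Hvan q r (w : 'I_r -> nat) (M : lmodType S) (iota : {linear M -> 'rV[S]_r}) :
  (forall x, iota x = 0 -> x = 0) ->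
  graded w (fun y => exists x, iota x = y) ->
  (forall p, (p + q < l)%N -> Hvan t l p (fun y => exists x, iota x = y)) ->
  pd_le M q.
Proof.
elim: q r w M iota => [|q IH] r w M iota inj gr hv.
  have [k [v [dl [vN vh vg vm]]]] := graded_gens (kerim_submod iota) gr.
  have /choice[m mE] := vN.
  have lE c : iota (lincomb m c) = lincomb v c.
    by rewrite linear_sum; apply: eq_bigr => j _; rewrite linearZ /= mE.
  have hl : Hvan t l l.-1 (fun u => exists c, u = lincomb v c).
    apply: (@Hvan_iff _ _ _ _ _ (fun y => exists x, iota x = y)); last first.
      by apply: hv; rewrite addn0 prednK.
    move=> u; split=> [h|[c ->]]; first exact: vg.
    by exists (lincomb m c).
  apply: (@pd_le_free _ M k (lincomb m)).
    move=> x; have [|c ce] := vg (iota x); first by exists x.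
    exists c; apply/eqP; rewrite -subr_eq0; apply/eqP; apply: inj.
    by rewrite linearB /= lE ce subrr.
  by move=> c c0; apply: (min_gens_free vm hl); rewrite -lE c0 linear0.
have [k [v [dl [vN vh vg vm]]]] := graded_gens (kerim_submod iota) gr.
have /choice[m mE] := vN.
have lE c : iota (lincomb m c) = lincomb v c.
  by rewrite linear_sum; apply: eq_bigr => j _; rewrite linearZ /= mE.
pose Rel (c : 'rV[S]_k) := lincomb v c = 0.
have sR : submod Rel.
  split; first exact: linear0.
  by move=> a u z hu hz; rewrite /Rel lincombP hu hz scaler0 addr0.
apply: (@pd_le_step _ M (subm sR) k q (lincomb m) (@sm_val _ _ _ sR)).
- move=> x; have [|c ce] := vg (iota x); first by exists x.
  exists c; apply/eqP; rewrite -subr_eq0; apply/eqP; apply: inj.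
  by rewrite linearB /= lE ce subrr.
- exact: subm_inj.
- move=> c; rewrite subm_exP /Rel -lE.
  by split=> [->|/inj //]; rewrite linear0.
apply: (IH k dl (subm sR) (@sm_val _ _ _ sR)).
- exact: subm_inj.
- move=> d c /subm_exP rc; apply/subm_exP; rewrite /Rel -(hc_lincomb _ _ vh) rc.
  exact: raddf0.
move=> p pq; apply: (@Hvan_iff _ _ _ _ _ (kker (fun _ => True) (lincomb v))).
  by move=> c; rewrite subm_exP; split=> [[]|].
apply: (@Hvan_ker _ _ _ _ l t t _ (fun y => exists x, iota x = y)).
- exact: submodT.
- by move=> x y _ _; rewrite linearB.
- by move=> i x _ _; rewrite linearZ.
- by move=> y /vg[c ->]; exists c.
- by move=> c _; exists (lincomb m c).
- by apply: Hvan_rV; apply: tgood; lia.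
- by move=> p' pp'; apply: hv; lia.
Qed.

End KZ.
End Graded.

(** * Logarithmic forms *)

Local Notation "x %:F" := (@tofrac _ x) : ring_scope.

Section KozSets.
Variables (R : comNzRingType) (V : lmodType R).

Definition preS n (I : {set 'I_n.+1}) : {set 'I_n} := [set j | lift ord0 j \in I].
Definition insS n (b : bool) (I : {set 'I_n}) : {set 'I_n.+1} :=
  [set i | if unlift ord0 i is Some j then j \in I else b].

Lemma preS_ins n b (I : {set 'I_n}) : preS (insS b I) = I.
Proof. by apply/setP => j; rewrite !inE liftK. Qed.

Lemma ins0 n b (I : {set 'I_n}) : (ord0 \in insS b I) = b.
Proof. by rewrite inE unlift_none. Qed.

Lemma ins_preS n (I : {set 'I_n.+1}) : insS (ord0 \in I) (preS I) = I.
Proof. by apply/setP => i; rewrite inE; case: unliftP => [j|] -> //; rewrite inE. Qed.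

Lemma card_preS n (I : {set 'I_n.+1}) : #|I| = ((ord0 \in I) + #|preS I|)%N.
Proof.
rewrite -sum1_card big_mkcond big_ord_recl /= -sum1_card [in RHS]big_mkcond.
congr addn.
by apply: eq_bigr => j _; rewrite inE.
Qed.

(** [koz] is built by recursion on the first basis vector, which suits inductions, whereas [ratform]
    is indexed by sets; [kget] and [kset] translate between the two. *)
Fixpoint kget n : koz n V -> {set 'I_n} -> V :=
  match n return koz n V -> {set 'I_n} -> V with
  | 0 => fun c _ => c
  | n'.+1 => fun c I => @kget n' (if ord0 \in I then c.2 else c.1) (preS I)
  end.

Fixpoint kset n : ({set 'I_n} -> V) -> koz n V :=
  match n return ({set 'I_n} -> V) -> koz n V with
  | 0 => fun F => F set0
  | n'.+1 => fun F => (@kset n' (fun I => F (insS false I)),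
                       @kset n' (fun I => F (insS true I)))
  end.

Lemma kgetK n (F : {set 'I_n} -> V) I : kget (kset F) I = F I.
Proof.
elim: n F I => [|n IH] F I /=; first by congr F; apply/setP; case.
rewrite -[in RHS](ins_preS I); case: (ord0 \in I) => /=; exact: IH.
Qed.

Lemma kget_lin n r (c c' : koz n V) I :
  kget (r *: c + c') I = r *: kget c I + kget c' I.
Proof. by elim: n c c' I => [|n IH] c c' I //=; case: ifP => _; apply: IH. Qed.

Lemma kget_sub n (c c' : koz n V) I : kget (c - c') I = kget c I - kget c' I.
Proof. by rewrite addrC -scaleN1r kget_lin scaleN1r addrC. Qed.

Lemma kgetZ n r (c : koz n V) I : kget (r *: c) I = r *: kget c I.
Proof. by elim: n c I => [|n IH] c I //=; case: ifP => _; apply: IH. Qed.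

Lemma kget_ext n (c c' : koz n V) : (forall I, kget c I = kget c' I) -> c = c'.
Proof.
elim: n c c' => [|n IH]; first by move=> c c' /(_ set0).
move=> [a b] [a' b'] h; congr (_, _); apply: IH => I.
  by have := h (insS false I); rewrite /= ins0 preS_ins.
by have := h (insS true I); rewrite /= ins0 preS_ins.
Qed.

Lemma kin_kget n U (c : koz n V) : kin U c <-> forall I, U (kget c I).
Proof.
elim: n c => [|n IH] c /=; first by split=> // h; apply: (h set0).
split=> [[/IH h1 /IH h2] I|h]; first by case: ifP.
split; apply/IH => I.
  by have := h (insS false I); rewrite ins0 preS_ins.
by have := h (insS true I); rewrite ins0 preS_ins.
Qed.

Lemma kdeg_kget n p (c : koz n V) :
  kdeg p c <-> forall I : {set 'I_n}, #|I| != p -> kget c I = 0.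
Proof.
elim: n p c => [|n IH] p c /=.
  have c0 (I : {set 'I_0}) : #|I| = 0%N by apply/eqP; rewrite cards_eq0; apply/eqP/setP; case.
  split=> [[->|->] I|h]; rewrite ?c0 //.
  by case: p h => [|p] h; [left|right; apply: (h set0); rewrite c0].
split=> [[/IH h1 h2] I|h].
  rewrite card_preS; case: ifP => _ /=; last by rewrite add0n; apply: h1.
  case: p h2 {h1} => [->|p /IH h2] hI.
    by elim: (n) (preS I) => [|m IHm] J //=; case: ifP => _; apply: IHm.
  by apply: h2; rewrite add1n eqSS in hI.
split; first apply/IH => I hI.
  by have := h (insS false I); rewrite card_preS ins0 preS_ins; apply.
have h2 (I : {set 'I_n}) : (#|I|.+1 != p)%N -> kget c.2 I = 0.
  by move=> hI; have := h (insS true I); rewrite card_preS ins0 preS_ins; apply.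
case: p h h2 => [|p] h h2; last by apply/IH => I hI; apply: h2.
apply: kget_ext => I; rewrite h2 //.
by elim: (n) I {h2} => [|m IHm] J //=; case: ifP => _; rewrite -IHm.
Qed.

Lemma kget0 n I : kget (0 : koz n V) I = 0.
Proof. by have := kgetZ 0 (0 : koz n V) I; rewrite !scale0r. Qed.

Let below n (T : {set 'I_n}) (i : 'I_n) := (\sum_(k < n) ((k \in T) && (k < i)%N))%N.

Lemma kget_kd_below n f (c : koz n V) (T : {set 'I_n}) :
  kget (kd f c) T =
  \sum_(i in T) (-1) ^+ below T i *: (f i *: kget c (T :\ i)).
Proof.
elim: n f c T => [|n IH] f c T /=; first by rewrite big_mkcond big_ord0.
rewrite big_mkcond big_ord_recl /=.
have lb j : below T (lift ord0 j) = ((ord0 \in T) + below (preS T) j)%N.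
  rewrite /below big_ord_recl andbT; congr addn.
  by apply: eq_bigr => k _; rewrite inE.
have sl j : preS (T :\ lift ord0 j) = preS T :\ j.
  by apply/setP => k; rewrite !inE (inj_eq lift_inj).
have l0 j : (ord0 \in T :\ lift ord0 j) = (ord0 \in T) by rewrite !inE.
case: (boolP (ord0 \in T)) => T0 /=.
  rewrite kget_sub kgetZ IH; congr (_ + _).
    have -> : below T ord0 = 0%N by rewrite /below big1 // => k _; rewrite ltn0 andbF.
    rewrite expr0 scale1r !inE eqxx /=; congr (_ *: kget _ _).
    by apply/setP => k; rewrite !inE.
  rewrite -sumrN big_mkcond; apply: eq_bigr => j _; rewrite inE.
  case: ifP => // jT; rewrite lb l0 T0 sl add1n exprS mulN1r scaleNr.
  by congr (- (_ *: (_ *: _))).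
rewrite add0r IH big_mkcond; apply: eq_bigr => j _; rewrite inE.
by case: ifP => // jT; rewrite lb l0 (negPf T0) sl.
Qed.

Lemma kget_kd n f (c : koz n V) (T : {set 'I_n}) :
  kget (kd f c) T =
  \sum_(i in T) (-1) ^+ #|[set k in T | (k < i)%N]| *: (f i *: kget c (T :\ i)).
Proof.
rewrite kget_kd_below; apply: eq_bigr => i _; congr ((-1) ^+ _ *: _).
rewrite -sum1_card [RHS]big_mkcond; apply: eq_bigr => k _.
by rewrite inE; case: (_ && _).
Qed.

End KozSets.

Section OmegaKoz.
Variables (K : fieldType) (l : nat).
Local Notation S := {mpoly K[l]}.
Local Notation vsp := {vspace 'rV[K]_l}.

Definition mdvd (R : comNzRingType) (a b : R) : Prop := exists c, b = a * c.

Lemma mdvd_submod (R : comNzRingType) (a : R) : submod (mdvd a : R^o -> Prop).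
Proof.
split; first by exists 0; rewrite mulr0.
move=> r u v [c ->] [d ->]; exists (r * c + d).
by rewrite mulrDr mulrCA.
Qed.

Definition acoef (a : 'cV[K]_l) : nat -> S := natf (fun i => (a i 0)%:MP).

(* Ulog A m p is Q(A, m) Omega^p(A, m), the numerators of logarithmic forms. *)
Definition Ulog (A : {fset vsp}) (m : vsp -> nat) p (z : koz l S^o) : Prop :=
  kdeg p z /\ forall H, H \in A ->
    kin (mdvd (alpha H ^+ m H) : S^o -> Prop) (kd (acoef (alpha_coef H)) z).

Lemma Ulog_submod A m p : submod (Ulog A m p).
Proof.
split.
  split; first exact: kdeg0.
  by move=> H HA; rewrite linear0; apply: kin0; apply: mdvd_submod.
move=> r u v [u1 u2] [v1 v2]; split; first exact: kdeg_lin.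
move=> H HA; rewrite linearP; apply: kin_lin; first exact: mdvd_submod.
  exact: u2.
exact: v2.
Qed.

Lemma ratformZ (f : S) (w : ratform K l) I : (f *: w) I = f%:F * w I.
Proof. by rewrite ffunE. Qed.

Lemma mderiv_linear_form (a : 'cV[K]_l) i : mderiv i (linear_form a) = (a i 0)%:MP.
Proof.
rewrite /linear_form raddf_sum (bigD1 i) //= big1 => [|j ji].
  rewrite mderivZ mderivX mnm1E eqxx addr0 mulr1n.
  have -> : (U_(i) - U_(i) = 0)%MM by apply/mnmP => k; rewrite !mnmE subnn.
  by rewrite mpolyX0 scale1r -mul_mpolyC mulr1.
by rewrite mderivZ mderivX mnm1E (negPf ji) scale0r scaler0.
Qed.

Lemma wedge_dalpha H (w : ratform K l) T :
  wedge (ext_diff (alpha H)) w T =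
  \sum_(i in T) (-1) ^+ #|[set k in T | (k < i)%N]| *
     ((alpha_coef H i 0)%:MP)%:F * w (T :\ i).
Proof.
rewrite ffunE.
under eq_bigr => I _.
  rewrite ffunE mulr_sumr mulr_suml.
  under eq_bigr do rewrite mderiv_linear_form.
  over.
rewrite (exchange_big_dep xpredT) //= [RHS]big_mkcond; apply: eq_bigr => i _.
case: ifP => iT; last first.
  by rewrite big_pred0 // => I; case: eqP => [->|_]; rewrite ?sub1set ?iT ?andbF.
rewrite (bigD1 [set i]) ?sub1set ?iT ?eqxx //= big1 ?addr0; last first.
  by move=> I /andP[/andP[_ /eqP ->]]; rewrite eqxx.
congr ((-1) ^+ _ * _ * _).
rewrite /wedge_inv -(card_imset _ (_ : injective (fun k : 'I_l => (i, k)))); last by move=> x y [].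
congr #|pred_of_set _|; apply/setP => -[x y]; rewrite !inE /=.
apply/and3P/imsetP => [[/eqP -> /andP[yi yT] lt]|[k]].
  by exists y; rewrite ?inE ?yT.
by rewrite inE => /andP[kT ki] [-> ->]; rewrite eqxx kT ki neq_ltn ki.
Qed.

Lemma tofrac_inj (x y : S) : x%:F = y%:F -> x = y.
Proof. by move/eqP; rewrite tofrac_eq => /eqP. Qed.

Lemma linear_form_inj : injective (@linear_form K l).
Proof.
move=> a b e; apply/colP => i.
have := congr1 (mderiv i) e; rewrite !mderiv_linear_form.
by move/mpolyP/(_ 0%MM); rewrite !mcoeffC eqxx !mulr1.
Qed.

Lemma linear_formD (a b : 'cV[K]_l) : linear_form (a + b) = linear_form a + linear_form b.
Proof. by rewrite -big_split; apply: eq_bigr => i _; rewrite mxE scalerDl. Qed.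
Lemma linear_formZ c (a : 'cV[K]_l) : linear_form (c *: a) = c *: linear_form a.
Proof. by rewrite scaler_sumr; apply: eq_bigr => i _; rewrite mxE scalerA. Qed.
Lemma linear_form0 : @linear_form K l 0 = 0.
Proof. by rewrite /linear_form big1 // => i _; rewrite mxE scale0r. Qed.
Lemma linear_form_eq0 (a : 'cV[K]_l) : (linear_form a == 0) = (a == 0).
Proof. by apply/eqP/eqP => [|->]; rewrite -?linear_form0 // => /linear_form_inj. Qed.

Lemma linear_form_homog (a : 'cV[K]_l) : linear_form a \is 1.-homog for mdeg.
Proof.
by apply: rpred_sum => i _; apply: dhomogZ; rewrite dhomogX /= mdeg1.
Qed.

Lemma alpha_coef_neq0 (H : vsp) : is_hyperplane H -> alpha_coef H != 0.
Proof.
move=> hH; apply/eqP => a0; have := alpha_coefP hH; rewrite a0 => e.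
move: hH; rewrite /is_hyperplane -e /ker_form.
have -> : lker (linfun (mulmxr (0 : 'cV[K]_l)) : 'Hom('rV[K]_l, 'rV[K]_1)) = fullv.
  apply/eqP; rewrite eqEsubv subvf; apply/subvP => v _.
  by rewrite memv_ker lfunE /= mulmx0.
by rewrite dimvf /dim /= mul1n => /esym/n_Sn.
Qed.

Section OmegaP.
Variables (A : {fset vsp}) (m : vsp -> nat) (p : nat).
Hypothesis hA : is_arrangement A.
Local Notation Q := (defpoly A m).

Lemma alpha_neq0 (H : vsp) : H \in A -> alpha H != 0.
Proof. by move=> HA; rewrite linear_form_eq0; apply: alpha_coef_neq0; apply: hA. Qed.

Lemma defpoly_neq0 : Q != 0.
Proof.
rewrite /defpoly big_seq; elim/big_ind: _ => [||H HA]; first exact: oner_neq0.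
  by move=> x y; apply: mulf_neq0.
by rewrite expf_neq0 // alpha_neq0.
Qed.

Let QF : Q%:F != 0. Proof. by rewrite tofrac_eq0 defpoly_neq0. Qed.

Lemma Omega_numer (w : ratform K l) (z : koz l S^o) :
  (forall I, Q%:F * w I = (kget z I : S)%:F) -> log_form A m p w <-> Ulog A m p z.
Proof.
move=> wz.
have dw H T : Q%:F * wedge (ext_diff (alpha H)) w T =
    (kget (kd (acoef (alpha_coef H)) z) T : S)%:F.
  rewrite wedge_dalpha kget_kd mulr_sumr rmorph_sum; apply: eq_bigr => i _ /=.
  rewrite /GRing.scale /= mulrCA wz /acoef natfE.
  by rewrite !rmorphM rmorph_sign !mulrA.
have kz0 I : w I = 0 <-> kget z I = 0.
  split=> h; first by apply: tofrac_inj; rewrite -wz h mulr0 rmorph0.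
  by apply: (mulfI QF); rewrite wz h mulr0 rmorph0.
split.
  move=> [rw hw]; split.
    apply/kdeg_kget => I hI; have [f fE f0] := rw I.
    move: fE; rewrite ffunE wz (f0 hI) => e.
    by apply: tofrac_inj; rewrite e.
  move=> H HA; apply/kin_kget => I; have [e re eE] := hw H HA.
  have [g gE _] := re I; exists g; apply: tofrac_inj.
  have := congr1 (fun u : ratform K l => u I) eE; rewrite !ratformZ dw => ->.
  by rewrite gE rmorphM.
move=> [zd zA]; split.
  move=> I; exists (kget z I) => [|hI]; first by rewrite ffunE wz.
  by move/kdeg_kget: zd; apply.
move=> H HA; have /kin_kget h := zA H HA.
have /choice[g gP] := h.
exists ([ffun I => (g I)%:F] : {ffun {set 'I_l} -> {fraction S}}).
  move=> I; exists (g I); first by rewrite ffunE.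
  move=> hI; have := kdeg_kd (acoef (alpha_coef H)) zd.
  move/kdeg_kget => /(_ I hI); rewrite (gP I) => /eqP; rewrite mulf_eq0 => /orP[|/eqP //].
  by rewrite expf_eq0 (negPf (alpha_neq0 HA)) andbF.
apply/ffunP => I; rewrite !ratformZ dw (gP I) rmorphM; congr (_ * _).
by rewrite ffunE.
Qed.

Definition numer_poly (x : {fraction S}) : S :=
  if pselect (exists f, x = f%:F) is left h then projT1 (cid h) else 0.

Lemma numer_polyE x f : x = f%:F -> numer_poly x = f.
Proof.
move=> xf; rewrite /numer_poly; case: pselect => [h|[]]; last by exists f.
by case: cid => g /= xg; apply: tofrac_inj; rewrite -xf -xg.
Qed.

Definition numer (w : Omega A m p) : koz l S^o :=
  @kset S S^o l (fun I => numer_poly (Q%:F * Omega_val w I)).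

Lemma numerE (w : Omega A m p) I : Q%:F * Omega_val w I = (kget (numer w) I : S)%:F.
Proof.
rewrite kgetK; case: w => w /= /asboolP[rw _].
by have [f fE _] := rw I; rewrite ffunE in fE; rewrite (numer_polyE fE).
Qed.

Lemma numer_linear : linear numer.
Proof.
move=> r u v; apply: kget_ext => I; rewrite kget_lin; apply: tofrac_inj.
rewrite -numerE.
have -> : Omega_val (r *: u + v) = r *: Omega_val u + Omega_val v.
  by rewrite -[@Omega_val _ _ _ _ _]/(val) linearP.
have -> : (r *: kget (numer u) I + kget (numer v) I : S)%:F =
  r%:F * (kget (numer u) I : S)%:F + (kget (numer v) I : S)%:F.
  by rewrite rmorphD rmorphM.
by rewrite -!numerE !ffunE mulrDr mulrCA.
Qed.
HB.instance Definition _ :=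
  GRing.isLinear.Build S (Omega A m p) (koz l S^o) _ numer numer_linear.

Lemma numer_inj (w : Omega A m p) : numer w = 0 -> w = 0.
Proof.
move=> h; apply: val_inj; apply/ffunP => I; rewrite !ffunE.
by apply: (mulfI QF); rewrite numerE h kget0 mulr0 rmorph0.
Qed.

Lemma numerP (z : koz l S^o) : (exists w : Omega A m p, numer w = z) <-> Ulog A m p z.
Proof.
split=> [[w <-]|hz].
  by apply/(Omega_numer (numerE w)); case: w => w /= /asboolP.
pose w : ratform K l := ([ffun I => (kget z I : S)%:F / Q%:F] : {ffun {set 'I_l} -> {fraction S}}).
have wz I : Q%:F * w I = (kget z I : S)%:F by rewrite ffunE mulrC divfK.
have wA : w \in log_form_pred A m p by apply/asboolP/(Omega_numer wz).
exists (MkOmega wA); apply: kget_ext => I; apply: tofrac_inj.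
by rewrite -numerE /= wz.
Qed.

End OmegaP.
End OmegaKoz.

Lemma kget_kmap (R R' : comNzRingType) (V : lmodType R) (W : lmodType R')
  (phi : V -> W) n (c : koz n V) I : kget (kmap phi c) I = phi (kget c I).
Proof. by elim: n c I => [|n IH] c I //=; case: ifP => _; apply: IH. Qed.

Lemma natf_lt (R : nzRingType) n (F : 'I_n -> R) k (kn : (k < n)%N) :
  natf F k = F (Ordinal kn).
Proof. exact: (natfE F (Ordinal kn)). Qed.

Section OneForms.
Variable R : comNzRingType.
Implicit Types (n : nat) (u a : nat -> R) (U : R^o -> Prop).

Fixpoint kone n : koz n R^o :=
  match n return koz n R^o with
  | 0 => 1
  | n'.+1 => (kone n', 0)
  end.

Lemma kget_kone n : kget (kone n) set0 = 1.
Proof.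
elim: n => //= n IH; rewrite inE -[RHS]IH; congr kget.
by apply/setP => j; rewrite !inE.
Qed.

(** Since [kone] is the unit of the exterior algebra, this is the 1-form with coefficients u_0, ...,
    u_(n-1). *)
Definition kv n u : koz n R^o := kd u (kone n).

Lemma kdeg_kone n : kdeg 0 (kone n).
Proof. by elim: n => [|n IH] /=; [left|split]. Qed.

Lemma kdeg_kv n u : kdeg 1 (kv n u).
Proof. exact: kdeg_kd (kdeg_kone n). Qed.

Lemma kv_linear n r u u' :
  kv n (fun k => r * u k + u' k) = r *: kv n u + kv n u'.
Proof. by rewrite /kv kd_addf kd_scalef. Qed.

Lemma kvS n u : kv n.+1 u = (kv n (fun k => u k.+1), u 0%N *: kone n).
Proof. by rewrite /kv /= linear0 subr0. Qed.

Lemma kin_kone n U s : submod U -> kin U (s *: kone n) <-> U s.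
Proof.
move=> sU; elim: n => [|n IH] /=; first by rewrite /GRing.scale /= mulr1.
split=> [[/IH //]|/IH h]; split=> //.
by rewrite scaler0; apply: kin0.
Qed.

Lemma kin_kv n U u : submod U -> kin U (kv n u) <-> forall k, (k < n)%N -> U (u k).
Proof.
move=> sU; elim: n u => [|n IH] u.
  by split=> // _; rewrite /kv /=; case: sU.
rewrite kvS; split.
  by move=> [/IH h1 /(kin_kone _ _ sU) h2] [|k] kn //; apply: h1.
by move=> h; split; [apply/IH => k kn; apply: h|apply/kin_kone => //; apply: h].
Qed.

Lemma kin_kd_kv n U a u : submod U -> kin U (kd a (kv n u)) <->
  forall i j, (i < n)%N -> (j < n)%N -> U (a i * u j - a j * u i).
Proof.
move=> sU; elim: n a u => [|n IH] a u.
  by split=> // _; rewrite /kv /=; case: sU.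
rewrite kvS /= linearZ /=.
have -> : a 0 *: kv n (fun k => u k.+1) - u 0 *: kd (fun k => a k.+1) (kone n) =
    kv n (fun k => a 0%N * u k.+1 - u 0%N * a k.+1).
  have := kv_linear n (a 0%N) (fun k => u k.+1) (fun k => - u 0%N * a k.+1).
  rewrite {3}/kv kd_scalef scaleNr => <-; apply: kd_eqf => k _.
  by rewrite mulNr.
split.
  move=> [/IH h1 /(kin_kv _ _ sU) h2] [|i] [|j] hi hj.
  - by rewrite subrr; case: sU.
  - by have := h2 j hj; rewrite [u 0%N * _]mulrC.
  - by have := submodN sU (h2 i hi); rewrite opprB [u 0%N * _]mulrC.
  - exact: h1.
move=> h; split; first by apply/IH => i j hi hj; apply: (h i.+1 j.+1).
by apply/kin_kv => // k kn; rewrite [u 0%N * _]mulrC; apply: (h 0%N k.+1).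
Qed.

Lemma kdeg0E n (z : koz n R^o) : kdeg 0 z -> exists s, z = s *: kone n.
Proof.
elim: n z => [|n IH] z; first by exists z; rewrite /GRing.scale /= mulr1.
case: z => a b /= [/IH[s ->] ->]; exists s.
by congr (_, _); rewrite scaler0.
Qed.

Lemma kdeg1E n (z : koz n R^o) : kdeg 1 z -> exists u, z = kv n u.
Proof.
elim: n z => [|n IH] z; first by case=> // ->; exists (fun=> 0).
case: z => a b /= [/IH[u ->] /kdeg0E[s ->]].
by exists (fun k => if k is k'.+1 then u k' else s); rewrite kvS.
Qed.

Lemma kv_eq0 n u : kv n u = 0 -> forall k, (k < n)%N -> u k = 0.
Proof.
move=> e; have s0 : submod (fun x : R^o => x = 0).
  by split=> // r x y -> ->; rewrite scaler0 addr0.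
have := kin_kv n u s0; rewrite e => -[h _]; apply: h; exact: kin0.
Qed.

Definition kvec n (eta : 'rV[R]_n) : koz n R^o := kv n (natf (fun i => eta 0 i)).

Lemma natf_lin n r (F G : 'I_n -> R) k :
  natf (fun i => r * F i + G i) k = r * natf F k + natf G k.
Proof. by rewrite /natf; case: insub => [i|]; rewrite ?mulr0 ?addr0. Qed.

Lemma kvec_linear n : linear (@kvec n).
Proof.
move=> r u v; rewrite /kvec -kv_linear; apply: kd_eqf => k _.
by rewrite -natf_lin /natf; case: insub => [i|//]; rewrite !mxE.
Qed.
HB.instance Definition _ n :=
  GRing.isLinear.Build R 'rV[R]_n (koz n R^o) _ (@kvec n) (@kvec_linear n).

Lemma kvec_inj n (eta : 'rV[R]_n) : kvec eta = 0 -> eta = 0.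
Proof.
move=> /kv_eq0 h; apply/rowP => i; rewrite mxE.
by have := h i (ltn_ord i); rewrite natfE.
Qed.

Lemma kvec_surj n (z : koz n R^o) : kdeg 1 z -> exists eta : 'rV[R]_n, kvec eta = z.
Proof.
move=> /kdeg1E[u ->]; exists (\row_i u i); apply: kd_eqf => k kn.
by rewrite (natfE _ (Ordinal kn)) mxE.
Qed.

End OneForms.

Section OmegaHvan.
Variables (K : fieldType) (l : nat).
Local Notation S := {mpoly K[l]}.
Local Notation vsp := {vspace 'rV[K]_l}.
Variables (A : {fset vsp}) (m : vsp -> nat).
Hypothesis hA : is_arrangement A.

Lemma Ulog_pihomog p d (z : koz l S^o) : Ulog A m p z -> Ulog A m p (kmap (pihomog mdeg d : S^o -> S^o) z).
Proof.
have a0 : kadd (fun _ : S^o => True) (pihomog mdeg d : S^o -> S^o).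
  by move=> u v _ _; rewrite pihomogB.
move=> [h1 h2]; split; first by apply: kdeg_kmap => //; rewrite pihomog0.
move=> H HA; rewrite -(kmap_kd2 (f := acoef (alpha_coef H)) (submodT _) a0); last first.
- exact: kin_true.
- move=> k u kl _; rewrite /acoef /natf insubT /GRing.scale /= !mul_mpolyC.
  by rewrite linearZ.
apply: kin_kmap (h2 H HA) => _ [c ->].
rewrite mulrC (pihomogM _ _ (_ : _ \is (1 * m H).-homog for mdeg)); last first.
  by apply: dhomogMn; apply: linear_form_homog.
by case: ifP => _; [rewrite mulrC; exists (pihomog mdeg (d - 1 * m H) c)|exists 0; rewrite mulr0].
Qed.

Let N := #|{: {set 'I_l}}|.
Let row_of (z : koz l S^o) : 'rV[S]_N := \row_i kget z (enum_val i).

Let row_of_linear : linear row_of.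
Proof. by move=> r u v; apply/rowP => i; rewrite !mxE kget_lin. Qed.
HB.instance Definition _ := GRing.isLinear.Build S (koz l S^o) 'rV[S]_N _ row_of row_of_linear.

Let row_of_inj z : row_of z = 0 -> z = 0.
Proof.
move=> e; apply: kget_ext => I; rewrite kget0.
by move/rowP/(_ (enum_rank I)): e; rewrite !mxE enum_rankK.
Qed.

Lemma pd_le_Omega (t : nat -> S) p q : (0 < l)%N -> good t l l ->
  (forall k, (t k)@_0 = 0) ->
  (forall f : S, f@_0 = 0 -> inideal t l (fun _ : S^o => True) f) ->
  (forall p', (p' + q < l)%N -> Hvan t l p' (Ulog A m p)) ->
  pd_le (Omega A m p) q.
Proof.
move=> l0 tg t0 tgen hv.
pose iota : {linear Omega A m p -> 'rV[S]_N} := (row_of \o @numer K l A m p)%FUN.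
apply: (@pd_le_Hvan K l l t l0 tg t0 tgen q N (fun=> 0%N) _ iota).
- by move=> x /row_of_inj/(numer_inj hA).
- move=> d _ [w <-].
  have Uw : Ulog A m p (numer w) by apply/(numerP m p hA); exists w.
  have /(numerP m p hA)[w' w'E] := Ulog_pihomog d Uw.
  exists w'; rewrite /iota /= w'E.
  apply/rowP => i; rewrite !mxE /= subn0.
  by rewrite kget_kmap.
move=> p' p'q; apply: (@Hvan_iso _ _ _ _ l t t (Ulog A m p) _ row_of).
- exact: Ulog_submod.
- by move=> u v _ _; rewrite linearB.
- by move=> k u _ _; rewrite linearZ.
- by move=> _ [w <-]; exists (numer w) => //; apply/(numerP m p hA); exists w.
- by move=> z /(numerP m p hA)[w <-]; exists w.
- by move=> z _; apply: row_of_inj.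
- exact: hv.
Qed.

(* The contraction of a 1-form with a constant vector field. *)
Definition ev (eta : 'rV[S]_l) (v : 'rV[K]_l) : S := \sum_i v 0 i *: eta 0 i.

Lemma evD eta u v : ev eta (u + v) = ev eta u + ev eta v.
Proof. by rewrite -big_split; apply: eq_bigr => i _; rewrite mxE scalerDl. Qed.
Lemma evZ eta c v : ev eta (c *: v) = c *: ev eta v.
Proof. by rewrite scaler_sumr; apply: eq_bigr => i _; rewrite mxE scalerA. Qed.
Lemma evDl x y v : ev (x + y) v = ev x v + ev y v.
Proof. by rewrite -big_split; apply: eq_bigr => i _; rewrite mxE scalerDr. Qed.
Lemma evZl r x v : ev (r *: x) v = r * ev x v.
Proof. by rewrite /ev mulr_sumr; apply: eq_bigr => i _; rewrite mxE -!mul_mpolyC mulrCA. Qed.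
Lemma ev_delta eta i : ev eta (delta_mx 0 i) = eta 0 i.
Proof.
rewrite /ev (bigD1 i) //= mxE !eqxx scale1r big1 ?addr0 // => j ji.
by rewrite mxE (negPf ji) andbF scale0r.
Qed.

Lemma mem_hyperplane (H : vsp) (v : 'rV[K]_l) : is_hyperplane H ->
  (v \in H) = ((v *m alpha_coef H) 0 0 == 0).
Proof.
move=> hH; rewrite -{1}(alpha_coefP hH) memv_ker lfunE /=.
by apply/eqP/eqP => [->|e]; [rewrite mxE|apply/matrixP => i j; rewrite !ord1 e mxE].
Qed.

(* Numerators of logarithmic 1-forms: the condition on d alpha_H /\ eta says that
   alpha_H^m(H) divides the values of eta on H. *)
Definition UA (eta : 'rV[S]_l) : Prop :=
  forall H, H \in A -> forall v, v \in H -> mdvd (alpha H ^+ m H) (ev eta v).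

Lemma mdvdD (R : comNzRingType) (a x y : R) : mdvd a x -> mdvd a y -> mdvd a (x + y).
Proof. by move=> [c ->] [d ->]; exists (c + d); rewrite mulrDr. Qed.
Lemma mdvdMl (R : comNzRingType) (a x y : R) : mdvd a x -> mdvd a (y * x).
Proof. by move=> [c ->]; exists (y * c); rewrite mulrCA. Qed.
Lemma mdvdZ (a x : S) (c : K) : mdvd a x -> mdvd a (c *: x).
Proof. by rewrite -mul_mpolyC; apply: mdvdMl. Qed.
Lemma mdvd_sum (R : comNzRingType) (a : R) I (r : seq I) (P : pred I) F :
  (forall i, P i -> mdvd a (F i)) -> mdvd a (\sum_(i <- r | P i) F i).
Proof.
move=> h; elim/big_ind: _ => //; first by exists 0; rewrite mulr0.
by move=> x y; apply: mdvdD.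
Qed.

Lemma UA_submod : submod UA.
Proof.
split.
  by move=> H _ v _; exists 0; rewrite mulr0 /ev big1 // => i _; rewrite mxE scaler0.
move=> r x y hx hy H HA v vH; rewrite evDl evZl; apply: mdvdD; last exact: hy.
by apply: mdvdMl; apply: hx.
Qed.

(** The coefficients of d alpha_H /\ eta are the values of eta on the vectors a_i e_j - a_j e_i,
    where a is the coefficient vector of alpha_H, and these vectors span H. *)
Lemma Ulog_kvec eta : Ulog A m 1 (kvec eta) <-> UA eta.
Proof.
have pair H i j (hi : (i < l)%N) (hj : (j < l)%N) :
    acoef (alpha_coef H) i * natf (fun i => eta 0 i) j
    - acoef (alpha_coef H) j * natf (fun i => eta 0 i) i =
    ev eta (alpha_coef H (Ordinal hi) 0 *: delta_mx 0 (Ordinal hj)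
            - alpha_coef H (Ordinal hj) 0 *: delta_mx 0 (Ordinal hi)).
  rewrite -scaleNr evD !evZ !ev_delta scaleNr /acoef.
  by rewrite !(natf_lt _ hi) !(natf_lt _ hj) -!mul_mpolyC.
split.
  move=> [_ h] H HA v vH.
  have /(kin_kd_kv _ _ _ (mdvd_submod _)) hij := h H HA.
  have a0 : alpha_coef H != 0 by apply: alpha_coef_neq0; apply: hA.
  have [j aj] : exists j, alpha_coef H j 0 != 0.
    apply/existsP; apply: contraR a0; rewrite negb_exists => /forallP a0.
    by apply/eqP/colP => j; rewrite mxE; apply/eqP; have := a0 j; rewrite negbK.
  have va : \sum_i v 0 i * alpha_coef H i 0 = 0.
    by move: vH; rewrite (mem_hyperplane _ (hA HA)) => /eqP; rewrite mxE.
  have -> : ev eta v = (alpha_coef H j 0)^-1 *: (\sum_i v 0 i *: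
     (alpha_coef H j 0 *: eta 0 i - alpha_coef H i 0 *: eta 0 j)).
    have -> : \sum_i v 0 i *: (alpha_coef H j 0 *: eta 0 i - alpha_coef H i 0 *: eta 0 j)
      = alpha_coef H j 0 *: ev eta v.
      rewrite /ev scaler_sumr.
      under eq_bigr do rewrite scalerBr !scalerA mulrC.
      rewrite sumrB -scaler_suml va scale0r subr0.
      by apply: eq_bigr => i _; rewrite scalerA.
    by rewrite scalerA mulVf // scale1r.
  apply: mdvdZ; apply: mdvd_sum => i _; apply: mdvdZ.
  have := hij j i (ltn_ord j) (ltn_ord i); rewrite /acoef !natfE.
  by rewrite !mul_mpolyC.
move=> h; split; first exact: kdeg_kv.
move=> H HA; apply/kin_kd_kv; first exact: mdvd_submod.
move=> i j hi hj; rewrite pair; apply: h => //.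
rewrite (mem_hyperplane _ (hA HA)) mulmxBl -!scalemxAl -!rowE !mxE.
by rewrite mulrC subrr.
Qed.

Lemma Hvan_Ulog1 f n p : Hvan f n p (Ulog A m 1) <-> Hvan f n p UA.
Proof.
split=> h.
  pose phi (z : koz l S^o) : 'rV[S]_l := \row_i kget z [set i].
  have phiK eta : phi (kvec eta) = eta.
    apply/rowP => i; rewrite mxE /kvec /kv kget_kd big_set1 natfE.
    rewrite (_ : [set k in [set i] | (k < i)%N] = set0) ?cards0 ?scale1r; last first.
      by apply/setP => k; rewrite !inE; case: eqP => [->|//]; rewrite ltnn.
    by rewrite setDv kget_kone /GRing.scale /= mulr1.
  apply: (@Hvan_iso _ _ _ _ n f f (Ulog A m 1) _ phi).
  - exact: Ulog_submod.
  - by move=> u v _ _; apply/rowP => i; rewrite !mxE kget_sub.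
  - by move=> k u _ _; apply/rowP => i; rewrite !mxE kgetZ.
  - by move=> w wU; exists (kvec w); [apply/Ulog_kvec|apply: phiK].
  - by move=> z zU; have [eta ez] := kvec_surj zU.1; move: zU; rewrite -ez phiK => /Ulog_kvec.
  - by move=> z zU; have [eta ez] := kvec_surj zU.1; rewrite -ez phiK => ->; rewrite linear0.
  - exact: h.
apply: (@Hvan_iso _ _ _ _ n f f UA _ (@kvec S l)).
- exact: UA_submod.
- by move=> u v _ _; rewrite linearB.
- by move=> k u _ _; rewrite linearZ.
- move=> z zU; have [eta ez] := kvec_surj zU.1; exists eta => //.
  by apply/Ulog_kvec; rewrite ez.
- by move=> u /Ulog_kvec.
- by move=> u _; apply: kvec_inj.
- exact: h.
Qed.

Lemma Hvan_UA_pd f n g q : good f n g -> pd_le (Omega A m 1) q ->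
  forall p, (p + q < g)%N -> Hvan f n p UA.
Proof.
move=> gf pq p pg; apply/Hvan_Ulog1.
apply: (@Hvan_iso _ _ _ _ n f f (fun _ : Omega A m 1 => True) _ (@numer K l A m 1)) => //.
- by move=> u v _ _; rewrite linearB.
- by move=> k u _ _; rewrite linearZ.
- by move=> w /(numerP m 1 hA)[x <-]; exists x.
- by move=> u _; apply/(numerP m 1 hA); exists u.
- by move=> u _; apply: (numer_inj hA).
- exact: (Hvan_pd_le gf pq).
Qed.

End OmegaHvan.

(** * Restriction to a hyperplane *)

Section PrimeProducts.
Variable R : idomainType.

Definition mprime (p : R) : Prop :=
  p != 0 /\ forall x y, mdvd p (x * y) -> mdvd p x \/ mdvd p y.

Lemma mdvd_cancel (c p x : R) : c != 0 -> mdvd (c * p) (c * x) -> mdvd p x.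
Proof. by move=> c0 [d]; rewrite -mulrA => /(mulfI c0) ->; exists d. Qed.

Lemma mdvd_refl (p : R) : mdvd p p. Proof. by exists 1; rewrite mulr1. Qed.
Lemma mdvd_trans (p q r : R) : mdvd p q -> mdvd q r -> mdvd p r.
Proof. by move=> [c ->] [d ->]; exists (c * d); rewrite mulrA. Qed.
Lemma mdvdMr (p x y : R) : mdvd p x -> mdvd p (x * y).
Proof. by move=> [c ->]; exists (c * y); rewrite mulrA. Qed.
Lemma mdvd_exp (p : R) m k : (m <= k)%N -> mdvd (p ^+ m) (p ^+ k).
Proof. by move=> mk; exists (p ^+ (k - m)); rewrite -exprD subnKC. Qed.

Lemma mprime_pow (p u x : R) m : mprime p -> ~ mdvd p u ->
  mdvd (p ^+ m) (u * x) -> mdvd (p ^+ m) x.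
Proof.
move=> [p0 pp] nu; elim: m x => [|m IH] x; first by move=> _; exists x; rewrite mul1r.
move=> h; have [//|[y xE]] : mdvd p u \/ mdvd p x.
  by apply: pp; case: h => c ->; rewrite exprS -mulrA; exists (p ^+ m * c).
subst x; move: h; rewrite exprS mulrCA => /(mdvd_cancel p0)/IH[c ->].
by exists c; rewrite mulrA.
Qed.

Section Family.
Variables (I : Type) (P : I -> R).

Let assoc i j : bool := `[< mdvd (P i) (P j) >].

(* The valuation of the product at P i is the number of factors P j divisible
   by P i, provided P j / P i is prime to P i. *)
Lemma prime_valuation i (s : seq I) k b : mprime (P i) ->
  (forall j, List.In j s -> mdvd (P i) (P j) -> exists2 u, P j = P i * u & ~ mdvd (P i) u) ->
  mdvd (P i ^+ (count (assoc i) s + k)) ((\prod_(j <- s) P j) * b) ->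
  mdvd (P i ^+ k) b.
Proof.
move=> pp; have p0 := pp.1.
elim: s => [|j s IH] /= hu; first by rewrite big_nil mul1r add0n.
have {}IH := IH (fun x xs => hu x (or_intror xs)).
rewrite big_cons -mulrA; case: (boolP (assoc i j)) => [/asboolP/(hu j (or_introl erefl))[u -> nu]|/asboolP nij].
  rewrite -addnA [X in _ ^+ X]add1n exprS -mulrA => /(mdvd_cancel p0).
  by move/(mprime_pow pp nu).
by rewrite add0n => /(mprime_pow pp nij).
Qed.

(** Factors may be associated, and each class is counted with its multiplicity: members of A with
    the same intersection with H restrict to proportional forms on H. *)
Lemma prime_prod_dvd (s : seq I) a :
  (forall i, List.In i s -> mprime (P i)) ->
  (forall i j, List.In i s -> List.In j s -> mdvd (P i) (P j) ->
     exists2 u, P j = P i * u & ~ mdvd (P i) u) ->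
  (forall i, List.In i s -> mdvd (P i ^+ count (fun j => `[< mdvd (P i) (P j) >]) s) a) ->
  mdvd (\prod_(i <- s) P i) a.
Proof.
elim: s => [|i s IH] pp hu h; first by rewrite big_nil; exists a; rewrite mul1r.
have [b ab] : mdvd (\prod_(j <- s) P j) a.
  apply: IH => [j js|j k js ks|j js].
  - exact: pp (or_intror js).
  - exact: hu (or_intror js) (or_intror ks).
  apply: mdvd_trans (h j (or_intror js)); apply: mdvd_exp => /=.
  exact: leq_addl.
have ii : assoc i i by apply/asboolP; apply: mdvd_refl.
have := h i (or_introl erefl); rewrite /= -/(assoc i i) ii addnC ab.
move/(prime_valuation (pp i (or_introl erefl)) (fun j js => hu i j (or_introl erefl) (or_intror js))).
by rewrite expr1 => -[c ->]; exists c; rewrite big_cons mulrCA mulrA.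
Qed.

End Family.

Lemma mem_In (I : eqType) (s : seq I) i : i \in s <-> List.In i s.
Proof.
elim: s => //= j s IH; rewrite inE; split.
  by move=> /orP[/eqP ->|/IH]; [left|right].
by move=> [->|/IH ->]; rewrite ?eqxx ?orbT.
Qed.

Lemma prime_prod_dvd_uniq (I : eqType) (P : I -> R) (s : seq I) a : uniq s ->
  (forall i, i \in s -> mprime (P i)) ->
  (forall i j, i \in s -> j \in s -> mdvd (P i) (P j) -> i = j) ->
  (forall i, i \in s -> mdvd (P i) a) ->
  mdvd (\prod_(i <- s) P i) a.
Proof.
elim: s => [|i s IH] //= /[swap]; first by rewrite big_nil => *; exists a; rewrite mul1r.
move=> /[swap] /andP[nis us] pp hu h.
have [b ab] : mdvd (\prod_(j <- s) P j) a.
  apply: IH => // [j js|j k js ks|j js].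
  - by apply: pp; rewrite inE js orbT.
  - by apply: hu; rewrite inE ?js ?ks orbT.
  - by apply: h; rewrite inE js orbT.
have pi := pp i (mem_head _ _).
have ns : forall r : seq I, {subset r <= s} -> mdvd (P i) ((\prod_(j <- r) P j) * b) -> mdvd (P i) b.
  elim=> [|j r IHr] sub; first by rewrite big_nil mul1r.
  rewrite big_cons -mulrA => /(pi.2)[|]; last first.
    by apply: IHr => k kr; apply: sub; rewrite inE kr orbT.
  have js := sub j (mem_head _ _) => ij.
  have js' : j \in i :: s by rewrite inE js orbT.
  by case/negP: nis; rewrite (hu i j (mem_head _ _) js' ij).
have := h i (mem_head _ _); rewrite ab => /(ns s (fun _ => id))[c ->].
by exists c; rewrite big_cons mulrCA mulrA.
Qed.

End PrimeProducts.

(** * Linear substitutions and the coordinate ring of H *)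

Section LinSub.
Variable K : fieldType.

Lemma linear_formB l (a b : 'cV[K]_l) : linear_form a - linear_form b = linear_form (a - b).
Proof. by have := linear_formZ (-1) b; rewrite !scaleN1r linear_formD => ->. Qed.

(** The pullback of functions along the linear map sending the row vector w to [w *m B], from K^k to
    K^l. *)
Definition lsub k l (B : 'M[K]_(k, l)) (p : {mpoly K[l]}) : {mpoly K[k]} :=
  p \mPo [tuple linear_form (col i B) | i < l].
HB.instance Definition _ k l (B : 'M[K]_(k, l)) :=
  GRing.RMorphism.copy (lsub B) (comp_mpoly [tuple linear_form (col i B) | i < l]).
HB.instance Definition _ k l (B : 'M[K]_(k, l)) :=
  GRing.Linear.copy (lsub B) (comp_mpoly [tuple linear_form (col i B) | i < l]).

Lemma lsubX k l (B : 'M[K]_(k, l)) i : lsub B 'X_i = linear_form (col i B).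
Proof. by rewrite /lsub comp_mpolyXU -tnth_nth tnth_mktuple. Qed.

Lemma lsubC k l (B : 'M[K]_(k, l)) c : lsub B c%:MP = c%:MP.
Proof. exact: comp_mpolyC. Qed.

Lemma lsub_lf k l (B : 'M[K]_(k, l)) c : lsub B (linear_form c) = linear_form (B *m c).
Proof.
rewrite {1}/linear_form linear_sum /=.
transitivity (\sum_i linear_form (c i 0 *: col i B)).
  by apply: eq_bigr => i _; rewrite linearZ /= lsubX linear_formZ.
rewrite -(big_morph (@linear_form K k) (@linear_formD K k) (@linear_form0 K k)).
congr linear_form; apply/colP => j; rewrite summxE mxE.
by apply: eq_bigr => i _; rewrite !mxE mulrC.
Qed.

Lemma mpoly_ring_ind l (P : {mpoly K[l]} -> Prop) :
  (forall c, P c%:MP) -> (forall i, P 'X_i) ->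
  (forall p q, P p -> P q -> P (p + q)) -> (forall p q, P p -> P q -> P (p * q)) ->
  forall p, P p.
Proof.
move=> PC PX PD PM p; rewrite (mpolyE p); elim/big_ind: _; [exact: (PC 0)|exact: PD|].
move=> m _; rewrite -mul_mpolyC; apply: (PM) => //; rewrite mpolyXE_id.
elim/big_ind: _ => //; first exact: (PC 1).
by move=> i _; elim: (m i) => [|k hk]; [exact: (PC 1)|rewrite exprS; apply: PM].
Qed.

Lemma lsub_comp j k l (B : 'M[K]_(j, k)) (C : 'M[K]_(k, l)) p :
  lsub B (lsub C p) = lsub (B *m C) p.
Proof.
elim/mpoly_ring_ind: p => [c|i|p q hp hq|p q hp hq]; first by rewrite !lsubC.
- by rewrite !lsubX lsub_lf !colE mulmxA.
- by rewrite !rmorphD /= hp hq.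
- by rewrite !rmorphM /= hp hq.
Qed.

Lemma lsub1 l (p : {mpoly K[l]}) : lsub 1%:M p = p.
Proof.
elim/mpoly_ring_ind: p => [c|i|p q hp hq|p q hp hq]; first by rewrite lsubC.
- rewrite lsubX /linear_form (bigD1 i) //= !mxE eqxx scale1r big1 ?addr0 // => j ji.
  by rewrite !mxE (negPf ji) scale0r.
- by rewrite rmorphD /= hp hq.
- by rewrite rmorphM /= hp hq.
Qed.

End LinSub.

Section Pairing.
Variables (K : fieldType) (l : nat).
Implicit Types (u v : 'rV[K]_l) (c d : 'cV[K]_l).

Definition pair v c : K := (v *m c) 0 0.

Lemma pairDl u v c : pair (u + v) c = pair u c + pair v c.
Proof. by rewrite /pair mulmxDl mxE. Qed.
Lemma pairZl k v c : pair (k *: v) c = k * pair v c.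
Proof. by rewrite /pair -scalemxAl mxE. Qed.
Lemma pairBl u v c : pair (u - v) c = pair u c - pair v c.
Proof. by rewrite pairDl -scaleN1r pairZl mulN1r. Qed.
Lemma pairDr v c d : pair v (c + d) = pair v c + pair v d.
Proof. by rewrite /pair mulmxDr mxE. Qed.
Lemma pairZr k v c : pair v (k *: c) = k * pair v c.
Proof. by rewrite /pair -scalemxAr mxE. Qed.
Lemma pairBr v c d : pair v (c - d) = pair v c - pair v d.
Proof. by rewrite pairDr -scaleN1r pairZr mulN1r. Qed.
Lemma pair_delta i c : pair (delta_mx 0 i) c = c i 0.
Proof. by rewrite /pair -rowE mxE. Qed.
Lemma pair_ext c d : (forall v, pair v c = pair v d) -> c = d.
Proof. by move=> h; apply/colP => i; have := h (delta_mx 0 i); rewrite !pair_delta. Qed.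
Lemma mulmx_pair0 k (B : 'M[K]_(k, l)) (u : 'rV_k) c : B *m c = 0 -> pair (u *m B) c = 0.
Proof. by move=> e; rewrite /pair -mulmxA e mulmx0 mxE. Qed.

End Pairing.

Section Hyperplane.
Variables (K : fieldType) (l : nat) (H : {vspace 'rV[K]_l}).
Hypothesis hH : is_hyperplane H.
Local Notation n := (\dim H).
Local Notation S := {mpoly K[l]}.
Local Notation T := {mpoly K[n]}.
Local Notation a := (alpha_coef H).

(* hpi is the restriction to H in the coordinates of param H, and hsg a section
   of it. *)
Definition hbas : 'M[K]_(n, l) := \matrix_i (vbasis H)`_i.
Definition hdual : 'M[K]_(l, n) := pinvmx hbas.
Definition hpi : S -> T := lsub hbas.
Definition hsg : T -> S := lsub hdual.

Lemma hpiD p q : hpi (p + q) = hpi p + hpi q. Proof. exact: (rmorphD (lsub hbas)). Qed.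
Lemma hpiB p q : hpi (p - q) = hpi p - hpi q. Proof. exact: (rmorphB (lsub hbas)). Qed.
Lemma hpiM p q : hpi (p * q) = hpi p * hpi q. Proof. exact: (rmorphM (lsub hbas)). Qed.
Lemma hpi0 : hpi 0 = 0. Proof. exact: (rmorph0 (lsub hbas)). Qed.
Lemma hpiZ c p : hpi (c *: p) = c *: hpi p. Proof. exact: (linearZ_LR (lsub hbas)). Qed.
Lemma hsgD p q : hsg (p + q) = hsg p + hsg q. Proof. exact: (rmorphD (lsub hdual)). Qed.
Lemma hsgM p q : hsg (p * q) = hsg p * hsg q. Proof. exact: (rmorphM (lsub hdual)). Qed.
Lemma hpi_lf c : hpi (linear_form c) = linear_form (hbas *m c). Proof. exact: lsub_lf. Qed.
Lemma hbas_mem (u : 'rV[K]_n) : u *m hbas \in H.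
Proof.
rewrite mulmx_sum_row; apply: memv_suml => i _; rewrite memvZ // rowK.
by rewrite vbasis_mem ?mem_nth ?size_tuple.
Qed.

Lemma hbas_surj (v : 'rV[K]_l) : v \in H -> exists u, v = u *m hbas.
Proof.
move=> vH; exists (\row_i coord (vbasis H) i v).
rewrite mulmx_sum_row [LHS](coord_vbasis vH).
by apply: eq_bigr => i _; rewrite mxE rowK.
Qed.

Lemma hbas_inj (u : 'rV[K]_n) : u *m hbas = 0 -> u = 0.
Proof.
rewrite mulmx_sum_row => e; apply/rowP => i; rewrite mxE.
have /freeP h := basis_free (vbasisP H).
by apply: (h (fun i => u 0 i)); rewrite -[RHS]e; apply: eq_bigr => j _; rewrite rowK.
Qed.

Lemma hbas_dual : hbas *m hdual = 1%:M.
Proof.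
apply: mulmxVp; rewrite -kermx_eq0; apply/eqP/row_matrixP => i.
by rewrite row0; apply: hbas_inj; rewrite -row_mul mulmx_ker row0.
Qed.

Lemma hsgK p : hpi (hsg p) = p.
Proof. by rewrite /hpi /hsg lsub_comp hbas_dual lsub1. Qed.

Lemma hbas_alpha : hbas *m a = 0.
Proof.
apply/row_matrixP => i; rewrite row0 row_mul; apply/matrixP => j k.
have := hbas_mem (delta_mx 0 i); rewrite (mem_hyperplane _ hH) -rowE => /eqP e.
by rewrite !ord1 e mxE.
Qed.

Lemma hpi_alpha : hpi (alpha H) = 0.
Proof. by rewrite hpi_lf hbas_alpha linear_form0. Qed.

Lemma mem_hpair (v : 'rV[K]_l) : (v \in H) = (pair v a == 0).
Proof. exact: mem_hyperplane. Qed.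

Lemma hz_ex : exists z : 'rV[K]_l, pair z a = 1.
Proof.
have : a != 0 by apply: alpha_coef_neq0.
case: (pselect (exists i, a i 0 != 0)) => [[i ai] _|h]; last first.
  move=> /eqP; case; apply/colP => i; rewrite mxE; apply/eqP/negPn/negP => ai.
  by apply: h; exists i.
exists ((a i 0)^-1 *: delta_mx 0 i).
by rewrite pairZl pair_delta mulVf.
Qed.

Lemma hz_norm_ex : exists z : 'rV[K]_l, pair z a = 1 /\ z *m hdual = 0.
Proof.
have [z e] := hz_ex; exists (z - z *m hdual *m hbas); split.
  by rewrite pairBl e mulmx_pair0 ?hbas_alpha ?subr0.
by rewrite mulmxBl -[_ *m hbas *m _]mulmxA hbas_dual mulmx1 subrr.
Qed.

(* A vector outside H normalised so that the coordinates hdual vanish on it. *)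
Definition hz : 'rV[K]_l := projT1 (cid hz_norm_ex).

Lemma hzP : pair hz a = 1. Proof. by rewrite /hz; case: cid => z []. Qed.

Lemma hz_dual : hz *m hdual = 0. Proof. by rewrite /hz; case: cid => z []. Qed.

Lemma hsplit (v : 'rV[K]_l) : v = pair v a *: hz + v *m hdual *m hbas.
Proof.
have vH : v - pair v a *: hz \in H by rewrite mem_hpair pairBl pairZl hzP mulr1 subrr.
have [u e] := hbas_surj vH.
have vE : v = pair v a *: hz + u *m hbas by rewrite -e addrC subrK.
rewrite {1}vE; congr (_ + _ *m _).
by rewrite vE mulmxDl -scalemxAl hz_dual scaler0 add0r -mulmxA hbas_dual mulmx1.
Qed.

Lemma hdecomp (v : 'rV[K]_l) : exists u, v = pair v a *: hz + u *m hbas.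
Proof. by exists (v *m hdual); apply: hsplit. Qed.

Lemma hbas_ker (c : 'cV[K]_l) : hbas *m c = 0 -> exists k, c = k *: a.
Proof.
move=> hc; exists (pair hz c); apply: pair_ext => v.
have [u ->] := hdecomp v; rewrite !pairDl !pairZl pairZr pairZr hzP mulr1.
by rewrite !mulmx_pair0 ?hbas_alpha // mulr0.
Qed.

(** The polynomials q for which alpha_H divides q - hsg (hpi q) contain the constants and the
    variables and are closed under sums and products. *)
Lemma hpi_ker p : hpi p = 0 -> mdvd (alpha H) p.
Proof.
have h q : mdvd (alpha H) (q - hsg (hpi q)).
  elim/mpoly_ring_ind: q => [c|i|q r hq hr|q r hq hr].
  - by rewrite /hsg /hpi !lsubC subrr; exists 0; rewrite mulr0.
  - have -> : 'X_i = linear_form (delta_mx i 0) :> S.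
      rewrite /linear_form (bigD1 i) //= mxE !eqxx scale1r big1 ?addr0 // => j ji.
      by rewrite mxE (negPf ji) scale0r.
    rewrite /hsg /hpi lsub_comp lsub_lf.
    have [k hk] : exists k, delta_mx i 0 - hdual *m hbas *m delta_mx i 0 = k *: a.
      by apply: hbas_ker; rewrite mulmxBr mulmxA [hbas *m (hdual *m hbas)]mulmxA hbas_dual mul1mx subrr.
    exists k%:MP; rewrite mulrC mul_mpolyC /alpha -linear_formZ -hk.
    exact: linear_formB.
  - rewrite hpiD hsgD; move: (hsg (hpi q)) (hsg (hpi r)) hq hr => q' r' hq hr.
    by rewrite opprD addrACA; apply: mdvdD.
  - rewrite hpiM hsgM.
    move: (hsg (hpi q)) (hsg (hpi r)) hq hr => q' r' hq hr.
    have -> : q * r - q' * r' = r * (q - q') + q' * (r - r') by ring.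
    by apply: mdvdD; apply: mdvdMl.
by move=> p0; have := h p; rewrite p0 /hsg rmorph0 subr0.
Qed.

Lemma hpi_eq0 p : hpi p = 0 <-> mdvd (alpha H) p.
Proof. by split=> [|[c ->]]; [exact: hpi_ker|rewrite hpiM hpi_alpha mul0r]. Qed.

Lemma alpha_neq0' : alpha H != 0.
Proof. by rewrite linear_form_eq0 alpha_coef_neq0. Qed.

Lemma alpha_prime : mprime (alpha H).
Proof.
split=> [|x y /hpi_eq0]; first exact: alpha_neq0'.
rewrite hpiM => /eqP; rewrite mulf_eq0 => /orP[] /eqP /hpi_ker; first by left.
by right.
Qed.

Lemma alpha_dvd_lf c : mdvd (alpha H) (linear_form c) -> exists k, c = k *: a.
Proof.
move=> /hpi_eq0; rewrite hpi_lf => /eqP; rewrite linear_form_eq0 => /eqP.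
exact: hbas_ker.
Qed.

End Hyperplane.

Section TwoHyperplanes.
Variables (K : fieldType) (l : nat).
Implicit Types H L : {vspace 'rV[K]_l}.

Lemma ker_formZ k (c : 'cV[K]_l) : k != 0 -> ker_form (k *: c) = ker_form c.
Proof.
move=> k0; apply/vspaceP => v; rewrite !memv_ker !lfunE /= -scalemxAr.
by rewrite scaler_eq0 (negPf k0).
Qed.

Lemma alpha_dvd_eq H L : is_hyperplane H -> is_hyperplane L ->
  mdvd (alpha H) (alpha L) -> H = L.
Proof.
move=> hH hL /(alpha_dvd_lf hH)[k e].
have k0 : k != 0.
  apply/eqP => k0; have := alpha_coef_neq0 hL; rewrite e k0 scale0r eqxx //.
by rewrite -(alpha_coefP hL) -(alpha_coefP hH) e ker_formZ.
Qed.

Lemma alpha_dvd_mull H L p : is_hyperplane H -> is_hyperplane L -> L != H ->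
  mdvd (alpha L) (alpha H * p) -> mdvd (alpha L) p.
Proof.
move=> hH hL /eqP LH /(alpha_prime hL).2[d|//]; case: LH.
exact: alpha_dvd_eq hL hH d.
Qed.

Lemma defpoly_dvd (A : {fset {vspace 'rV[K]_l}}) p : is_arrangement A ->
  (forall L, L \in A -> mdvd (alpha L) p) -> mdvd (defpoly A (fun=> 1%N)) p.
Proof.
move=> hA h; rewrite /defpoly; under eq_bigr do rewrite expr1.
apply: prime_prod_dvd_uniq => //.
  by move=> L LA; apply: alpha_prime; apply: hA.
by move=> L M LA MA; apply: alpha_dvd_eq; apply: hA.
Qed.

End TwoHyperplanes.

(** * Free arrangements *)

Section SpanForms.
Variables (K : fieldType) (l : nat).

Lemma span_forms (s : seq 'cV[K]_l) (c : 'cV[K]_l) :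
  (forall v, (forall b, b \in s -> pair v b = 0) -> pair v c = 0) ->
  exists D : nat -> K, c = \sum_(i < size s) D i *: s`_i.
Proof.
move=> h; pose B : 'M[K]_(size s, l) := \matrix_i (s`_i)^T.
have cB : (c^T <= B)%MS.
  rewrite submxE; apply/eqP/matrixP => i j; rewrite !ord1 [RHS]mxE.
  pose v := (col j (cokermx B))^T.
  have -> : (c^T *m cokermx B) 0 j = pair v c.
    rewrite /pair /v !mxE; apply: eq_bigr => k _; rewrite !mxE mulrC //.
  apply: h => b bs; have ib : (index b s < size s)%N by rewrite index_mem.
  have := congr1 (fun M : 'M_(_, _) => M (Ordinal ib) j) (mulmx_coker B).
  rewrite !mxE => e; rewrite /pair mxE -[RHS]e; apply: eq_bigr => k _.
  by rewrite !mxE /= nth_index // mulrC.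
have /submxP[D e] := cB; exists (fun i => natf (fun j => D 0 j) i).
have -> : c = (D *m B)^T by rewrite -e trmxK.
apply/colP => k; rewrite mxE summxE mxE; apply: eq_bigr => i _.
by rewrite natfE !mxE.
Qed.

End SpanForms.

(** * A substitute for the Nullstellensatz at the rational points of H *)

Section Radical.
Variables (K : fieldType) (l : nat).
Local Notation S := {mpoly K[l]}.
Local Notation vsp := {vspace 'rV[K]_l}.

(** A unit in the local ring at x. Q(A) is its product with Q(A_x), and multiplication by it turns
    forms logarithmic along A_x into forms logarithmic along A, so it makes statements at x
    global. *)
Definition offprod (A : seq vsp) (x : 'rV[K]_l) : S := \prod_(L <- A | x \notin L) alpha L.

Let plus (J : S^o -> Prop) (u p : S) : Prop := exists j c, J j /\ p = j + c * u.

Let plus_mul (J : S^o -> Prop) (u v p q : S) : submod J ->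
  plus J u p -> plus J v q -> plus J (u * v) (p * q).
Proof.
move=> sJ [i [c [Ji ->]]] [j [d [Jj ->]]].
exists (i * (j + d * v) + (c * u) * j), (c * d); split; last by ring.
by apply: submodD => //; [rewrite mulrC|]; apply: (@submodZ S S^o).
Qed.

Let sumid (I : S^o -> Prop) (T : seq vsp) (p : S^o) : Prop :=
  exists i (c : vsp -> S), I i /\ p = i + \sum_(L <- T) c L * alpha L.

(** Descending induction on T: some power of h lies in I + (alpha_L : L in T). If the members of T
    and H have only 0 in common, the last hypothesis applies. Otherwise they share a point x other
    than 0; every L avoiding x is outside T, and the induction hypothesis for L :: T is multiplied
    over all these L until [offprod A x] appears, a power of which lies in I. *)
Lemma radical_offprod (A : seq vsp) (H : vsp) (I : S^o -> Prop) (h : S) :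
  submod I ->
  (forall x, x != 0 -> x \in H -> exists k, I (offprod A x ^+ k)) ->
  (forall T : seq vsp, uniq T -> {subset T <= A} ->
     (forall v, v \in H -> (forall L, L \in T -> v \in L) -> v = 0) ->
     exists i (c : vsp -> S), I i /\ h = i + \sum_(L <- T) c L * alpha L) ->
  exists N, I (h ^+ N).
Proof.
move=> sI hx hT.
have sJ T : submod (sumid I T).
  split.
    exists 0, (fun=> 0); split; [by case: sI|rewrite add0r big1 // => L _].
    by rewrite mul0r.
  move=> r u v [i [c [Ii ->]]] [j [d [Ij ->]]].
  exists (r * i + j), (fun L => r * c L + d L); split; first exact: (sI.2 r).
  rewrite -[r *: _]/(r * _) mulrDr addrACA mulr_sumr -big_split; congr (_ + _).
  by apply: eq_bigr => L _; rewrite /= mulrDl mulrA.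
suff main m : forall T : seq vsp, uniq T -> {subset T <= A} ->
    (count (fun L => L \notin T) A <= m)%N -> exists N, sumid I T (h ^+ N).
  have [|N [i [c [Ii e]]]] := main (size A) [::] isT _ (count_size _ _); first by [].
  by exists N; rewrite e big_nil addr0.
elim: m => [|m IH] T uT TA cT; last first.
  case: (pselect (forall v, v \in H -> (forall L, L \in T -> v \in L) -> v = 0)) => [/(hT T uT TA)h1|].
    by exists 1%N.
  move/existsNP => [x /not_implyP[xH /not_implyP[xT /eqP x0]]].
  (* A product of elements of J + (u) and J + (v) lies in J + (u v); along the members of A avoiding
     x this accumulates the factors of [offprod A x]. *)
  have step (s : seq vsp) : {subset s <= A} ->
      exists N, plus (sumid I T) (\prod_(L <- s | x \notin L) alpha L) (h ^+ N).
    elim: s => [|L s IHs] sA.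
      exists 0%N, 0, 1; split; first by case: (sJ T).
      by rewrite big_nil add0r mulr1.
    have [|N hN] := IHs; first by move=> M Ms; apply: sA; rewrite inE Ms orbT.
    rewrite big_cons; case: ifP => xL; last by exists N.
    have LA : L \in A by apply: sA; rewrite mem_head.
    have LT : L \notin T by apply/negP => /xT; apply/negP; rewrite xL.
    have [|||N' [i [c [Ii e]]]] := IH (L :: T).
    - by rewrite /= LT.
    - by move=> M; rewrite inE => /orP[/eqP ->//|/TA].
    - rewrite -ltnS; apply: leq_trans cT.
      have := perm_to_rem LA => /permP pA; rewrite !pA /= LT mem_head /= add0n add1n ltnS.
      by apply: sub_count => M; rewrite inE negb_or => /andP[].
    exists (N' + N)%N; rewrite exprD; apply: plus_mul => //; exists (i + \sum_(M <- T) c M * alpha M), (c L).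
    split; first by exists i, c.
    by rewrite e big_cons addrCA addrC.
  have [|N hN] := step A; first by [].
  have [k Ik] := hx x x0 xH; exists (N * k)%N.
  have : plus (sumid I T) (offprod A x ^+ k) ((h ^+ N) ^+ k).
    elim: (k) => [|k' IHk]; last by rewrite !exprS; apply: plus_mul.
    by exists 0, 1; split; [case: (sJ T)|rewrite !expr0 add0r mulr1].
  rewrite -exprM => -[j [c [Jj ->]]]; apply: submodD => //.
  apply: (@submodZ S S^o _ _ _ (sJ T)); exists (offprod A x ^+ k), (fun=> 0).
  by split=> //; rewrite big1 ?addr0 // => L _; rewrite mul0r.
(* Here T exhausts A, so no member avoids a common point x: [offprod A x] is an empty product and 1
   lies in I. *)
have AT : {subset A <= T}.
  move=> L LA; apply/negPn/negP => LT; move: cT; rewrite leqNgt -has_count.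
  by move=> /negP; apply; apply/hasP; exists L.
case: (pselect (forall v, v \in H -> (forall L, L \in T -> v \in L) -> v = 0)) => [/(hT T uT TA)h1|].
  by exists 1%N.
move/existsNP => [x /not_implyP[xH /not_implyP[xT /eqP x0]]].
have [k Ik] := hx x x0 xH; exists 0%N.
have o1 : offprod A x = 1 by rewrite /offprod big_seq_cond big_pred0 // => L; apply/andP => -[/AT/xT ->].
rewrite o1 expr1n in Ik; exists 1, (fun=> 0); split=> //.
by rewrite big1 ?addr0 // => L _; rewrite mul0r.
Qed.

End Radical.

Section VecOmega.
Variables (K : fieldType) (l : nat).
Local Notation S := {mpoly K[l]}.
Local Notation vsp := {vspace 'rV[K]_l}.
Variables (A : {fset vsp}) (m : vsp -> nat).
Hypothesis hA : is_arrangement A.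

Lemma vecOmega_ex : exists phi : {linear Omega A m 1 -> 'rV[S]_l},
  (forall w, phi w = 0 -> w = 0) /\
  (forall eta, (exists w, phi w = eta) <-> UA A m eta).
Proof.
have /choice[f fE] : forall w : Omega A m 1, exists eta, kvec eta = numer w.
  move=> w; have [hd _] : Ulog A m 1 (numer w) by apply/(numerP m 1 hA); exists w.
  exact: kvec_surj.
have f_lin : linear f.
  move=> r u v; apply/eqP; rewrite -subr_eq0; apply/eqP; apply: kvec_inj.
  by rewrite linearB /= linearP /= !fE linearP subrr.
pose fm := GRing.isLinear.Build S (Omega A m 1) 'rV[S]_l _ f f_lin.
pose phi : {linear Omega A m 1 -> 'rV[S]_l} := HB.pack f fm.
exists phi; split.
  by move=> w fw; apply: (numer_inj hA); rewrite -fE -[f w]/(phi w) fw linear0.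
move=> eta; rewrite -(Ulog_kvec m hA) -(numerP m 1 hA); split=> -[w].
  by move=> <-; exists w; rewrite fE.
move=> e; exists w; apply/eqP; rewrite -subr_eq0; apply/eqP; apply: kvec_inj.
by rewrite linearB /= fE e subrr.
Qed.

End VecOmega.

Section FreeData.
Variables (K : fieldType) (l : nat).
Local Notation S := {mpoly K[l]}.
Local Notation vsp := {vspace 'rV[K]_l}.
Local Notation Q A := (defpoly A (fun=> 1%N)).

Definition U1 (A : {fset vsp}) (eta : 'rV[S]_l) : Prop :=
  forall L, L \in A -> forall v, v \in L -> mdvd (alpha L) (ev eta v).

Lemma U1E A eta : U1 A eta <-> UA A (fun=> 1%N) eta.
Proof. by split=> h L LA v vL; have := h L LA v vL; rewrite expr1. Qed.

Lemma U1_submod A : submod (U1 A).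
Proof.
have [h0 h1] := UA_submod A (fun=> 1%N).
by split=> [|r u v /U1E hu /U1E hv]; apply/U1E => //; apply: h1.
Qed.

Lemma defpolyD1 (A : {fset vsp}) (L : vsp) : L \in A -> Q A = alpha L * Q (A `\ L).
Proof. by move=> LA; rewrite /defpoly (big_fsetD1 L LA) expr1. Qed.

Lemma alpha_dvd_Q (A : {fset vsp}) (L : vsp) : L \in A -> mdvd (alpha L) (Q A).
Proof. by move=> LA; exists (Q (A `\ L)); apply: defpolyD1. Qed.

(* The coefficient matrix N of a basis of numerators of Omega^1(A); the columns
   of T are the dual basis of derivations. *)
Definition freedata (A : {fset vsp}) : Prop :=
  exists k (N : 'M[S]_(k, l)) (T : 'M[S]_(l, k)),
    [/\ forall i, U1 A (row i N), T *m N = (Q A)%:M, N *m T = (Q A)%:M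
      & forall eta, U1 A eta -> exists c, eta = c *m N].

(** [is_free] allows a basis of any size. The forms with numerators Q dx_i involve only finitely
    many basis elements [s], and a further element b would be linked to [s] by the relation
    expressing Q b, so the basis is finite. Its size [k] is not compared with l: the two products
    with T say that N becomes invertible once Q is inverted. *)
Lemma arr_free_data A : is_arrangement A -> arr_free A -> freedata A.
Proof.
move=> hA [B [Bind Bspan]].
have [phi [phi_inj phiP]] := vecOmega_ex (fun=> 1%N) hA.
have QN0 : Q A != 0 by apply: defpoly_neq0.
set M := Omega A (fun=> 1%N) 1 in Bind Bspan phi phi_inj phiP.
pose spn (s : seq M) (x : M) := exists C : M -> S, x = \sum_(b <- s) C b *: b.
have sspn s : submod (spn s).
  split; first by exists (fun=> 0); rewrite big1 // => b _; rewrite scale0r.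
  move=> r u v [C ->] [D ->]; exists (fun b => r * C b + D b).
  by rewrite scaler_sumr -big_split; apply: eq_bigr => b _; rewrite scalerDl scalerA.
have spn_mem s b : uniq s -> b \in s -> spn s b.
  move=> us bs; exists (fun x => (x == b)%:R).
  rewrite (bigD1_seq b) //= eqxx scale1r big1 ?addr0 // => x /negPf ->.
  by rewrite scale0r.
have spn_sum s (s' : seq M) (c : M -> S) : uniq s -> {subset s' <= s} -> spn s (\sum_(b <- s') c b *: b).
  move=> us; elim: s' => [|b s' IH] sub; first by rewrite big_nil; case: (sspn s).
  rewrite big_cons; apply: (submodD (sspn s)).
    by apply: (submodZ _ (sspn s)); apply: spn_mem => //; apply: sub; rewrite mem_head.
  by apply: IH => x xs; apply: sub; rewrite inE xs orbT.
have /choice[e eE] : forall i : 'I_l, exists w : M, phi w = Q A *: delta_mx 0 i.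
  move=> i; apply/phiP => L LA v vL; rewrite expr1 evZl.
  by apply: mdvdMr; apply: alpha_dvd_Q.
have /choice[sc scE] : forall i : 'I_l, exists sc : seq M * (M -> S),
    (forall b, b \in sc.1 -> B b) /\ e i = \sum_(b <- sc.1) sc.2 b *: b.
  by move=> i; have [s [c [h1 h2]]] := Bspan (e i); exists (s, c).
pose s := undup (flatten [seq (sc i).1 | i <- enum 'I_l]).
have us : uniq s by apply: undup_uniq.
have sB b : b \in s -> B b.
  rewrite mem_undup => /flattenP[x /mapP[i _ ->]]; exact: (scE i).1.
have espn i : spn s (e i).
  rewrite (scE i).2; apply: spn_sum => // b bs; rewrite mem_undup; apply/flattenP.
  by exists (sc i).1 => //; apply: map_f; rewrite mem_enum.
have phi_e x : Q A *: x = \sum_i phi x 0 i *: e i.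
  apply/eqP; rewrite -subr_eq0; apply/eqP; apply: phi_inj.
  rewrite linearB linearZ linear_sum /=; apply/eqP; rewrite subr_eq0; apply/eqP.
  rewrite {1}[phi x]row_sum_delta scaler_sumr; apply: eq_bigr => i _.
  by rewrite [RHS]linearZ /= eE !scalerA mulrC.
have Bs b : B b -> b \in s.
  move=> Bb; apply/negPn/negP => bs.
  have [D hD] : spn s (Q A *: b).
    rewrite phi_e; refine (@submod_sum S M (spn s) 'I_l _ xpredT
      (fun i => phi b 0 i *: e i) (sspn s) _) => i _.
    exact: (submodZ _ (sspn s)).
  have := Bind (b :: s) (fun x => if x == b then Q A else - D x).
  rewrite /= bs us => /(_ isT) h; case/negP: QN0; apply/eqP.
  have := h _ _ b (mem_head _ _); rewrite eqxx; apply.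
    by move=> x; rewrite inE => /orP[/eqP ->//|/sB].
  rewrite big_cons eqxx hD big_seq [X in _ + X]big_seq -big_split big1 // => x xs /=.
  by case: eqP => [xb|_]; [case/negP: bs; rewrite -xb|rewrite scaleNr subrr].
have all_spn x : spn s x.
  have [s' [c [h1 ->]]] := Bspan x; apply: spn_sum => // b bs'.
  by apply: Bs; apply: h1.
pose k := size s; pose bs (i : 'I_k) := tnth (in_tuple s) i.
pose N : 'M[S]_(k, l) := \matrix_i phi (bs i).
have spnN x : exists c : 'rV[S]_k, phi x = c *m N /\ x = \sum_i c 0 i *: bs i.
  have [C hC] := all_spn x; exists (\row_i C (bs i)).
  have -> : x = \sum_i (\row_i C (bs i)) 0 i *: bs i.
    rewrite hC (big_tnth _ _ s); apply: eq_bigr => i _; by rewrite mxE.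
  split=> //; rewrite linear_sum mulmx_sum_row; apply: eq_bigr => i _.
  by rewrite linearZ /= rowK.
have /choice[T0 T0E] : forall i, exists c : 'rV[S]_k, Q A *: delta_mx 0 i = c *m N.
  by move=> i; have [c [hc _]] := spnN (e i); exists c; rewrite -eE.
pose T : 'M[S]_(l, k) := \matrix_i T0 i.
have TN : T *m N = (Q A)%:M.
  apply/row_matrixP => i; rewrite row_mul rowK -T0E.
  by apply/rowP => j; rewrite !mxE eqxx /= eq_sym mulr_natr.
exists k, N, T; split=> //.
- by move=> i; rewrite rowK; apply/U1E/phiP; exists (bs i).
- have Ninj (c : 'rV[S]_k) : c *m N = 0 -> c = 0.
    move=> c0; apply/rowP => i; rewrite mxE.
    have z0 : \sum_i c 0 i *: bs i = 0.
      apply: phi_inj; rewrite -[RHS]c0 linear_sum mulmx_sum_row.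
      by apply: eq_bigr => j _; rewrite linearZ /= rowK.
    have binj : injective bs by apply/tuple_uniqP.
    have /choice[g gE] : forall b : M, exists x : S, forall i, bs i = b -> x = c 0 i.
      move=> b; case: (pselect (exists i, bs i = b)) => [[j <-]|nb].
        by exists (c 0 j) => j' /binj ->.
      by exists 0 => j jb; case: nb; exists j.
    have := Bind s g us sB; rewrite (big_tnth _ _ s) -/k.
    have -> : \sum_(i0 < k) g (tnth (in_tuple s) i0) *: tnth (in_tuple s) i0 = 0.
      by rewrite -[RHS]z0; apply: eq_bigr => j _; rewrite -(gE _ j erefl).
    move=> /(_ erefl (bs i)); rewrite -(gE _ i erefl); apply.
    exact: mem_tnth.
  apply/row_matrixP => i; apply/eqP; rewrite -subr_eq0; apply/eqP; apply: Ninj.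
  rewrite mulmxBl -row_mul -mulmxA TN -row_mul mul_scalar_mx mul_mx_scalar.
  exact: subrr.
- by move=> eta /U1E/phiP[x <-]; have [c [hc _]] := spnN x; exists c.
Qed.

End FreeData.

Section Restriction.
Variables (K : fieldType) (l : nat) (H : {vspace 'rV[K]_l}).
Hypothesis hH : is_hyperplane H.
Local Notation n := (\dim H).
Local Notation S := {mpoly K[l]}.
Local Notation T := {mpoly K[n]}.
Local Notation vsp := {vspace 'rV[K]_l}.
Local Notation a := (alpha_coef H).
Local Notation pi := (@hpi K l H).
Local Notation Q A := (defpoly A (fun=> 1%N)).
Implicit Types (A : {fset vsp}) (L : vsp).

Definition bcoef L : 'cV[K]_n := hbas H *m alpha_coef L.
Definition beta L : T := pi (alpha L).
Local Notation restr := (restrict_hyperplane H).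

Lemma betaE L : beta L = linear_form (bcoef L).
Proof. exact: hpi_lf. Qed.

Lemma mprimeZ k (c : K) (p q : {mpoly K[k]}) : c != 0 -> p = c *: q -> mprime q -> mprime p.
Proof.
move=> c0 -> [q0 qp]; have cc : (c^-1)%:MP * c%:MP = 1 :> {mpoly K[k]} by rewrite -mpolyCM mulVf.
split; first by rewrite scaler_eq0 negb_or c0.
move=> x y [d e]; have [|h|h] := qp x y.
- by exists (c%:MP * d); rewrite e -mul_mpolyC mulrA [q * _]mulrC.
- left; case: h => z ->; exists ((c^-1)%:MP * z).
  by rewrite -mul_mpolyC mulrCA !mulrA cc mul1r.
- right; case: h => z ->; exists ((c^-1)%:MP * z).
  by rewrite -mul_mpolyC mulrCA !mulrA cc mul1r.
Qed.

Lemma mdvdZl k (c : K) (p q : {mpoly K[k]}) : c != 0 -> mdvd (c *: p) q <-> mdvd p q.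
Proof.
move=> c0; split=> -[d ->].
  by exists (c%:MP * d); rewrite -mul_mpolyC mulrCA mulrA.
exists (c^-1 *: d); rewrite -scalerAl -scalerAr scalerA mulfV // scale1r //.
Qed.

Lemma lf_coef0 k (b : 'cV[K]_k) : (linear_form b)@_0 = 0.
Proof. by apply: (dhomog_nemf_coeff (linear_form_homog b)); rewrite /= mdeg0. Qed.

Lemma lf_dvd_const k (b : 'cV[K]_k) (c : K) : mdvd (linear_form b) c%:MP -> c = 0.
Proof.
move=> [d e]; have := @ord_geM K k 0 _ d (lf_coef0 b).
rewrite -e => /(_ _ 0%MM); rewrite mcoeffC eqxx mulr1 mdeg0; apply=> //.
Qed.

Lemma mem_restr L w : is_hyperplane L -> (w \in restr L) = (pair w (bcoef L) == 0).
Proof.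
move=> hL; have pE : param H w = w *m hbas H by rewrite lfunE.
rewrite -memv_preim memv_cap pE hbas_mem /= (mem_hpair hL).
by rewrite /pair /bcoef mulmxA.
Qed.

Lemma restr_hyperplane L : is_hyperplane L -> L != H -> is_hyperplane (restr L).
Proof.
move=> hL LH; have arr : is_arrangement [fset H; L] by move=> M /fset2P[] ->.
apply: (@restriction_arrangement K l [fset H; L] H arr); first exact: fset21.
apply/imfsetP; exists L; last by [].
by apply/fsetD1P; split=> //; apply: fset22.
Qed.

Lemma bcoef_neq0 L : is_hyperplane L -> L != H -> bcoef L != 0.
Proof.
move=> hL /eqP LH; apply/eqP => b0; apply: LH.
have [k e] := hbas_ker hH b0; symmetry; apply: alpha_dvd_eq => //.
by exists k%:MP; rewrite /alpha e linear_formZ mulrC mul_mpolyC.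
Qed.

Lemma bcoef_alpha L : is_hyperplane L -> L != H ->
  exists2 c, c != 0 & bcoef L = c *: alpha_coef (restr L).
Proof.
move=> hL LH; have hX := restr_hyperplane hL LH.
have [|k e] := @hbas_ker _ _ _ hX (bcoef L).
  apply/row_matrixP => i; rewrite row0 row_mul; apply/matrixP => j k.
  have := hbas_mem (delta_mx 0 i : 'rV_(\dim (restr L))).
  rewrite (mem_restr _ hL) /pair -rowE => /eqP e.
  by rewrite !ord1 e mxE.
exists k => //; apply/eqP => k0; have := bcoef_neq0 hL LH.
by rewrite e k0 scale0r eqxx.
Qed.

Lemma beta_alpha L : is_hyperplane L -> L != H ->
  exists2 c, c != 0 & beta L = c *: alpha (restr L).
Proof.
move=> hL LH; have [c c0 e] := bcoef_alpha hL LH.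
by exists c => //; rewrite betaE e linear_formZ.
Qed.

Lemma beta_prime L : is_hyperplane L -> L != H -> mprime (beta L).
Proof.
move=> hL LH; have [c c0 e] := beta_alpha hL LH.
by apply: (mprimeZ c0 e); apply: alpha_prime; apply: restr_hyperplane.
Qed.

Lemma restr_bcoef L M : is_hyperplane L -> L != H -> is_hyperplane M -> M != H ->
  restr L = restr M -> exists2 c, c != 0 & bcoef M = c *: bcoef L.
Proof.
move=> hL LH hM MH e.
have [c c0 ec] := bcoef_alpha hL LH; have [d d0 ed] := bcoef_alpha hM MH.
exists (d / c); first by rewrite mulf_neq0 ?invr_eq0.
by rewrite ec ed -e scalerA divfK.
Qed.

Lemma beta_dvd L M : is_hyperplane L -> L != H -> is_hyperplane M -> M != H ->
  mdvd (beta L) (beta M) <-> restr L = restr M.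
Proof.
move=> hL LH hM MH; split.
  have [c c0 ->] := beta_alpha hL LH; have [d d0 ->] := beta_alpha hM MH.
  rewrite mdvdZl // => -[q e]; apply: alpha_dvd_eq; [exact: restr_hyperplane|exact: restr_hyperplane|].
  by exists (d^-1 *: q); rewrite -scalerAr -e scalerA mulVf ?scale1r.
move=> /(restr_bcoef hL LH hM MH)[c c0 e]; exists c%:MP.
by rewrite !betaE e linear_formZ mulrC mul_mpolyC.
Qed.

Lemma hpi_prod I (s : seq I) (P : pred I) F : pi (\prod_(i <- s | P i) F i) = \prod_(i <- s | P i) pi (F i).
Proof. exact: (rmorph_prod (lsub (hbas H))). Qed.

(** Distinct alpha_M are pairwise coprime in S, so their product divides p; on H each of them
    contributes a factor beta_L. This is the source of the multiplicities m^H. *)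
Lemma beta_pow L (s : seq vsp) p : uniq s ->
  (forall M, M \in s -> [/\ is_hyperplane M, mdvd (beta L) (beta M) & mdvd (alpha M) p]) ->
  mdvd (beta L ^+ size s) (pi p).
Proof.
move=> us hs; have [c ->] : mdvd (\prod_(M <- s) alpha M) p.
  apply: prime_prod_dvd_uniq => //.
  - by move=> M /hs[hM _ _]; apply: alpha_prime.
  - by move=> M N /hs[hM _ _] /hs[hN _ _]; apply: alpha_dvd_eq.
  - by move=> M /hs[].
rewrite hpiM; apply: mdvdMr; rewrite hpi_prod.
elim: s hs {us} => [|M s IH] hs; first by rewrite big_nil; apply: mdvd_refl.
rewrite big_cons /= exprS.
have [_ [d hd] _] := hs M (mem_head _ _).
have [|e he] := IH; first by move=> N Ns; apply: hs; rewrite inE Ns orbT.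
have -> : pi (alpha M) = beta L * d by exact: hd.
by rewrite he; exists (d * e); apply: mulrACA.
Qed.

(** The Ziegler multiplicity of the restriction of L, for an arrangement from which H has been
    removed. *)
Definition rcount A L : nat := count (fun M => restr M == restr L) A.

Lemma beta_prod_dvd A y : is_arrangement A -> H \notin A ->
  (forall L, L \in A -> mdvd (beta L ^+ rcount A L) y) -> mdvd (pi (Q A)) y.
Proof.
move=> hA HA h; have nH L : L \in A -> L != H by apply: contraTneq => ->.
rewrite /defpoly hpi_prod; under eq_bigr do rewrite expr1 -/(beta _).
apply: prime_prod_dvd => [L|L M|L] /mem_In LA.
- by apply: beta_prime; [apply: hA|apply: nH].
- move=> /mem_In MA /(beta_dvd (hA _ LA) (nH _ LA) (hA _ MA) (nH _ MA)).
  move=> /(restr_bcoef (hA _ LA) (nH _ LA) (hA _ MA) (nH _ MA))[c c0 e].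
  exists c%:MP; first by rewrite !betaE e linear_formZ mulrC mul_mpolyC.
  by rewrite betaE => /lf_dvd_const c0'; rewrite c0' eqxx in c0.
- have := h L LA; congr (mdvd (_ ^+ _) _).
  apply: eq_in_count => M MA; apply/eqP/asboolP => [e|].
    by apply/(beta_dvd (hA _ LA) (nH _ LA) (hA _ MA) (nH _ MA)).
  by move=> /(beta_dvd (hA _ LA) (nH _ LA) (hA _ MA) (nH _ MA)) ->.
Qed.

End Restriction.

(** * Low degrees *)

Section Divisorial.
Variable R : idomainType.

Lemma koz_regular n (a : R) (c : koz n (R^o)) : a != 0 -> a *: c = 0 -> c = 0.
Proof.
move=> a0 e; apply: kget_ext => I; have := congr1 (fun x => kget x I) e.
by rewrite kgetZ !kget0 => /eqP; rewrite mulf_eq0 (negPf a0) => /eqP.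
Qed.

Lemma kmap_scaleE (V : lmodType R) n (a : R) (c : koz n V) : kmap ( *:%R a) c = a *: c.
Proof. by elim: n c => [|n IH] c //=; rewrite !IH. Qed.

Lemma kin_mdvd_lift n p (a : R) (c : koz n (R^o)) : kdeg p c ->
  kin (mdvd a : R^o -> Prop) c -> exists2 d, kdeg p d & c = a *: d.
Proof.
move=> cd ca; have h0 : a *: (0 : R^o) = 0 by rewrite scaler0.
have hs (w : R^o) : mdvd a w -> exists2 u : R^o, True & a *: u = w by move=> [u ->]; exists u.
have [d [_ dd <-]] := kmap_lift I h0 hs ca cd.
by exists d => //; rewrite kmap_scaleE.
Qed.

(* A submodule of U0 cut out by divisibility conditions a i | lam i v inherits
   the vanishing of H^1 from U0 and R, as reflexive modules do. *)
Lemma Hvan_div (V : lmodType R) (I : Type) (P : I -> Prop) (lam : I -> V -> R) (a : I -> R)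
    (U0 : V -> Prop) f n :
  submod U0 ->
  (forall i, P i -> forall r u v, lam i (r *: u + v) = r * lam i u + lam i v) ->
  Hvan f n 1 U0 -> Hvan f n 0 (fun _ : R^o => True) -> Hvan f n 1 (fun _ : R^o => True) ->
  Hvan f n 1 (fun v => U0 v /\ forall i, P i -> mdvd (a i) (lam i v)).
Proof.
move=> sU0 lin h1 r0 r1 c cU cd c0.
have cU0 : kin U0 c by apply: kin_imp cU => u [].
have [b [bU bd be]] := h1 c cU0 cd c0; exists b; split=> //.
suff bi i : P i -> kin (fun v => mdvd (a i) (lam i v)) b.
  apply/kin_kget => J; split; first by move/kin_kget: bU.
  by move=> i /bi /kin_kget.
move=> Pi; pose L : V -> R^o := lam i.
have LD u v : L (u - v) = L u - L v.
  by have := lin i Pi (-1) v u; rewrite scaleN1r mulN1r addrC [- lam i v + _]addrC.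
have L0 : L 0 = 0 by have := LD 0 0; rewrite !subrr.
have LZ r u : L (r *: u) = r *: L u.
  by have := lin i Pi r u 0; rewrite addr0 -[lam i 0]/(L 0) L0 addr0.
have La : kadd (fun _ : V => True) L by move=> u v _ _; apply: LD.
have Lk k u : (k < n)%N -> True -> L (f k *: u) = f k *: L u by move=> _ _; apply: LZ.
have Lkd (x : koz n V) : kmap L (kd f x) = kd f (kmap L x).
  have xT : kin (fun _ : V => True) x by apply: kin_true.
  exact: (kmap_kd2 (submodT V) La Lk xT).
suff: kin (mdvd (a i) : R^o -> Prop) (kmap L b).
  move/kin_kget => h; apply/kin_kget => J; have := h J; by rewrite kget_kmap.
have cdv : kin (mdvd (a i) : R^o -> Prop) (kd f (kmap L b)).
  rewrite -Lkd be; apply/kin_kget => J; rewrite kget_kmap.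
  by move/kin_kget: cU => /(_ J)[_ /(_ i Pi)].
have bd' : kdeg 0 (kmap L b) by apply: kdeg_kmap.
case: (eqVneq (a i) 0) => ai.
  have d0 : kd f (kmap L b) = 0.
    apply: kget_ext => J; rewrite kget0; move/kin_kget: cdv => /(_ J)[x ->].
    by rewrite ai mul0r.
  have [e [_ /= ed ee]] := r0 _ (kin_true _ (fun=> Logic.I)) bd' d0.
  by rewrite -ee ed linear0; apply: kin0; apply: mdvd_submod.
have [g gd ge] := kin_mdvd_lift (kdeg_kd f bd') cdv.
have dg0 : kd f g = 0.
  by apply: (koz_regular ai); rewrite -linearZ /= -ge kd_dd.
have [t [_ td te]] := r1 g (kin_true _ (fun=> Logic.I)) gd dg0.
have d0 : kd f (kmap L b - a i *: t) = 0.
  by rewrite linearB linearZ /= te ge subrr.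
have [e [_ /= ed ee]] := r0 _ (kin_true _ (fun=> Logic.I)) (kdegB bd' (kdegZ (a i) td)) d0.
have -> : kmap L b = a i *: t.
  by apply/eqP; rewrite -subr_eq0 -ee ed linear0.
by apply/kin_kget => J; rewrite kgetZ; exists (kget t J).
Qed.

Lemma Hvan0_sub (V : lmodType R) f n (U U0 : V -> Prop) : submod U ->
  (forall u, U u -> U0 u) -> Hvan f n 0 U0 -> Hvan f n 0 U.
Proof.
move=> sU sub h c cU cd c0.
have [b [_ /= b0 be]] := h c (kin_imp sub cU) cd c0.
exists 0; split; [exact: kin0|by []|].
by rewrite -be b0.
Qed.

End Divisorial.

Section Cone.
Variables (K : fieldType) (l : nat) (H : {vspace 'rV[K]_l}).
Hypothesis hH : is_hyperplane H.
Local Notation n := (\dim H).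
Local Notation S := {mpoly K[l]}.
Local Notation T := {mpoly K[n]}.
Local Notation pi := (@hpi K l H).

Lemma good_kcons (g : nat -> S) (h : nat -> T) m :
  (forall k, (k < n)%N -> pi (g k) = h k) -> good h n m -> good (kcons (alpha H) g) n.+1 m.+1.
Proof.
move=> gh gd p pm; apply: (@Hvan_cone _ _ _ _ n g h (fun _ : S^o => True) (fun _ : T^o => True) pi).
- exact: submodT.
- by move=> u v _ _; apply: hpiB.
- by move=> k u kn _; rewrite -gh //; apply: hpiM.
- by move=> w _; exists (hsg w : S) => //; apply: hsgK.
- by [].
- by move=> u _ /eqP; rewrite mulf_eq0 (negPf (alpha_neq0' hH)) => /eqP.
- by move=> u _; rewrite -[_ *: _]/(_ * _) hpiM hpi_alpha // mul0r.
- by move=> u _ /(hpi_ker hH)[q ->]; exists q.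
- by move=> p' pp; apply: gd; rewrite pp in pm.
Qed.

Definition yhat (k : nat) : S := hsg (natf (fun j : 'I_n => 'X_j) k).
(** A system of parameters of S made of alpha_H and N-th powers of lifted coordinates of H. Local
    freeness only brings in unknown powers of the coordinates, hence N. For N = 1 these are linear
    forms generating the maximal ideal, as required for reading off projective dimension. *)
Definition tcoord (N : nat) : nat -> S := kcons (alpha H) (fun k => yhat k ^+ N).

Lemma hpi_yhat k : pi (yhat k) = natf (fun j : 'I_n => 'X_j) k.
Proof. exact: hsgK. Qed.

Lemma hpiX p m : pi (p ^+ m) = pi p ^+ m.
Proof. exact: (rmorphXn (lsub (hbas H))). Qed.

Lemma good_tcoord N : good (tcoord N) n.+1 n.+1.
Proof.
apply: (@good_kcons _ (@Xn K n N)); last exact: good_Xn.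
by move=> k kn; rewrite hpiX hpi_yhat.
Qed.

Lemma yhat_lf (j : 'I_n) : yhat j = linear_form (col j (hdual H)).
Proof. by rewrite /yhat natfE; apply: lsubX. Qed.

Lemma yhat_coef0 k : (yhat k)@_0 = 0.
Proof.
rewrite /yhat /natf; case: insub => [j|].
  by rewrite [hsg _]lsubX lf_coef0.
by rewrite [hsg 0](rmorph0 (lsub (hdual H))) mcoeff0.
Qed.

Lemma tcoord_coef0 k : (tcoord 1 k)@_0 = 0.
Proof. by case: k => [|k] /=; rewrite ?expr1; [apply: lf_coef0|apply: yhat_coef0]. Qed.

Lemma mpoly_inideal k (p : {mpoly K[k]}) : p@_0 = 0 ->
  exists q : 'I_k -> {mpoly K[k]}, p = \sum_i 'X_i * q i.
Proof.
have h : exists (q : 'I_k -> {mpoly K[k]}), p = (p@_0)%:MP + \sum_i 'X_i * q i.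
  elim/mpoly_ring_ind: p => [c|i|p q [q1 e1] [q2 e2]|p q [q1 e1] [q2 e2]].
  - exists (fun=> 0); rewrite big1 => [|i _]; last by rewrite mulr0.
    by rewrite mcoeffC eqxx mulr1 addr0.
  - exists (fun j => (j == i)%:R); rewrite (bigD1 i) //= eqxx mulr1 big1 ?addr0.
      by rewrite mcoeffX (_ : (U_(i)%MM == 0%MM) = false) ?mpolyC0 ?add0r // -mdeg_eq0 mdeg1.
    by move=> j /negPf ->; rewrite mulr0.
  - exists (fun i => q1 i + q2 i); rewrite {1}e1 {1}e2 mcoeffD mpolyCD addrACA.
    by rewrite -big_split; congr (_ + _); apply: eq_bigr => i _; rewrite mulrDr.
  - exists (fun i => q1 i * q + (p@_0)%:MP * q2 i).
    rewrite {1}e1 mulrDl {1}e2 mulrDr -mpolyCM.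
    have -> : (p * q)@_0 = p@_0 * q@_0 by exact: (rmorphM (mcoeff 0%MM)).
    rewrite -addrA; congr (_ + _); rewrite mulr_suml mulr_sumr -big_split.
    by apply: eq_bigr => i _ /=; rewrite mulrDr addrC -!mulrA [in X in _ + X]mulrCA.
by move=> p0; have [q ->] := h; rewrite p0 mpolyC0 add0r; exists q.
Qed.

Lemma tcoord_gen (p : S) : p@_0 = 0 -> inideal (tcoord 1) n.+1 (fun _ : S^o => True) p.
Proof.
move=> p0; have pp0 : (pi p)@_0 = 0.
  have [q ->] := mpoly_inideal p0.
  rewrite [pi _](rmorph_sum (lsub (hbas H))) raddf_sum big1 // => i _ /=.
  rewrite rmorphM /= lsubX.
  by rewrite [_@_0](rmorphM (mcoeff 0%MM)) /= lf_coef0 mul0r.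
have [q qE] := mpoly_inideal pp0.
have [r rE] : mdvd (alpha H) (p - \sum_(j < n) yhat j * hsg (q j)).
  apply: hpi_ker => //; rewrite hpiB [pi (\sum_(_ < _) _)](rmorph_sum (lsub (hbas H))) /=.
  rewrite qE; apply/eqP; rewrite subr_eq0; apply/eqP; apply: eq_bigr => j _.
  by rewrite -[RHS]/(pi _) hpiM hpi_yhat natfE hsgK.
exists (fun k => if k is k'.+1 then natf (fun j => hsg (q j)) k' else r) => //.
rewrite big_ord_recl /= -[p](subrK (\sum_(j < n) yhat j * hsg (q j))) rE.
congr (_ + _); apply: eq_bigr => j _; by rewrite natfE expr1.
Qed.

Variable A : {fset {vspace 'rV[K]_l}}.
Hypothesis hA : is_arrangement A.
Hypothesis nl : n.+1 = l.

Lemma tame_of_Hvan p : (forall p', (p' + p < l)%N -> Hvan (tcoord 1) l p' (Ulog A (fun=> 1%N) p)) ->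
  pd_le (Omega A (fun=> 1%N) p) p.
Proof.
move=> h; apply: (pd_le_Omega hA _ _ _ _ h).
- by rewrite -nl.
- have := (@good_tcoord 1); rewrite nl; apply.
- exact: tcoord_coef0.
- by move=> f /tcoord_gen; rewrite nl.
Qed.

Lemma Hvan_Ulog_low (f : nat -> S) m g p p' : good f g 2 -> (p' < 2)%N ->
  Hvan f g p' (Ulog A m p).
Proof.
move=> gf p2.
have sk : submod (fun c : koz l S^o => kdeg p c) by split; [apply: kdeg0|apply: kdeg_lin].
case: p' p2 => [|[|//]] _.
  apply: (Hvan0_sub (U0 := fun c : koz l S^o => kdeg p c)) => //; first exact: Ulog_submod.
    by move=> u [].
  by apply: Hvan_kdeg; apply: gf.
have := @Hvan_div S (koz l S^o) ({vspace 'rV[K]_l} * {set 'I_l})%type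
  (fun i => i.1 \in A) (fun i z => kget (kd (acoef (alpha_coef i.1)) z) i.2)
  (fun i => alpha i.1 ^+ m i.1) (fun c => kdeg p c) f g sk.
move=> h; apply: Hvan_iff (h _ _ _ _).
- move=> u; split.
    move=> [u1 u2]; split=> // L LA; apply/kin_kget => J; exact: (u2 (L, J) LA).
  by move=> [u1 u2]; split=> // -[L J] /= LA; have /kin_kget := u2 L LA; apply.
- by move=> [L J] _ r u v; rewrite linearP kget_lin.
- by apply: Hvan_kdeg; apply: gf.
- exact: gf.
- exact: gf.
Qed.

(** In degree 0 the numerators are the multiples of Q(A), since some coefficient of each alpha_L is
    a unit; they form a free module of rank one. *)
Lemma Hvan_Ulog0 (f : nat -> S) g m : good f g m -> forall p', (p' < m)%N ->
  Hvan f g p' (Ulog A (fun=> 1%N) 0).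
Proof.
move=> gf p' pm; set Q := defpoly A (fun=> 1%N).
have Q0 : Q != 0 by apply: defpoly_neq0.
apply: (@Hvan_iso _ _ _ _ g f f (fun _ : S^o => True) _ (fun s : S^o => (Q * s) *: kone S l)) => //.
- by move=> u v _ _; rewrite mulrBr scalerBl.
- by move=> k u _ _; rewrite scalerA -[_ *: u]/(_ * u) mulrCA.
- move=> z [/kdeg0E[s ->] zA].
  have [q qE] : mdvd Q s; last by exists q; rewrite // -qE.
  apply: defpoly_dvd => // L LA.
  have a0 : alpha_coef L != 0 by apply: alpha_coef_neq0; apply: hA.
  have [j aj] : exists j, alpha_coef L j 0 != 0.
    case: (pselect (exists i, alpha_coef L i 0 != 0)) => // hn; case/eqP: a0.
    by apply/colP => i; rewrite mxE; apply/eqP/negPn/negP => ai; apply: hn; exists i.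
  have := zA L LA; rewrite linearZ /= -kd_scalef expr1 => /kin_kv-/(_ (mdvd_submod _) j (ltn_ord j)).
  rewrite /acoef natfE => /(mdvdMl ((alpha_coef L j 0)^-1)%:MP).
  by rewrite mulrCA -mpolyCM mulVf // mulr1.
- move=> s _; split; first by apply: kdegZ; apply: kdeg_kone.
  move=> L LA; rewrite linearZ /= -kd_scalef expr1; apply/kin_kv; first exact: mdvd_submod.
  move=> k kl; rewrite -mulrA; apply: mdvdMr; exact: alpha_dvd_Q.
- move=> s _ e; have := congr1 (fun x => kget x set0) e.
  rewrite kgetZ kget0 kget_kone => /eqP.
  by rewrite -[_ *: _]/(_ * _) mulr1 mulf_eq0 (negPf Q0) => /eqP.
- exact: gf.
Qed.

Lemma Hvan_U1_low (f : nat -> S) g p' : good f g 2 -> (p' < 2)%N -> Hvan f g p' (U1 A).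
Proof.
move=> gf p2; apply: (@Hvan_iff _ _ _ _ _ (UA A (fun=> 1%N))); first by move=> u; rewrite U1E.
by apply/Hvan_Ulog1 => //; apply: Hvan_Ulog_low.
Qed.

End Cone.

(** * Residues *)

Section LocalResidue.
Variables (K : fieldType) (l : nat).
Local Notation S := {mpoly K[l]}.
Local Notation vsp := {vspace 'rV[K]_l}.
Local Notation Q A := (defpoly A (fun=> 1%N)).

Definition dl (c : 'cV[K]_l) : 'rV[S]_l := \row_i (c i 0)%:MP.

Lemma dlD c d : dl (c + d) = dl c + dl d.
Proof. by apply/rowP => i; rewrite !mxE mpolyCD. Qed.
Lemma dlZ k c : dl (k *: c) = k%:MP *: dl c.
Proof. by apply/rowP => i; rewrite !mxE mpolyCM. Qed.

Lemma dl_comb k (M : 'M[S]_(l, k)) x y u w :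
  dl (x *: u + y *: w) *m M = x%:MP *: (dl u *m M) + y%:MP *: (dl w *m M).
Proof. by rewrite dlD !dlZ mulmxDl -!scalemxAl. Qed.

Lemma alpha_comb (L M N : vsp) x y : alpha_coef M = x *: alpha_coef L + y *: alpha_coef N ->
  alpha M = x%:MP * alpha L + y%:MP * alpha N.
Proof. by move=> e; rewrite !mul_mpolyC -!linear_formZ -linear_formD -e. Qed.

Lemma mdvd_unscale d (q x y : S) : d != 0 -> d%:MP * x = q * y -> mdvd q x.
Proof.
move=> d0 e; exists ((d^-1)%:MP * y).
by rewrite mulrCA -e mulrA -mpolyCM mulVf // mul1r.
Qed.

Lemma scale2E (R : comNzRingType) k (f : R) (u : 'rV[R]_k) i : (f *: u) 0 i = f * u 0 i.
Proof. by rewrite mxE. Qed.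

Lemma residue_alg (R : comNzRingType) k (AM AL AH c d : R) (r x p : 'rV[R]_k) i :
  AM = c * AL + d * AH -> AM * r 0 i = (c *: (AL *: x) + d *: p) 0 i ->
  d * (p 0 i - AH * x 0 i) = AM * (r 0 i - x 0 i).
Proof. by rewrite !mxE => e h; rewrite [RHS]mulrBr h e; ring. Qed.

Lemma ev_dl c v : ev (dl c) v = (pair v c)%:MP.
Proof.
rewrite /pair mxE rmorph_sum; apply: eq_bigr => i _.
by rewrite mxE -mul_mpolyC -mpolyCM.
Qed.

Lemma ev_mulmx k (c : 'rV[S]_k) (N : 'M[S]_(k, l)) v :
  ev (c *m N) v = \sum_i c 0 i * ev (row i N) v.
Proof.
rewrite mulmx_sum_row /ev; under eq_bigr do rewrite summxE scaler_sumr.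
rewrite exchange_big; apply: eq_bigr => i _; rewrite mulr_sumr.
by apply: eq_bigr => j _; rewrite !mxE -!mul_mpolyC mulrCA.
Qed.

Lemma U1_mulmx A k (c : 'rV[S]_k) (N : 'M[S]_(k, l)) :
  (forall i, U1 A (row i N)) -> U1 A (c *m N).
Proof.
move=> h L LA v vL; rewrite ev_mulmx; apply: mdvd_sum => i _.
by apply: mdvdMl; apply: h.
Qed.

Lemma ev_all_dvd d (eta : 'rV[S]_l) : (forall v, mdvd d (ev eta v)) ->
  exists eta', eta = d *: eta'.
Proof.
move=> h; have hd i : mdvd d (eta 0 i) by rewrite -ev_delta.
have /choice[q qE] := hd; exists (\row_i q i); by apply/rowP => i; rewrite !mxE.
Qed.

Lemma locP (A : {fset vsp}) x L :
  reflect (L \in A /\ x \in L) (L \in localization A x).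
Proof.
apply: (iffP idP); first by move=> /imfsetP[M /=]; rewrite inE => /andP[h1 h2] ->.
by move=> [LA xL]; apply/imfsetP; exists L => //=; rewrite inE LA xL.
Qed.

Lemma loc_arr x (A : {fset vsp}) : is_arrangement A -> is_arrangement (localization A x).
Proof. by move=> hA L /locP[/hA]. Qed.

Lemma off_U1 (A B : {fset vsp}) x eta : U1 (localization A x) eta ->
  (forall L, L \in A -> x \notin L -> L \in B) -> U1 A (offprod B x *: eta).
Proof.
move=> eU AB L LA v vL; rewrite evZl; case: (boolP (x \in L)) => xL.
  by apply: mdvdMl; apply: eU => //; apply/locP.
apply: mdvdMr; rewrite /offprod (big_rem L (AB L LA xL)) xL.
by eexists; reflexivity.
Qed.

Lemma U1_dalpha A (L : vsp) R : is_arrangement A -> L \in A -> Q A = alpha L * R ->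
  U1 A (R *: dl (alpha_coef L)).
Proof.
move=> hA LA QE M MA v vM; rewrite evZl ev_dl.
case: (eqVneq M L) => [ML|ML].
  move: vM; rewrite ML (mem_hpair (hA _ LA)) => /eqP ->.
  by exists 0; rewrite mpolyC0 !mulr0.
apply: mdvdMr; have [d dE] := alpha_dvd_Q MA.
have [|e|//] := (alpha_prime (hA _ MA)).2 (alpha L) R.
  by rewrite -QE; exists d.
by case/eqP: ML; apply: alpha_dvd_eq => //; apply: hA.
Qed.

(** The vector [dl (alpha_coef L) *m T] lists the values at alpha_L of the derivations in the
    columns of T. Expanding the numerator of d alpha_L / alpha_L in the basis N shows that alpha_L
    divides them: the columns are logarithmic derivations. *)
Lemma theta_alpha A (L : vsp) k (N : 'M[S]_(k, l)) (T : 'M[S]_(l, k)) :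
  is_arrangement A -> L \in A -> N *m T = (Q A)%:M ->
  (forall eta, U1 A eta -> exists c, eta = c *m N) ->
  exists c, dl (alpha_coef L) *m T = alpha L *: c.
Proof.
move=> hA LA NT span; have [R QE] := alpha_dvd_Q LA.
have R0 : R != 0.
  have : Q A != 0 by apply: defpoly_neq0.
  by apply: contraNneq => R0; rewrite QE R0 mulr0.
have [c ec] := span _ (U1_dalpha hA LA QE); exists c.
have : R *: (dl (alpha_coef L) *m T) = R *: (alpha L *: c).
  by rewrite scalemxAl ec -mulmxA NT mul_mx_scalar QE mulrC scalerA.
move=> e; apply/rowP => i; have := congr1 (fun x : 'rV_k => x 0 i) e; rewrite !mxE.
exact: (mulfI R0).
Qed.

Variable H : vsp.
Hypothesis hH : is_hyperplane H.
Local Notation pi := (@hpi K l H).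
Local Notation a := (alpha_coef H).
Local Notation restr := (restrict_hyperplane H).

Lemma restr_rel (L M : vsp) : is_hyperplane L -> L != H -> is_hyperplane M -> M != H ->
  L != M -> restr M = restr L ->
  exists c d, [/\ c != 0, d != 0 & alpha_coef M = c *: alpha_coef L + d *: a].
Proof.
move=> hL LH hM MH LM e.
have [c c0 ec] := restr_bcoef hH hL LH hM MH (esym e).
have [d ed] : exists d, alpha_coef M - c *: alpha_coef L = d *: a.
  by apply: hbas_ker => //; rewrite mulmxBr -scalemxAr -/(bcoef H M) ec subrr.
exists c, d; split=> //; last by rewrite -ed addrC subrK.
apply: contraNneq LM => d0; apply/eqP; apply: alpha_dvd_eq => //; exists c%:MP.
rewrite mulrC mul_mpolyC /alpha -linear_formZ; congr linear_form.
by apply/eqP; rewrite -subr_eq0 ed d0 scale0r.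
Qed.

Lemma rcountE (A : {fset vsp}) L : L \in A ->
  rcount H A L = (size [seq M <- A | (restr M == restr L) && (M != L)]).+1.
Proof.
move=> LA; rewrite /rcount size_filter.
have := perm_to_rem LA => /permP pA; rewrite !pA /= !eqxx /= add1n add0n; congr _.+1.
apply: eq_in_count => M; rewrite (rem_filter _ (fset_uniq A)) mem_filter /=.
by move=> /andP[-> _]; rewrite andbT.
Qed.

(** In the basis N one has Q(A) d alpha_H = p N. On H the product Qred p is divisible by Q(A), and
    lifting the quotients q gives a form q N that restricts to Qred d alpha_H. *)
Lemma local_residue (A : {fset vsp}) Qred : is_arrangement A -> H \notin A -> freedata A ->
  (forall L, L \in A -> mdvd (beta H L) Qred) ->
  exists2 eta, U1 A eta & forall v, pi (ev eta v) = pair v a *: Qred.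
Proof.
move=> hA HA [k [N [T [NU TN NT span]]]] hQ.
have nH L : L \in A -> L != H by apply: contraTneq => ->.
pose p := dl a *m T.
have pdvd i : mdvd (pi (Q A)) (Qred * pi (p 0 i)).
  apply: beta_prod_dvd => // L LA; rewrite rcountE // exprS.
  set s := [seq _ <- _ | _].
  have [R hR] := theta_alpha hA LA NT span.
  have [d dE] := hQ L LA.
  (* Subtracting a multiple of alpha_H does not change the restriction. The difference is divisible
     by alpha_M for every other M with the same restriction as L, which gives all factors beta_L but
     one; [Qred] supplies the last. *)
  have -> : pi (p 0 i) = pi (p 0 i - alpha H * R 0 i).
    by rewrite hpiB hpiM hpi_alpha // mul0r subr0.
  have [||e eE] := @beta_pow K l H L s (p 0 i - alpha H * R 0 i).
  - by rewrite filter_uniq // fset_uniq.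
  - move=> M; rewrite mem_filter => /andP[/andP[/eqP ML MneL] MA]; split.
    + exact: hA.
    + by apply/beta_dvd => //; [apply: hA|apply: nH|apply: hA|apply: nH].
    have [|c [d' [c0 d0 aM]]] := restr_rel (hA _ LA) (nH _ LA) (hA _ MA) (nH _ MA) _ ML.
      by rewrite eq_sym.
    have [RM hM] := theta_alpha hA MA NT span.
    have aME : alpha M = c%:MP * alpha L + d'%:MP * alpha H by exact: alpha_comb.
    have e : alpha M *: RM = c%:MP *: (alpha L *: R) + d'%:MP *: p.
      by rewrite -hM -hR /p -dl_comb -aM.
    apply: (mdvd_unscale (y := RM 0 i - R 0 i) d0).
    have := congr1 (fun x : 'rV_k => x 0 i) e; rewrite !scale2E.
    exact: residue_alg aME.
  by rewrite dE eE; exists (d * e); apply: mulrACA.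
have /choice[q qE] := pdvd.
exists ((\row_i hsg (q i)) *m N); first exact: U1_mulmx.
move=> v; have Q0 : pi (Q A) != 0.
  rewrite /defpoly hpi_prod big_seq; elim/big_ind: _ => [||L LA]; first exact: oner_neq0.
    by move=> x y; apply: mulf_neq0.
  by rewrite expr1; have [] := beta_prime hH (hA _ LA) (nH _ LA).
apply: (mulfI Q0).
transitivity (Qred * pi (ev (p *m N) v)); last first.
  rewrite /p -mulmxA TN mul_mx_scalar evZl ev_dl hpiM.
  rewrite [pi (_%:MP)](lsubC (hbas H)) -mul_mpolyC; move: (pi (Q A)) => x.
  by rewrite mulrCA [Qred * _]mulrC.
rewrite !ev_mulmx ![pi (\sum_(_ < _) _)](rmorph_sum (lsub (hbas H))) /= !mulr_sumr.
apply: eq_bigr => i _; rewrite mxE -!/(pi _) !hpiM hsgK mulrA -qE.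
by rewrite mulrA.
Qed.

End LocalResidue.
Arguments loc_arr {K l} x [A] _.

(** * Residues along H and the deletion of H *)

Section Addition.
Variables (K : fieldType) (l : nat).
Local Notation S := {mpoly K[l]}.
Local Notation vsp := {vspace 'rV[K]_l}.
Local Notation Q A := (defpoly A (fun=> 1%N)).

Lemma span_alpha (s : seq vsp) (c : 'cV[K]_l) : uniq s -> (forall L, L \in s -> is_hyperplane L) ->
  (forall v, (forall L, L \in s -> v \in L) -> pair v c = 0) ->
  exists d : vsp -> K, linear_form c = \sum_(L <- s) (d L)%:MP * alpha L.
Proof.
move=> us hs h; have [|D cE] := @span_forms K l [seq alpha_coef L | L <- s] c.
  move=> v hv; apply: h => L Ls; rewrite (mem_hpair (hs _ Ls)); apply/eqP.
  by apply: hv; apply: map_f.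
exists (fun L => D (index L s)); rewrite cE size_map.
rewrite (big_morph (@linear_form K l) (@linear_formD K l) (@linear_form0 K l)).
rewrite (big_nth fullv) big_mkord; apply: eq_bigr => i _.
by rewrite linear_formZ (nth_map fullv) // index_uniq // mul_mpolyC.
Qed.


Variables (H : vsp) (A : {fset vsp}).
Hypotheses (hA : is_arrangement A) (HA : H \in A).
Let hH : is_hyperplane H := hA HA.
Local Notation n := (\dim H).
Local Notation T := {mpoly K[n]}.
Local Notation pi := (@hpi K l H).
Local Notation a := (alpha_coef H).
Local Notation restr := (restrict_hyperplane H).
Local Notation A' := (A `\ H).

Lemma arr_deletion : is_arrangement A'.
Proof. by move=> L /fsetD1P[_ /hA]. Qed.
Local Notation hA' := arr_deletion.

(* A vector of L outside H lets one recover the residue along H. *)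
Lemma transversal_vec L : is_hyperplane L -> L != H -> exists2 v, v \in L & pair v a != 0.
Proof.
move=> hL /eqP LH; case: (pselect (exists2 v, v \in L & pair v a != 0)) => // hn.
case: LH; apply: alpha_dvd_eq => //.
have [|k e] := @hbas_ker _ _ L hL a; last first.
  by exists k%:MP; rewrite /alpha e linear_formZ mulrC mul_mpolyC.
apply/row_matrixP => i; rewrite row0 row_mul; apply/matrixP => j k.
have hm := hbas_mem (H := L) (delta_mx 0 i); rewrite -rowE in hm.
rewrite !ord1 [RHS]mxE; apply/eqP/negPn/negP => ne; apply: hn.
by exists (row i (hbas L)).
Qed.

Lemma U1_deletion eta : U1 A eta <-> U1 A' eta /\ forall v, v \in H -> mdvd (alpha H) (ev eta v).
Proof.
split=> [h|[h1 h2] L LA v vL]; first by split=> [L /fsetD1P[_ LA]|]; apply: h.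
by case: (eqVneq L H) vL => [->|LH] vL; [apply: h2|apply: h1 => //; apply/fsetD1P].
Qed.

(* The residue along H, up to the factor Q(A) / alpha_H. *)
Definition residue (eta : 'rV[S]_l) : T^o := pi (ev eta (hz hH)).

Lemma residueB x y : residue (x - y) = residue x - residue y.
Proof. by rewrite /residue -scaleN1r evDl evZl mulN1r hpiB. Qed.
Lemma residueD x y : residue (x + y) = residue x + residue y.
Proof. by rewrite /residue evDl hpiD. Qed.
Lemma residueZ r x : residue (r *: x) = (pi r : T) *: residue x.
Proof. by rewrite /residue evZl hpiM. Qed.

Lemma residue_ev eta v : (forall v, v \in H -> mdvd (alpha H) (ev eta v)) ->
  pi (ev eta v) = pair v a *: residue eta.
Proof.
move=> h; have [u ->] := hdecomp hH v.
rewrite evD evZ hpiD hpiZ !pairDl !pairZl hzP mulr1 mulmx_pair0 ?hbas_alpha // addr0.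
by have /(hpi_eq0 hH) -> := h _ (hbas_mem u); rewrite addr0.
Qed.

Definition Qred : T := defpoly (restriction A H) (fun=> 1%N).

Lemma Qred_neq0 : Qred != 0.
Proof. by apply: defpoly_neq0; apply: restriction_arrangement. Qed.

Lemma restr_mem L : L \in A' -> restr L \in restriction A H.
Proof. by move=> LA; apply/imfsetP; exists L. Qed.

Lemma beta_Qred L : L \in A' -> mdvd (beta H L) Qred.
Proof.
move=> /[dup] LA /fsetD1P[LH LA']; have [c c0 ->] := beta_alpha hH (hA LA') LH.
by apply/mdvdZl => //; apply: alpha_dvd_Q; apply: restr_mem.
Qed.

Lemma residue_dvd eta : U1 A eta -> mdvd Qred (residue eta).
Proof.
move=> he; apply: defpoly_dvd; first exact: restriction_arrangement.
move=> X /imfsetP[L /= /fsetD1P[LH LA] ->].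
have [v vL va] := transversal_vec (hA LA) LH.
have [c c0 be] := beta_alpha hH (hA LA) LH.
apply/(mdvdZl _ _ c0); rewrite -be.
have := residue_ev v (he H HA); have [d ->] := he L LA v vL.
rewrite hpiM -/(beta H L) => e.
exists (((pair v a)^-1)%:MP * pi d); rewrite mulrCA e mul_mpolyC scalerA mulVf // scale1r //.
Qed.

Lemma residue_ker eta : U1 A eta -> residue eta = 0 -> exists2 eta', U1 A' eta' & eta = alpha H *: eta'.
Proof.
move=> he e0; have [|eta' eE] := @ev_all_dvd K l (alpha H) eta.
  by move=> v; apply/(hpi_eq0 hH); rewrite (residue_ev _ (he H HA)) e0 scaler0.
exists eta' => // L /fsetD1P[LH LA] v vL; have := he L LA v vL; rewrite eE evZl.
exact: alpha_dvd_mull hH (hA LA) LH.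
Qed.

Lemma U1_scale_deletion eta : U1 A' eta -> U1 A (alpha H *: eta) /\ residue (alpha H *: eta) = 0.
Proof.
move=> h; split; last by rewrite residueZ hpi_alpha // scale0r.
apply/U1_deletion; split; first exact: (submodZ _ (U1_submod A')).
by move=> v _; rewrite evZl; exists (ev eta v).
Qed.

Lemma hplane_span (s : seq vsp) (j : 'I_n) : uniq s -> {subset s <= A'} ->
  (forall v, v \in H -> (forall L, L \in s -> v \in L) -> v = 0) ->
  exists d : vsp -> K, exists e : K, yhat H j = e%:MP * alpha H + \sum_(L <- s) (d L)%:MP * alpha L.
Proof.
move=> us sA h; have Hs : H \notin s by apply/negP => /sA /fsetD1P[]; rewrite eqxx.
have [|||d dE] := @span_alpha (H :: s) (col j (hdual H)).
- by rewrite /= Hs.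
- by move=> L; rewrite inE => /orP[/eqP ->//|/sA/hA'].
- move=> v hv; rewrite (h v) ?mul0mx /pair ?mul0mx ?mxE //; first by apply: hv; rewrite mem_head.
  by move=> L Ls; apply: hv; rewrite inE Ls orbT.
by exists d, (d H); rewrite yhat_lf dE big_cons.
Qed.

(** As I contains alpha_H, the coordinate lifts only have to be combinations of alpha_H and the
    alpha_L whenever these hyperplanes have just 0 in common. The lifts are linear forms, so this is
    linear algebra. *)
Lemma yhat_radical (I : S^o -> Prop) : submod I -> I (alpha H) ->
  (forall x, x != 0 -> x \in H -> exists k, I (offprod A' x ^+ k)) ->
  exists N, forall k, (k < n)%N -> I (yhat H k ^+ N).
Proof.
move=> sI I_alpha I_off; have hN (j : 'I_n) : exists N, I (yhat H j ^+ N).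
  apply: (@radical_offprod K l (A' : seq vsp) H I (yhat H j) sI I_off) => s us sA hs.
  have [d [e ->]] := hplane_span j us sA hs.
  exists (e%:MP * alpha H), (fun L => (d L)%:MP); split=> //.
  exact: (@submodZ S S^o _ _ _ sI).
have /choice[N NE] := hN; exists (\sum_j N j)%N => k kn.
rewrite (bigD1 (Ordinal kn)) //= exprD mulrC.
exact: (@submodZ S S^o _ _ _ sI) (NE (Ordinal kn)).
Qed.

(* The residue of an A-form is a multiple of Qred; freeness of the deletion
   away from the origin makes every such multiple a residue up to a power. *)
Hypothesis lf : locally_free_along A' H.

Let I (s : S^o) : Prop := exists2 eta, U1 A eta & residue eta = (pi s * Qred : T).

Let sI : submod I.
Proof.
split.
  exists 0; first by case: (U1_submod A).
  by rewrite /residue hpi0 mul0r /ev big1 ?hpi0 // => i _; rewrite mxE scaler0.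
move=> r u v [x xU xe] [y yU ye]; exists (r *: x + y); first exact: (U1_submod A).2.
rewrite residueD residueZ xe ye -[r *: u + v]/(r * u + v : S) hpiD hpiM.
by rewrite mulrDl -[_ *: _]/(_ * _) mulrA.
Qed.

Let I_alpha : I (alpha H).
Proof.
exists 0; first by case: (U1_submod A).
by rewrite /residue hpi_alpha // mul0r /ev big1 ?hpi0 // => i _; rewrite mxE scaler0.
Qed.

Let I_off x : x != 0 -> x \in H -> I (offprod A' x).
Proof.
move=> x0 xH; have hAx := loc_arr x hA'.
have [||eta eU eE] := @local_residue _ _ H hH (localization A' x) Qred hAx _ (arr_free_data hAx (lf x0 xH)).
- by apply/negP => /locP[/fsetD1P[]]; rewrite eqxx.
- by move=> L /locP[LA _]; apply: beta_Qred.
exists (offprod A' x *: eta); last by rewrite residueZ /residue eE hzP scale1r.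
apply/U1_deletion; split; first exact: off_U1.
move=> v vH; rewrite evZl; apply: mdvdMl; apply/(hpi_eq0 hH).
by move: vH; rewrite eE (mem_hpair hH) => /eqP ->; rewrite scale0r.
Qed.

Lemma yhat_residue : exists N, forall k, (k < n)%N -> I (yhat H k ^+ N).
Proof.
apply: yhat_radical => // x x0 xH; by exists 1%N; rewrite expr1; apply: I_off.
Qed.

End Addition.

Lemma rV_scale_inj (R : idomainType) k (c : R) (u : 'rV[R]_k) : c != 0 -> c *: u = 0 -> u = 0.
Proof.
move=> c0 e; apply/rowP => i; have := congr1 (fun x : 'rV_k => x 0 i) e.
by rewrite !mxE => /eqP; rewrite mulf_eq0 (negPf c0) => /eqP.
Qed.

Section AdditionCohomology.
Variables (K : fieldType) (l : nat).
Local Notation S := {mpoly K[l]}.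
Local Notation vsp := {vspace 'rV[K]_l}.
Variables (H : vsp) (A : {fset vsp}).
Hypotheses (hA : is_arrangement A) (HA : H \in A).
Let hH : is_hyperplane H := hA HA.
Local Notation n := (\dim H).
Local Notation T := {mpoly K[n]}.
Local Notation pi := (@hpi K l H).
Local Notation A' := (A `\ H).
Local Notation res := (residue hA HA).

Let res_add : kadd (U1 A) res.
Proof. by move=> u v _ _; apply: residueB. Qed.

Lemma Hvan_residue_ker f g p : Hvan f g p (U1 A') -> Hvan f g p (kker (U1 A) res).
Proof.
apply: (@Hvan_iso _ _ _ _ g f f (U1 A') _ (fun eta => alpha H *: eta)).
- exact: U1_submod.
- by move=> u v _ _; rewrite scalerBr.
- by move=> k u _ _; rewrite !scalerA mulrC.
- by move=> eta [eU e0]; have [eta' h1 h2] := residue_ker eU e0; exists eta'.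
- by move=> u /(U1_scale_deletion hA HA)[].
by move=> u _; apply: rV_scale_inj; apply: alpha_neq0'.
Qed.

(** The components of the cocycle d Qred are the products f_k Qred, which are residues by
    [yhat_residue] for a suitable power N. The module of residues has H^1 = 0 by the sequence 0 ->
    U1(A') -> U1(A) -> residues -> 0, whose first map is multiplication by alpha_H. Hence d Qred = d
    s for a residue s, and s = Qred. *)
Lemma residue_onto : (0 < n)%N -> n.+1 = l -> locally_free_along A' H ->
  (forall N, Hvan (tcoord H N) l 2 (U1 A')) ->
  exists2 eta, U1 A eta & res eta = Qred H A.
Proof.
move=> n0 nl lf h2; have [N hN] := yhat_residue hA HA lf.
pose f := tcoord H N; pose g k : T := pi (f k).
have gd : good f l 2.
  by move=> p p2; have := (@good_tcoord _ _ _ hH N); rewrite nl; apply; lia.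
have hI : Hvan g l 1 (fun s : T^o => exists2 eta, U1 A eta & res eta = s).
  apply: (@Hvan_coker _ _ _ _ l f g (U1 A) _ res (U1_submod A) res_add _ _ _ 1).
  - by move=> k u _ _; apply: residueZ.
  - by [].
  - by move=> u uU; exists u.
  - exact: Hvan_U1_low.
  - exact: Hvan_residue_ker (h2 N).
have fI k : (k < l)%N -> exists2 eta, U1 A eta & res eta = g k * Qred H A.
  case: k => [_|k kn]; last by apply: hN; rewrite -ltnS nl.
  exists 0; first by case: (U1_submod A).
  by rewrite /g /= hpi_alpha // mul0r; apply: kadd0 res_add; apply: U1_submod.
have sI : submod (fun s : T^o => exists2 eta, U1 A eta & res eta = s).
  split; first by exists 0; [case: (U1_submod A)|apply: kadd0 res_add; apply: U1_submod].
  move=> r u v [x xU <-] [y yU <-]; exists (hsg r *: x + y); first exact: (U1_submod A).2.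
  by rewrite residueD residueZ hsgK.
have [||b [bI bd be]] := hI (kd g (Qred H A *: kone T l)) _ _ (kd_dd _ _).
- rewrite linearZ /= -kd_scalef; apply/kin_kv => // k kl; rewrite mulrC; exact: fI.
- by apply: kdeg_kd; apply: kdegZ; apply: kdeg_kone.
have [s bE] := kdeg0E bd; subst b.
(* Component 0 of g is the restriction of alpha_H, which is zero; component 1 is a power of a
   coordinate of H and can be cancelled. *)
have : s = Qred H A.
  have e : kv l (fun k => (s - Qred H A) * g k) = 0.
    by rewrite /kv kd_scalef scalerBl -!linearZ /= be subrr.
  have l1 : (1 < l)%N by move: n0 nl; move: (\dim H) => n' /[swap] <-.
  have /eqP := kv_eq0 e l1.
  rewrite mulf_eq0 subr_eq0 => /orP[/eqP //|].
  rewrite /g /f /= hpiX expf_eq0 hpi_yhat (natfE _ (Ordinal n0)).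
  have /negPf -> : 'X_(Ordinal n0) != 0 :> T.
    apply/eqP => /mpolyP/(_ U_(Ordinal n0)%MM); rewrite mcoeffX mcoeff0 eqxx => /eqP.
    by rewrite oner_eq0.
  by rewrite andbF.
move=> sE; subst s; move/kin_kone: bI; exact.
Qed.



(** The sequence 0 -> S -> U1(A') + S -> U1(A) -> 0, where (eta', s) goes to alpha_H eta' + s eta0
    and the kernel consists of the pairs (- s eta0, alpha_H s). *)
Lemma Hvan_U1_addition f g p eta0 : U1 A eta0 -> res eta0 = Qred H A ->
  Hvan f g p (U1 A') -> good f g p.+2 -> Hvan f g p (U1 A).
Proof.
move=> e0U e0E hA' gf.
pose phi (x : ('rV[S]_l * S^o)%type) : 'rV[S]_l := alpha H *: x.1 + x.2 *: eta0.
pose U (x : ('rV[S]_l * S^o)%type) := U1 A' x.1 /\ True.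
have sU : submod U by split=> [|r u v [u1 _] [v1 _]]; split=> //; [case: (U1_submod A')|apply: (U1_submod A').2].
have aphi : kadd U phi.
  by move=> u v _ _; rewrite /phi /= scalerBr scalerBl opprD addrACA.
have Q0 : Qred H A != 0 by apply: Qred_neq0.
apply: (@Hvan_coker _ _ _ _ g f f U (U1 A) phi sU aphi _ _ _ p).
- by move=> k u _ _; rewrite /phi /= scalerDr !scalerA mulrC.
- move=> eta eU; have [x xE] := residue_dvd hA HA eU.
  have [||eta' e1 e2] := @residue_ker K l H A hA HA (eta - hsg x *: eta0).
  - exact: (submodB (U1_submod A) eU (submodZ _ (U1_submod A) e0U)).
  - by rewrite residueB residueZ hsgK e0E xE mulrC subrr.
  by exists (eta', hsg x); [split|rewrite /phi /= -e2 subrK].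
- move=> u [u1 _]; have [u2 _] := U1_scale_deletion hA HA u1.
  exact: (submodD (U1_submod A) u2 (submodZ _ (U1_submod A) e0U)).
- exact: (Hvan_prod (U1_submod A') (@submodT S S^o) hA' (gf p _)).
apply: (@Hvan_iso _ _ _ _ g f f (fun _ : S^o => True) (kker U phi)
  (fun s : S^o => (- ((s : S) *: eta0), (alpha H * s : S^o)) : ('rV[S]_l * S^o)%type)).
- exact: submodT.
- move=> u v _ _; congr (_, _); first by rewrite -[u - v]/((u : S) - v) scalerBl opprD.
  by rewrite -[u - v]/((u : S) - v) mulrBr.
- move=> k u _ _; congr (_, _); rewrite -[f k *: u]/(f k * u : S).
    by rewrite -scalerA scalerN.
  exact: mulrCA.
- move=> [u s] [[/= uU _]]; rewrite /phi /= => e.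
  have [s' sE] : mdvd (alpha H) s.
    apply/(hpi_eq0 hH); have := congr1 res e; rewrite residueD.
    have [_ ->] := U1_scale_deletion hA HA uU; rewrite add0r residueZ e0E.
    have -> : res 0 = 0 by apply: kadd0 res_add; apply: U1_submod.
    move/eqP; rewrite -[_ *: _]/(_ * _) mulf_eq0 (negPf Q0) orbF => /eqP //.
  exists s' => //; congr (_, _) => //; apply/eqP; rewrite eq_sym -addr_eq0; apply/eqP.
  apply: (rV_scale_inj (alpha_neq0' hH)); by rewrite scalerDr scalerA -sE.
- move=> s _; split; first split=> //=.
    have [e0U' _] := (@U1_deletion K l H A HA eta0).1 e0U.
    exact: (submodN (U1_submod A') (submodZ _ (U1_submod A') e0U')).
  by rewrite /phi /= scalerN scalerA addNr.
- move=> s _ /(congr1 snd) e; have /eqP : alpha H * s = 0 :> S by exact: e.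
  by rewrite mulf_eq0 (negPf (alpha_neq0' hH)) => /eqP.
by apply: gf.
Qed.

End AdditionCohomology.

(** * Tameness from the deletion in dimension four *)

Theorem tame_addition (K : fieldType) (A : {fset {vspace 'rV[K]_4}}) H :
  is_arrangement A -> H \in A -> tame (A `\ H) -> locally_free_along (A `\ H) H -> tame A.
Proof.
move=> hA HA tA lf; have hH := hA _ HA; have nl : (\dim H).+1 = 4 := hH.
have hA' : is_arrangement (A `\ H) by apply: arr_deletion.
have gd N : good (tcoord H N) 4 4 by have := @good_tcoord _ _ _ hH N; rewrite nl.
have h1 N p : (p < 3)%N -> Hvan (tcoord H N) 4 p (U1 (A `\ H)).
  move=> p3; apply: (@Hvan_iff _ _ _ _ _ (UA (A `\ H) (fun=> 1%N))); first by move=> u; rewrite U1E.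
  by apply: (Hvan_UA_pd hA' (gd N) (tA 1%N isT)); rewrite addn1.
have n0 : (0 < \dim H)%N by lia.
have [eta0 e0U e0E] := residue_onto hA HA n0 nl lf (fun N => h1 N 2 isT).
move=> p p4; apply: (tame_of_Hvan hH hA nl) => p' pp'.
case: p p4 pp' => [|[|p]] p4 pp'.
- by apply: (Hvan_Ulog0 hA (gd 1%N)); lia.
- apply/Hvan_Ulog1 => //; apply: (@Hvan_iff _ _ _ _ _ (U1 A)); first by move=> u; rewrite U1E.
  apply: (Hvan_U1_addition e0U e0E); first by apply: h1; lia.
  by move=> q qp; apply: gd; lia.
(* For forms of degree at least 2 in dimension 4, only the cohomology in degrees 0 and 1 is left to
   check. *)
- by apply: Hvan_Ulog_low; [move=> q q2; apply: gd; lia|lia].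
Qed.

(** * The Ziegler restriction map *)

Section Contraction.
Variables (K : fieldType) (l : nat).
Local Notation S := {mpoly K[l]}.
Implicit Types (t eta : 'rV[S]_l) (c : 'cV[K]_l).

(** The row vector t is a polynomial vector field; [ct] contracts a 1-form with it and [dv] is its
    value on the linear form with coefficients c. *)
Definition ct t eta : S := \sum_i t 0 i * eta 0 i.
Definition dv t c : S := \sum_i t 0 i * (c i 0)%:MP.

Lemma ct_lin t r u v : ct t (r *: u + v) = r * ct t u + ct t v.
Proof.
rewrite /ct mulr_sumr -big_split; apply: eq_bigr => i _.
by rewrite !mxE mulrDr mulrCA.
Qed.

Lemma ct_dl t c : ct t (dl c) = dv t c.
Proof. by apply: eq_bigr => i _; rewrite mxE. Qed.

Lemma dvD t c d : dv t (c + d) = dv t c + dv t d.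
Proof. by rewrite /dv -big_split; apply: eq_bigr => i _; rewrite mxE mpolyCD mulrDr. Qed.
Lemma dvZ t k c : dv t (k *: c) = k%:MP * dv t c.
Proof. by rewrite /dv mulr_sumr; apply: eq_bigr => i _; rewrite mxE mpolyCM mulrCA. Qed.

Lemma dv0 t : dv t 0 = 0.
Proof. by rewrite -(scale0r 0) dvZ mpolyC0 mul0r. Qed.

Lemma ev_sum eta k (u : 'rV[K]_k) (B : 'M[K]_(k, l)) :
  ev eta (u *m B) = \sum_j u 0 j *: ev eta (row j B).
Proof.
rewrite mulmx_sum_row.
rewrite (big_morph (ev eta) (evD eta) (_ : ev eta 0 = 0)).
  by apply: eq_bigr => j _; rewrite evZ.
by rewrite /ev big1 // => i _; rewrite mxE scale0r.
Qed.

Lemma ev0l v : ev (0 : 'rV[S]_l) v = 0.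
Proof. by rewrite /ev big1 // => i _; rewrite [X in _ *: X]mxE scaler0. Qed.

Lemma ct_split H (hH : is_hyperplane H) t eta :
  ct t eta = dv t (alpha_coef H) * ev eta (hz hH)
    + \sum_j dv t (col j (hdual H)) * ev eta (row j (hbas H)).
Proof.
have e i : eta 0 i = (alpha_coef H i 0)%:MP * ev eta (hz hH)
    + \sum_j (hdual H i j)%:MP * ev eta (row j (hbas H)).
  rewrite -[LHS]ev_delta {1}(hsplit hH (delta_mx 0 i)) evD evZ pair_delta -mul_mpolyC.
  congr (_ + _); rewrite ev_sum; apply: eq_bigr => j _.
  by rewrite -rowE mxE mul_mpolyC.
rewrite /ct; under eq_bigr do rewrite e mulrDr mulrA mulr_sumr.
rewrite big_split -mulr_suml; congr (_ + _); rewrite exchange_big.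
apply: eq_bigr => j _; rewrite mulr_suml; apply: eq_bigr => i _.
have -> : (col j (hdual H)) i 0 = hdual H i j by rewrite mxE.
exact: mulrA.
Qed.

Lemma ct_dvd H d t eta : is_hyperplane H -> mdvd d (dv t (alpha_coef H)) ->
  (forall v, v \in H -> mdvd d (ev eta v)) -> mdvd d (ct t eta).
Proof.
move=> hH hd h; rewrite (ct_split hH); apply: mdvdD; first exact: mdvdMr.
apply: mdvd_sum => j _; apply: mdvdMl; apply: h.
by rewrite rowE; apply: hbas_mem.
Qed.

Definition eul : 'rV[S]_l := \row_i 'X_i.

Lemma dv_eul c : dv eul c = linear_form c.
Proof. by apply: eq_bigr => i _; rewrite mxE mulrC mul_mpolyC. Qed.

Definition U0 A eta := U1 A eta /\ ct eul eta = 0.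

Lemma U0_submod A : submod (U0 A).
Proof.
split; first by split; [case: (U1_submod A)|rewrite /ct big1 // => i _; rewrite !mxE mulr0].
move=> r u v [uU ue] [vU ve]; split; first exact: (U1_submod A).2.
by rewrite ct_lin ue ve mulr0 addr0.
Qed.

End Contraction.

Section Ziegler.
Variables (K : fieldType) (l : nat).
Local Notation S := {mpoly K[l]}.
Local Notation vsp := {vspace 'rV[K]_l}.
Variables (H : vsp).
Hypothesis hH : is_hyperplane H.
Local Notation n := (\dim H).
Local Notation T := {mpoly K[n]}.
Local Notation pi := (@hpi K l H).
Local Notation a := (alpha_coef H).
Local Notation restr := (restrict_hyperplane H).

Definition aquo (p : S) : S := if pselect (mdvd (alpha H) p) is left h then projT1 (cid h) else 0.

Lemma aquoE p : mdvd (alpha H) p -> alpha H * aquo p = p.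
Proof. by rewrite /aquo; case: pselect => // h _; case: cid. Qed.

Lemma aquoK q : aquo (alpha H * q) = q.
Proof. by apply: (mulfI (alpha_neq0' hH)); apply: aquoE; exists q. Qed.

(* The restriction of eta / alpha_H to H, which maps Omega^1(A) to the
   logarithmic forms of the Ziegler restriction. *)
Definition zieg (eta : 'rV[S]_l) : 'rV[T]_n := \row_j pi (aquo (ev eta (row j (hbas H)))).

Definition logH (eta : 'rV[S]_l) := forall v, v \in H -> mdvd (alpha H) (ev eta v).

Lemma logH_bas eta j : logH eta -> exists q, ev eta (row j (hbas H)) = alpha H * q.
Proof. by move=> h; apply: h; rewrite rowE; apply: hbas_mem. Qed.

Lemma ev_zieg eta u : logH eta -> ev (zieg eta) u = pi (aquo (ev eta (u *m hbas H))).
Proof.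
move=> h; have /choice[q qE] := fun j => logH_bas j h.
rewrite ev_sum; under [X in aquo X]eq_bigr do rewrite qE -mul_mpolyC mulrCA.
rewrite -mulr_sumr aquoK [RHS](rmorph_sum (lsub (hbas H))).
apply: eq_bigr => j _; rewrite mxE qE aquoK mul_mpolyC; exact/esym/hpiZ.
Qed.

Lemma zieg_lin r x y : logH x -> logH y -> zieg (r *: x + y) = pi r *: zieg x + zieg y.
Proof.
move=> hx hy; apply/rowP => j; rewrite !mxE evDl evZl.
have [q ->] := logH_bas j hx; have [q' ->] := logH_bas j hy.
by rewrite mulrCA -mulrDr !aquoK hpiD hpiM.
Qed.

Lemma zieg0 : zieg 0 = 0.
Proof.
apply/rowP => j; rewrite !mxE (_ : ev 0 _ = alpha H * 0).
  by rewrite aquoK hpi0.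
by rewrite mulr0 ev0l.
Qed.

Lemma ziegB x y : logH x -> logH y -> zieg (x - y) = zieg x - zieg y.
Proof.
move=> hx hy; rewrite addrC -scaleN1r zieg_lin // addrC.
by rewrite [pi _](rmorphN1 (lsub (hbas H))) scaleN1r.
Qed.

Lemma ziegZ r x : logH x -> zieg (r *: x) = pi r *: zieg x.
Proof.
move=> hx; rewrite -[r *: x]addr0 zieg_lin ?zieg0 ?addr0 // => v _.
by exists 0; rewrite mulr0 ev0l.
Qed.

Variable A : {fset vsp}.
Hypothesis hA : is_arrangement A.
Hypothesis HA : H \in A.

Lemma U1_logH eta : U1 A eta -> logH eta.
Proof. by move=> h; apply: h. Qed.

(** A vector v of X lies in every member M of A over X, so alpha_M divides eta(v), and also eta(v) /
    alpha_H because alpha_M is prime to alpha_H. On H these m^H(X) factors all become multiples of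
    the equation of X. *)
Lemma zieg_into eta : U1 A eta -> UA (restriction A H) (ziegler_mult A H) (zieg eta).
Proof.
move=> he X /imfsetP[L /= /fsetD1P[LH LA] ->] u uX.
have hL := hA LA; have [c c0 bE] := beta_alpha hH hL LH.
rewrite ev_zieg; last exact: U1_logH.
set s := [fset M in A `\ H | restr M == restr L].
have sP M : M \in s -> [/\ M \in A, M != H & restr M = restr L].
  by rewrite /s => /imfsetP[N /= + ->]; rewrite inE => /andP[/fsetD1P[? ?] /eqP].
have [d dE] : mdvd (beta H L ^+ size s) (pi (aquo (ev eta (u *m hbas H)))).
  apply: (@beta_pow K l H L s) => [|M /sP[MA MH MX]]; first exact: fset_uniq.
  split; [exact: hA|by apply/beta_dvd => //; apply: hA|].
  have vM : u *m hbas H \in M.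
    rewrite (mem_hpair (hA MA)) /pair -mulmxA -/(bcoef H M).
    by rewrite -(mem_restr _ (hA MA)) MX.
  have := he M MA _ vM; rewrite -{1}(aquoE (U1_logH he (hbas_mem u))).
  exact: alpha_dvd_mull hH (hA MA) MH.
exists ((c ^+ size s)%:MP * d); rewrite dE bE exprZn -mul_mpolyC -mulrA mulrCA //.
Qed.

End Ziegler.

Section ZieglerKernel.
Variables (K : fieldType) (l : nat).
Local Notation S := {mpoly K[l]}.
Local Notation vsp := {vspace 'rV[K]_l}.
Local Notation Q A := (defpoly A (fun=> 1%N)).
Variables (H : vsp) (A : {fset vsp}).
Hypotheses (hA : is_arrangement A) (HA : H \in A).
Let hH : is_hyperplane H := hA HA.
Local Notation n := (\dim H).
Local Notation T := {mpoly K[n]}.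
Local Notation pi := (@hpi K l H).
Local Notation a := (alpha_coef H).
Local Notation restr := (restrict_hyperplane H).

(** The map [zieg] only sees values on H. Contraction with the Euler field being zero, alpha_H
    eta(hz) is a combination of these values, which alpha_H^2 divides; this gives divisibility in
    the transversal direction. The form [dalpha] shows that U1 would be too large. *)
Lemma zieg_ker eta : U0 A eta -> zieg H eta = 0 ->
  exists2 eta', U0 A eta' & eta = alpha H *: eta'.
Proof.
move=> [eU e0] z0; have hl := U1_logH HA eU.
have hr j : exists r, ev eta (row j (hbas H)) = alpha H * (alpha H * r).
  have [q qE] := logH_bas j hl; have := congr1 (fun x : 'rV_n => x 0 j) z0.
  by rewrite !mxE qE (aquoK hH) => /(hpi_ker hH)[r ->]; exists r.
have /choice[r rE] := hr.
have hz_dvd : mdvd (alpha H) (ev eta (hz hH)).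
  exists (- \sum_j dv (eul K l) (col j (hdual H)) * r j).
  have a0 := alpha_neq0' hH.
  apply: (mulfI a0); apply/eqP; rewrite -subr_eq0 mulrN !mulrN opprK; apply/eqP.
  rewrite -[RHS]e0 (ct_split hH) dv_eul; congr (_ + _); rewrite mulr_sumr mulr_sumr.
  by apply: eq_bigr => j _; rewrite rE [dv _ _ * (_ * _)]mulrCA [dv _ _ * (_ * _)]mulrCA.
have [|eta' eE] := @ev_all_dvd K l (alpha H) eta.
  move=> v; rewrite (hsplit hH v) evD evZ; apply: mdvdD; first exact: mdvdZ.
  exact/hl/hbas_mem.
have a0 := alpha_neq0' hH.
exists eta' => //; split; last first.
  apply: (mulfI a0); rewrite mulr0 -e0 eE -[alpha H *: eta']addr0 ct_lin.
  by rewrite [X in _ + X](_ : _ = 0) ?addr0 // /ct big1 // => i _; rewrite [X in _ * X]mxE mulr0.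
move=> L LA v vL; case: (eqVneq L H) vL => [->|LH] vL.
  apply: (mdvd_cancel a0); rewrite -evZl -eE.
  have [u ->] := hbas_surj vL; rewrite ev_sum; apply: mdvd_sum => j _.
  by apply: mdvdZ; rewrite rE; exists (r j); rewrite mulrA.
have := eU L LA v vL; rewrite eE evZl.
exact: alpha_dvd_mull hH (hA LA) LH.
Qed.

(** The numerator of d alpha_H / alpha_H. Its contraction with the Euler field is Q(A), so it spans
    a complement of U0 in U1. *)
Definition dalpha : 'rV[S]_l := Q (A `\ H) *: dl a.

Lemma dalpha_U1 : U1 A dalpha.
Proof. exact: U1_dalpha (defpolyD1 HA). Qed.

Lemma dalpha_eul : ct (eul K l) dalpha = Q A.
Proof.
rewrite -[dalpha]addr0 ct_lin [X in _ + X](_ : _ = 0) ?addr0.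
  by rewrite ct_dl dv_eul (defpolyD1 HA) mulrC.
by rewrite /ct big1 // => i _; rewrite [X in _ * X]mxE mulr0.
Qed.

Lemma zieg_dalpha : zieg H dalpha = 0.
Proof.
apply/rowP => j; rewrite !mxE /dalpha evZl ev_dl.
have -> : pair (row j (hbas H)) a = 0.
  by rewrite rowE mulmx_pair0 // hbas_alpha.
by rewrite mpolyC0 mulr0 -(mulr0 (alpha H)) (aquoK hH) hpi0.
Qed.

Lemma ct_eul_dvd eta : U1 A eta -> mdvd (Q A) (ct (eul K l) eta).
Proof.
move=> eU; apply: defpoly_dvd => // L LA; apply: (ct_dvd (hA LA)).
  by rewrite dv_eul; apply: mdvd_refl.
exact: eU.
Qed.

Lemma U1_split eta : U1 A eta -> exists2 c, U0 A (eta - c *: dalpha) &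
  zieg H (eta - c *: dalpha) = zieg H eta.
Proof.
move=> eU; have [c cE] := ct_eul_dvd eU; exists c.
  split; first exact: (submodB (U1_submod A) eU (submodZ _ (U1_submod A) dalpha_U1)).
  rewrite addrC -scaleNr ct_lin cE dalpha_eul mulNr mulrC.
  exact: addNr.
have lU := U1_logH HA dalpha_U1.
have lcU : logH H (c *: dalpha) by move=> v vH; rewrite evZl; apply: mdvdMl; apply: lU.
by rewrite (ziegB hH (U1_logH HA eU) lcU) (ziegZ hH _ lU) zieg_dalpha scaler0 subr0.
Qed.

End ZieglerKernel.

Section ZieglerLocal.
Variables (K : fieldType) (l : nat).
Local Notation S := {mpoly K[l]}.
Local Notation vsp := {vspace 'rV[K]_l}.
Local Notation Q A := (defpoly A (fun=> 1%N)).
Variables (H : vsp) (A : {fset vsp}).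
Hypotheses (hA : is_arrangement A) (HA : H \in A).
Let hH : is_hyperplane H := hA HA.
Local Notation n := (\dim H).
Local Notation T := {mpoly K[n]}.
Local Notation pi := (@hpi K l H).
Local Notation a := (alpha_coef H).
Local Notation restr := (restrict_hyperplane H).

Lemma ziegler_multE L : ziegler_mult A H (restr L) = rcount H (A `\ H) L.
Proof.
rewrite /ziegler_mult /rcount -size_filter; apply/eqP; apply/eqP/perm_size.
apply: uniq_perm; [exact: fset_uniq|by rewrite filter_uniq ?fset_uniq|].
by move=> M; rewrite mem_filter andbC in_fset /= !inE.
Qed.

Lemma dv_linl k r (t u : 'rV[{mpoly K[k]}]_k) c : dv (r *: t + u) c = r * dv t c + dv u c.
Proof.
rewrite /dv mulr_sumr -big_split; apply: eq_bigr => i _.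
by rewrite !mxE mulrDl mulrA.
Qed.

Lemma dv_col k (M : 'M[S]_(l, k)) i c : dv (\row_j M j i) c = (dl c *m M) 0 i.
Proof. by rewrite mxE; apply: eq_bigr => j _; rewrite !mxE mulrC. Qed.

Lemma euler_alg (R : comNzRingType) (x y z : R) : - y * x + x * z = x * (z - y).
Proof. by ring. Qed.

Lemma hdual_hbas c : hdual H *m hbas H *m c = c - pair (hz hH) c *: a.
Proof.
apply: pair_ext => v; rewrite pairBr pairZr.
rewrite {2}(hsplit hH v) pairDl pairZl mulrC addrAC subrr add0r.
by rewrite /pair !mulmxA.
Qed.

(** Derivations dual to the basis N are corrected to be tangent to H and restricted to H.
    Contracting them with e gives multiples of the restriction of Q(A \ H), and the quotients q are
    the coefficients on H of the sought preimage in the basis N. *)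
Lemma zieg_local e : freedata A -> UA (restriction A H) (ziegler_mult A H) e ->
  exists2 eta, U1 A eta & zieg H eta = e.
Proof.
move=> [k [N [M [NU MN NM span]]]] eU.
set B := A `\ H; have hB : is_arrangement B by apply: arr_deletion.
have HB : H \notin B by apply/negP => /fsetD1P[]; rewrite eqxx.
have nH L : L \in B -> L != H by move=> /fsetD1P[].
have BA L : L \in B -> L \in A by move=> /fsetD1P[].
have /choice[R RE] : forall L, exists r, L \in A -> dl (alpha_coef L) *m M = alpha L *: r.
  move=> L; case: (boolP (L \in A)) => LA; last by exists 0.
  by have [r rE] := theta_alpha hA LA NM span; exists r.
(* Subtracting [R H 0 i] times the Euler field makes the i-th derivation annihilate alpha_H, so that
   it is tangent to H. *)
pose tau i : 'rV[S]_l := - R H 0 i *: eul K l + \row_j M j i.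
have tauE i L : L \in A -> dv (tau i) (alpha_coef L) = alpha L * (R L 0 i - R H 0 i).
  move=> LA; rewrite dv_linl dv_eul dv_col (RE L LA) scale2E.
  exact: euler_alg.
pose tb i : 'rV[T]_n := \row_j pi (dv (tau i) (col j (hdual H))).
have tbE i L : L \in B -> dv (tb i) (bcoef H L) = pi (alpha L * (R L 0 i - R H 0 i)).
  move=> LB; have -> : dv (tb i) (bcoef H L) = pi (dv (tau i) (hdual H *m hbas H *m alpha_coef L)).
    have -> : hdual H *m hbas H *m alpha_coef L = \sum_j bcoef H L j 0 *: col j (hdual H).
      rewrite -mulmxA -/(bcoef H L); apply/colP => s; rewrite mxE summxE.
      by apply: eq_bigr => j _; rewrite !mxE mulrC.
    rewrite (big_morph (dv (tau i)) (dvD (tau i)) (dv0 (tau i))).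
    rewrite [RHS](rmorph_sum (lsub (hbas H))); apply: eq_bigr => j _.
    by rewrite mxE dvZ mulrC mul_mpolyC mul_mpolyC; symmetry; apply: hpiZ.
  rewrite hdual_hbas -scaleNr dvD dvZ (tauE i _ HA) subrr !mulr0 addr0.
  by rewrite (tauE i _ (BA _ LB)).
(* At the restriction X of L, both the value of [tb i] on the equation of X and the values of e on X
   are divisible by beta_L to the power m^H(X); hence so is the contraction. For [tb i], one factor
   is alpha_L and the others come from the other members over X, on which [tau i] takes proportional
   values. *)
have Pdvd i : mdvd (pi (Q B)) (ct (tb i) e).
  apply: beta_prod_dvd => // L LB.
  have [c c0 bE] := bcoef_alpha hH (hB _ LB) (nH _ LB).
  apply: (ct_dvd (restr_hyperplane hH (hB _ LB) (nH _ LB))); last first.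
    move=> u uX; have := eU (restr L) (restr_mem LB) u uX.
    rewrite ziegler_multE betaE bE linear_formZ => -[d ->].
    exists (((c ^+ rcount H B L)^-1)%:MP * d); rewrite exprZn -mul_mpolyC.
    by rewrite mulrACA -mpolyCM mulfV ?expf_neq0 // mul1r.
  suff [d dE] : mdvd (beta H L ^+ rcount H B L) (dv (tb i) (bcoef H L)).
    exists ((c^-1)%:MP * d).
    by rewrite mulrCA -dE bE dvZ mulrA -mpolyCM mulVf // mul1r.
  rewrite tbE // rcountE // exprS hpiM.
  set s := [seq _ <- _ | _].
  have [||d dE] := @beta_pow K l H L s (R L 0 i - R H 0 i).
  - by rewrite filter_uniq // fset_uniq.
  - move=> N'; rewrite mem_filter => /andP[/andP[/eqP ML MneL] MB]; split.
    + exact: hB.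
    + by apply/beta_dvd => //; [apply: hB|apply: nH|apply: hB|apply: nH].
    have [|c' [d' [c0' d0 aM]]] := restr_rel hH (hB _ LB) (nH _ LB) (hB _ MB) (nH _ MB) _ ML.
      by rewrite eq_sym.
    have := tauE i _ (BA _ MB); rewrite aM dvD !dvZ (tauE i _ HA) subrr !mulr0 addr0.
    rewrite (tauE i _ (BA _ LB)) => /(mdvd_unscale c0').
    exact: alpha_dvd_mull (hB _ LB) (hB _ MB) MneL.
  by rewrite dE; exists d; rewrite mulrA.
have /choice[q qE] := Pdvd.
exists ((\row_i hsg (q i)) *m N); first exact: U1_mulmx.
have Q0 : pi (Q B) != 0.
  rewrite /defpoly hpi_prod big_seq; elim/big_ind: _ => [||L LA]; first exact: oner_neq0.
    by move=> x y; apply: mulf_neq0.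
  by rewrite expr1; have [] := beta_prime hH (hB _ LA) (nH _ LA).
apply/rowP => j; apply: (mulfI Q0).
have hn i : exists r, ev (row i N) (row j (hbas H)) = alpha H * r.
  by apply: logH_bas => v vH; apply: NU.
have /choice[nn nE] := hn.
(* Duality of N and M up to Q(A) = alpha_H Q(B), with alpha_H cancelled. The Euler correction
   contributes a multiple of [R H *m N], which is Q(B) d alpha_H and vanishes on the vectors of
   H. *)
have dual c : \sum_i dv (tau i) c * nn i = Q B * (pair (row j (hbas H)) c)%:MP.
  apply: (mulfI (alpha_neq0' hH)); rewrite mulrA -(defpolyD1 HA) -ev_dl -evZl.
  rewrite -mul_mx_scalar -MN mulmxA ev_mulmx mulr_sumr.
  transitivity (\sum_i ((dl c *m M) 0 i - linear_form c * R H 0 i) * ev (row i N) (row j (hbas H))).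
    apply: eq_bigr => i _; rewrite nE mulrCA; congr (_ * (_ * _)).
    by rewrite dv_linl dv_eul dv_col addrC mulNr mulrC.
  under eq_bigr do rewrite mulrBl; rewrite sumrB -[RHS]subr0; congr (_ - _).
  under eq_bigr do rewrite -mulrA; rewrite -mulr_sumr -ev_mulmx.
  have -> : ev (R H *m N) (row j (hbas H)) = 0; last by rewrite mulr0.
  apply: (mulfI (alpha_neq0' hH)); rewrite -evZl scalemxAl -(RE H HA) -mulmxA MN.
  rewrite mul_mx_scalar evZl ev_dl.
  have -> : pair (row j (hbas H)) a = 0 by rewrite rowE mulmx_pair0 // hbas_alpha.
  by rewrite mpolyC0 !mulr0.
transitivity (\sum_i ct (tb i) e * pi (nn i)).
  rewrite mxE ev_mulmx; under eq_bigr do rewrite nE mulrCA.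
  rewrite -mulr_sumr (aquoK hH) [pi (\sum_(_ < _) _)](rmorph_sum (lsub (hbas H))) mulr_sumr.
  apply: eq_bigr => i _; rewrite qE -mulrA; congr (_ * _).
  rewrite -[LHS]/(pi _) hpiM [X in pi X * _](_ : _ = hsg (q i)) ?hsgK //.
  by rewrite mxE.
transitivity (\sum_j' e 0 j' * pi (\sum_i dv (tau i) (col j' (hdual H)) * nn i)).
  under [RHS]eq_bigr do rewrite [pi (\sum_(_ < _) _)](rmorph_sum (lsub (hbas H))) mulr_sumr.
  rewrite exchange_big; apply: eq_bigr => i _; rewrite /ct mulr_suml.
  apply: eq_bigr => j' _; rewrite -[X in _ = _ * X]/(pi _) hpiM mxE.
  by rewrite mulrA [e 0 j' * _]mulrC.
under eq_bigr do rewrite dual hpiM [pi (_%:MP)](lsubC (hbas H)).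
have dl j' : pair (row j (hbas H)) (col j' (hdual H)) = (j == j')%:R.
  rewrite /pair; have := congr1 (fun m : 'M_n => m j j') (@hbas_dual K l H).
  by rewrite !mxE => <-; apply: eq_bigr => s _; rewrite !mxE.
rewrite (bigD1 j) //= dl eqxx mulr1 big1 ?addr0; first exact: mulrC.
by move=> j' jj'; rewrite dl eq_sym (negPf jj') mpolyC0 !mulr0.
Qed.

End ZieglerLocal.

(** * Surjectivity of the Ziegler restriction map *)

Section KdLinear.
Variables (R : comNzRingType) (V : lmodType R).
Implicit Types (f : nat -> R).

Lemma kdD n f (c d : koz n V) : kd f (c + d) = kd f c + kd f d.
Proof. by rewrite -[c]scale1r kd_lin !scale1r. Qed.
Lemma kdB n f (c d : koz n V) : kd f (c - d) = kd f c - kd f d.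
Proof. exact: linearB. Qed.
Lemma kdZ n f r (c : koz n V) : kd f (r *: c) = r *: kd f c.
Proof. exact: linearZ. Qed.

End KdLinear.

Section GradedKoszul.
Variables (R : comNzRingType) (V : lmodType R) (pr : nat -> V -> V).

Lemma kgetD n (c d : koz n V) J : kget (c + d) J = kget c J + kget d J.
Proof. by rewrite -[c]scale1r kget_lin !scale1r. Qed.

Lemma kget_sum n I (r : seq I) (P : pred I) (F : I -> koz n V) J :
  kget (\sum_(i <- r | P i) F i) J = \sum_(i <- r | P i) kget (F i) J.
Proof.
apply: (big_morph (fun c : koz n V => kget c J)) => [c d|]; last exact: kget0.
exact: kgetD.
Qed.

Definition grading : Prop :=
  [/\ forall d u v, pr d (u - v) = pr d u - pr d v,
      forall d u, pr d (pr d u) = pr d u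
    & forall u, exists M, forall M', (M <= M')%N -> u = \sum_(d < M') pr d u].

Hypothesis gr : grading.
Let prB d u v : pr d (u - v) = pr d u - pr d v. Proof. by case: gr. Qed.
Let pr0 d : pr d 0 = 0. Proof. by have := prB d 0 0; rewrite !subrr. Qed.

Lemma kmap_pr_id n d (c : koz n V) : kmap (pr d) (kmap (pr d) c) = kmap (pr d) c.
Proof. by case: gr => _ pr_id _; apply: kget_ext => J; rewrite !kget_kmap. Qed.

Lemma kpart n (c : koz n V) : exists M, c = \sum_(d < M) kmap (pr d) c.
Proof.
have [_ _ part] := gr.
have /choice[M ME] := fun J : {set 'I_n} => part (kget c J).
exists (\sum_J M J)%N; apply: kget_ext => J; rewrite kget_sum.
have MJ : (M J <= \sum_J M J)%N by rewrite (bigD1 J) //= leq_addr.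
by rewrite {1}(ME J _ MJ); apply: eq_bigr => d _; rewrite kget_kmap.
Qed.

Definition prs e d (u : V) : V := if (e <= d)%N then pr (d - e) u else 0.

Definition homogf (f : nat -> R) n e : Prop :=
  forall k, (k < n)%N -> forall d u, pr d (f k *: u) = f k *: prs e d u.

Lemma kmap_pr_kd f n e d (c : koz n V) : homogf f n e ->
  kmap (pr d) (kd f c) = kd f (kmap (prs e d) c).
Proof.
move=> hf; have aV : kadd (fun _ : V => True) (pr d) by move=> u v _ _; apply: prB.
apply: (kmap_kd2 (submodT V) aV _ (kin_true c (fun=> I))) => k u kn _.
exact: hf.
Qed.

Lemma kmap_prs e d n (c : koz n V) : kmap (prs e d) c =
  if (e <= d)%N then kmap (pr (d - e)) c else 0.
Proof.
apply: kget_ext => J; rewrite kget_kmap /prs; case: ifP => _; by rewrite ?kget_kmap ?kget0.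
Qed.

Lemma Hvan_graded (U : V -> Prop) f n p e : submod U -> (forall d u, U u -> U (pr d u)) ->
  homogf f n e ->
  (forall D (c : koz n V), kin U c -> kdeg p c -> kd f c = 0 -> kmap (pr D) c = c ->
     exists b : koz n V, [/\ kin U b, pdeg p b & kd f b = c]) ->
  Hvan f n p U.
Proof.
move=> sU gU hf h c cU cd c0.
have hd d : exists b : koz n V, [/\ kin U b, pdeg p b & kd f b = kmap (pr d) c].
  apply: (h d).
  - exact: (kin_kmap (gU d) cU).
  - exact: (kdeg_kmap (pr0 d) cd).
  - have := kmap_pr_kd (d + e) c hf; rewrite kmap_prs leq_addl addnK => <-.
    by rewrite c0 kmap0.
  - exact: kmap_pr_id.
have /choice[b bE] := hd; have [M ->] := kpart c.
exists (\sum_(d < M) b d); split.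
- apply/kin_kget => J; rewrite kget_sum; apply: submod_sum => // d _.
  by have [/kin_kget] := bE d.
- by elim/big_ind: _ => [|x y|d _]; [apply: pdeg0|apply: pdegD|have [] := bE d].
- by rewrite linear_sum; apply: eq_bigr => d _; have [] := bE d.
Qed.

End GradedKoszul.

Section Psi.
Variables (R : comNzRingType) (V : lmodType R).

(* The comparison map from the Koszul complex of f to that of f g. *)
Fixpoint kpsi n (g : nat -> R) : koz n V -> koz n V :=
  match n return koz n V -> koz n V with
  | 0 => id
  | n'.+1 => fun c => (@kpsi n' (fun k => g k.+1) c.1, g 0%N *: @kpsi n' (fun k => g k.+1) c.2)
  end.

Lemma kpsi_lin n g r (c d : koz n V) : kpsi g (r *: c + d) = r *: kpsi g c + kpsi g d.
Proof.
elim: n g c d => [|n IH] g c d //=; rewrite !IH; congr (_, _).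
by rewrite /= scalerDr !scalerA mulrC.
Qed.

Lemma kpsi_sub n g (c d : koz n V) : kpsi g (c - d) = kpsi g c - kpsi g d.
Proof. by rewrite addrC -scaleN1r kpsi_lin scaleN1r addrC. Qed.

Lemma kpsiZ n g r (c : koz n V) : kpsi g (r *: c) = r *: kpsi g c.
Proof.
elim: n g c => [|n IH] g c //=; rewrite !IH; congr (_, _).
by rewrite /= !scalerA mulrC.
Qed.

Lemma kpsi_kd n f g (c : koz n V) :
  kpsi g (kd f c) = kd (fun k => f k * g k) (kpsi g c).
Proof.
elim: n f g c => [|n IH] f g c //=; congr (_, _); first exact: IH.
rewrite /= kpsi_sub kpsiZ IH scalerBr scalerA mulrC.
by rewrite [in RHS]linearZ.
Qed.

Lemma kpsi_comp n f g (c : koz n V) : kpsi g (kpsi f c) = kpsi (fun k => f k * g k) c.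
Proof.
elim: n f g c => [|n IH] f g c //=; rewrite kpsiZ !IH; congr (_, _).
by rewrite /= scalerA mulrC.
Qed.

Lemma kpsi_eqf n f g (c : koz n V) : (forall k, (k < n)%N -> f k = g k) -> kpsi f c = kpsi g c.
Proof.
elim: n f g c => [|n IH] f g c h //=.
by rewrite h // !(IH _ (fun k => g k.+1)) // => k kn; apply: h.
Qed.

Lemma kget_kpsi n g (c : koz n V) (J : {set 'I_n}) :
  kget (kpsi g c) J = (\prod_(j in J) g j) *: kget c J.
Proof.
elim: n g c J => [|n IH] g c J /=.
  by rewrite big_pred0 ?scale1r // => -[].
rewrite big_mkcond big_ord_recl /=.
have -> : \prod_(i < n) (if lift ord0 i \in J then g (bump 0 i) else 1) =
    \prod_(j in preS J) g j.+1.
  by rewrite [RHS]big_mkcond; apply: eq_bigr => i _; rewrite inE.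
by case: ifP => _; rewrite ?kgetZ IH ?scalerA ?mul1r.
Qed.

Lemma kpsi_kdeg n g p (c : koz n V) : kdeg p c -> kdeg p (kpsi g c).
Proof. by move=> /kdeg_kget h; apply/kdeg_kget => J Jp; rewrite kget_kpsi h ?scaler0. Qed.

Lemma kpsi_kin n g U (c : koz n V) : submod U -> kin U c -> kin U (kpsi g c).
Proof.
by move=> sU /kin_kget h; apply/kin_kget => J; rewrite kget_kpsi; apply: submodZ.
Qed.

End Psi.

Lemma kmap_kpsi (R R' : comNzRingType) (V : lmodType R) (W : lmodType R') n
    (U : V -> Prop) (phi : V -> W) (pi : {rmorphism R -> R'}) g h (c : koz n V) :
  submod U -> (forall r u, U u -> phi (r *: u) = pi r *: phi u) ->
  (forall k, (k < n)%N -> pi (g k) = h k) -> kin U c ->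
  kmap phi (kpsi g c) = kpsi h (kmap phi c).
Proof.
move=> sU hphi gh /kin_kget cU; apply: kget_ext => J.
rewrite kget_kmap !kget_kpsi hphi // kget_kmap rmorph_prod.
by congr (_ *: _); apply: eq_bigr => j _; apply: gh.
Qed.

Section GoodLift.
Variables (K : fieldType) (l : nat).
Local Notation S := {mpoly K[l]}.

Lemma grading_S : grading (fun d => pihomog mdeg d : S^o -> S^o).
Proof.
split=> [d u v|d u|u]; first exact: raddfB.
  exact: pihomog_id.
by exists (msize u) => M' hM; apply: pihomog_partitionE.
Qed.

Lemma grading_rV m : grading (@hc K l m (fun=> 0%N)).
Proof.
split=> [d u v|d u|u]; [exact: raddfB|exact: hc_id|].
by exists (hbound (fun=> 0%N) u) => M' hM; apply: hc_partition.
Qed.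

Lemma homogf_S (f : nat -> S) n e : (forall k, (k < n)%N -> f k \is e.-homog for mdeg) ->
  homogf (fun d => pihomog mdeg d : S^o -> S^o) f n e.
Proof.
move=> hf k kn d u; rewrite -[_ *: u]/(f k * u) mulrC (pihomogM _ _ (hf k kn)) /prs.
by case: ifP => _; [rewrite mulrC|rewrite scaler0].
Qed.

Lemma homogf_rV m (f : nat -> S) n e : (forall k, (k < n)%N -> f k \is e.-homog for mdeg) ->
  homogf (@hc K l m (fun=> 0%N)) f n e.
Proof.
move=> hf k kn d u; rewrite /prs; case: leqP => ed.
  by rewrite -{1}(subnK ed) (hc_scaleS _ _ _ (hf k kn)).
by rewrite (hc_scaleS_lt _ _ (hf k kn)) // scaler0.
Qed.

Variable H : {vspace 'rV[K]_l}.
Hypothesis hH : is_hyperplane H.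
Local Notation n := (\dim H).
Local Notation T := {mpoly K[n]}.
Local Notation pi := (@hpi K l H).

(* Lifts to S of a regular sequence of S / alpha S: homogeneity replaces
   completeness along alpha. *)
Lemma good_lift (f : nat -> S) (h : nat -> T) m e :
  (forall k, (k < n)%N -> f k \is e.-homog for mdeg) ->
  (forall k, (k < n)%N -> pi (f k) = h k) -> good h n m -> good f n m.
Proof.
move=> hf fh gh p pm.
have hof := homogf_S hf.
apply: (Hvan_graded grading_S (submodT S^o) _ hof) => // D c _.
have [p1 p2] : kadd (fun _ : S^o => True) (pi : S^o -> T^o) /\
    (forall k u, (k < n)%N -> True -> (pi : S^o -> T^o) (f k *: u) = h k *: (pi u : T^o)).
  split=> [u v _ _|k u kn _]; first exact: hpiB.
  by rewrite -fh //; apply: hpiM.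
have al0 := alpha_neq0' hH.
pose pih d := fun u : S^o => pihomog mdeg d u : S^o.
pose low d := fun u : S^o => (if (0 < d)%N then pihomog mdeg d.-1 u else 0) : S^o.
have aD d (u v : S^o) : pih d (alpha H *: u + v) = alpha H *: low d u + pih d v.
  rewrite /pih /low [pihomog _ _ _]raddfD -[_ *: u]/(alpha H * u) /=; congr (_ + _).
  rewrite mulrC (pihomogM _ _ (linear_form_homog _)) subn1 mulrC.
  by case: ifP => _; rewrite ?scaler0.
(* A homogeneous cocycle of degree d is a coboundary plus alpha_H times a cocycle of degree d - 1,
   so the induction on d ends at the degree 0. *)
have step d (c0 : koz n S^o) : kdeg p c0 -> kd f c0 = 0 -> kmap (pih d) c0 = c0 ->
    exists b c', [/\ pdeg p b, kdeg p c', kd f (kmap (low d) c') = 0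
      & c0 = kd f b + alpha H *: kmap (low d) c'].
  move=> cd c00 cD.
  have [||b' [_ bd' be]] := gh p pm (kmap (pi : S^o -> T^o) c0) (kin_true _ (fun=> I)).
  - by apply: kdeg_kmap => //; apply: hpi0.
  - by rewrite -(kmap_kd2 (submodT S^o) p1 p2 (kin_true c0 (fun=> I))) c00 kmap0 // hpi0.
  have [b [_ bd bE]] := @kmap_lift_p _ _ S^o T^o n p (fun _ => True) (fun _ => True) (pi : S^o -> T^o) b' I (hpi0 H)
    (fun w _ => ex_intro2 _ _ (hsg w : S^o) I (hsgK w)) (kin_true _ (fun=> I)) bd'.
  have z0 : kmap (pi : S^o -> T^o) (c0 - kd f b) = 0.
    rewrite (kmap_sub p1 (kin_true _ (fun=> I)) (kin_true _ (fun=> I))).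
    by rewrite (kmap_kd2 (submodT S^o) p1 p2 (kin_true b (fun=> I))) bE be subrr.
  have zm : kin (mdvd (alpha H) : S^o -> Prop) (c0 - kd f b).
    have := kmap_eq0 (kin_true (c0 - kd f b) (fun=> I)) z0.
    by apply: kin_imp => u [_ /(hpi_ker hH)].
  have [c' c'd c'E] := kin_mdvd_lift (kdegB cd (pdeg_kd f bd)) zm.
  have cE : c0 = kd f (kmap (prs pih e d) b) + alpha H *: kmap (low d) c'.
    rewrite -(kmap_pr_kd grading_S _ _ hof) -{1}cD -[in LHS](subrK (kd f b) c0) c'E.
    apply: kget_ext => J; rewrite kget_kmap !kgetD !kgetZ !kget_kmap.
    by rewrite aD addrC.
  exists (kmap (prs pih e d) b), c'; split=> //.
    by rewrite kmap_prs; case: ifP => _; [apply: pdeg_kmap => //; apply: raddf0|apply: pdeg0].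
  apply: (koz_regular al0); have := congr1 (@kd _ _ n f) cE.
  by rewrite c00 kdD kd_dd add0r kdZ.
elim: D c => [|D IH] c cd c0 cD; have [b [c' [bd c'd c'0 cE]]] := step _ _ cd c0 cD.
  exists b; split=> //; first exact: kin_true.
  rewrite cE; have -> : kmap (low 0%N) c' = 0 by apply: kget_ext => J; rewrite kget_kmap kget0.
  by rewrite scaler0 addr0.
have [|||b2 [_ bd2 bE2]] := IH (kmap (low D.+1) c').
- by apply: kdeg_kmap => //; apply: raddf0.
- exact: c'0.
- exact: (kmap_pr_id grading_S).
exists (b + alpha H *: b2); split; first exact: kin_true.
  by apply: pdegD => //; apply: pdegZ.
by rewrite kdD kdZ bE2 -cE.
Qed.

End GoodLift.

Lemma kget_kd1 (R : comNzRingType) (V : lmodType R) n f (c : koz n V) (k : 'I_n) :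
  kget (kd f c) [set k] = f k *: kget c set0.
Proof.
rewrite kget_kd big_set1 (_ : [set j in [set k] | (j < k)%N] = set0).
  by rewrite cards0 scale1r setDv.
by apply/setP => j; rewrite !inE; case: eqP => [->|//]; rewrite ltnn.
Qed.

Section LowDegree.
Variables (R : idomainType) (V : lmodType R) (prV : nat -> V -> V) (prR : nat -> R^o -> R^o).
Variables (I : Type) (P : I -> Prop) (lam : I -> V -> R) (a : I -> R) (dl : I -> nat).
Hypotheses (grV : grading prV) (grR : grading prR).
Hypothesis lam_lin : forall i, P i -> forall r u v, lam i (r *: u + v) = r * lam i u + lam i v.
Hypothesis lam_pr : forall i, P i -> forall d u, lam i (prV d u) = prR (d + dl i) (lam i u).
Hypothesis dl1 : forall i, P i -> (dl i <= 1)%N.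
Hypothesis a_pr : forall i, P i -> forall d x, mdvd (a i) x -> mdvd (a i) (prR d x).
Variables (f : nat -> R) (n N : nat).
Hypotheses (fV : homogf prV f n N) (fR : homogf prR f n N).
Hypothesis hV : Hvan f n 2 (fun _ : V => True).
Hypothesis hR : good f n 3.

(* A submodule cut out by divisibility conditions has no second cohomology in
   low degrees: the cochain b solving d b = c in the free module has degree too
   small for the obstruction in R / a_i to be nonzero. *)
Lemma Hvan2_low D (c : koz n V) :
  kin (fun u => forall i, P i -> mdvd (a i) (lam i u)) c -> kdeg 2 c -> kd f c = 0 ->
  kmap (prV D) c = c -> (D.+1 < 2 * N)%N ->
  exists b : koz n V, [/\ kin (fun u => forall i, P i -> mdvd (a i) (lam i u)) b,
    kdeg 1 b & kd f b = c].
Proof.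
move=> cU cd c0 cD DN.
have [b0 [_ b0d b0E]] := hV (kin_true c (fun=> Logic.I)) cd c0.
have bE : kd f (kmap (prs prV N D) b0) = c by rewrite -(kmap_pr_kd grV) // b0E.
have prV0 d : prV d 0 = 0 by case: grV => h _ _; have := h d 0 0; rewrite !subrr.
have prR0 d : prR d 0 = 0 by case: grR => h _ _; have := h d 0 0; rewrite !subrr.
exists (kmap (prs prV N D) b0); split=> //; last first.
  by rewrite kmap_prs; case: ifP => _; [apply: kdeg_kmap|apply: kdeg0].
rewrite kmap_prs in bE *.
suff bi i : P i -> kin (fun v => mdvd (a i) (lam i v)) (if (N <= D)%N then kmap (prV (D - N)) b0 else 0).
  by apply/kin_kget => J i /bi /kin_kget.
move=> Pi; pose L : V -> R^o := lam i.
have LD u v : L (u - v) = L u - L v.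
  by have := lam_lin Pi (-1) v u; rewrite scaleN1r mulN1r addrC [- lam i v + _]addrC.
have L0 : L 0 = 0 by have := LD 0 0; rewrite !subrr.
have LZ r u : L (r *: u) = r *: L u.
  by have := lam_lin Pi r u 0; rewrite addr0 -[lam i 0]/(L 0) L0 addr0.
have La : kadd (fun _ : V => True) L by move=> u v _ _; apply: LD.
have Lk k u : (k < n)%N -> True -> L (f k *: u) = f k *: L u by move=> _ _; apply: LZ.
have Lkd (x : koz n V) : kmap L (kd f x) = kd f (kmap L x).
  by rewrite (kmap_kd2 (submodT V) La Lk (kin_true x (fun=> Logic.I))).
case: (leqP N D) bE => ND bE; last first.
  by apply/kin_kget => J; rewrite kget0 -[lam i 0]/(L 0) L0; exists 0; rewrite mulr0.
set b := kmap _ b0 in bE *.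
suff: kin (mdvd (a i) : R^o -> Prop) (kmap L b).
  move/kin_kget => h; apply/kin_kget => J; have := h J; by rewrite kget_kmap.
have bd : kdeg 1 (kmap L b) by apply: kdeg_kmap => //; apply: kdeg_kmap.
have dLE : kd f (kmap L b) = kmap L c by rewrite -Lkd bE.
pose d' := (D - N + dl i)%N.
have hom : kmap (prR d') (kmap L b) = kmap L b.
  apply: kget_ext => J; rewrite !kget_kmap /L -lam_pr //; congr (lam i _).
  by case: grV => _ ->.
(* The cochain [kmap L b] is homogeneous of degree at most D - N + 1, which is below N, while a
   coboundary d s has no component in degrees below N. *)
have d'N : (d' < N)%N by have := dl1 Pi; rewrite /d'; lia.
suff [t tE] : exists t : koz n R^o, kdeg 1 t /\ kd f (kmap L b - a i *: t) = 0.
  case: tE => td tE.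
  have [s [_ /= sd sE]] := hR (isT : (1 < 3)%N) (kin_true _ (fun=> Logic.I)) (kdegB bd (kdegZ (a i) td)) tE.
  have : kmap (prR d') (kd f s) = 0.
    by rewrite (kmap_pr_kd grR _ _ fR) kmap_prs leqNgt d'N linear0.
  rewrite sE => e; apply/kin_kget => J.
  have := congr1 (fun x => kget x J) e; rewrite kget0 kget_kmap kget_sub.
  have [prB _ _] := grR; rewrite prB -kget_kmap hom kgetZ => /eqP.
  rewrite subr_eq0 => /eqP ->; apply: a_pr => //; by exists (kget t J).
have cm : kin (mdvd (a i) : R^o -> Prop) (kmap L c).
  by apply/kin_kget => J; rewrite kget_kmap; move/kin_kget: cU => /(_ J i Pi).
case: (eqVneq (a i) 0) => ai.
  exists 0; split; first exact: kdeg0.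
  rewrite scaler0 subr0 dLE; apply: kget_ext => J; rewrite kget0.
  by move/kin_kget: cm => /(_ J)[x ->]; rewrite ai mul0r.
have [g gd gE] := kin_mdvd_lift (kdeg_kmap L0 cd) cm.
have g0 : kd f g = 0.
  by apply: (koz_regular ai); rewrite -kdZ -gE -Lkd c0 kmap0.
have [t [_ td tE]] := hR (isT : (2 < 3)%N) (kin_true _ (fun=> Logic.I)) gd g0.
by exists t; split=> //; rewrite kdB kdZ tE dLE gE subrr.
Qed.

End LowDegree.

Section Surjectivity.
Variables (R R' : comNzRingType) (V : lmodType R) (W : lmodType R') (pi : {rmorphism R -> R'}).
Variables (prV : nat -> V -> V) (U : V -> Prop) (U' : W -> Prop) (phi : V -> W) (a : R).
Variables (y : nat -> R) (h : nat -> R') (n : nat).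
Hypotheses (grV : grading prV) (sU : submod U) (gU : forall d u, U u -> U (prV d u)).
Hypotheses (aphi : kadd U phi) (pphi : forall r u, U u -> phi (r *: u) = pi r *: phi u).
Hypotheses (pi_surj : forall s, exists r, pi r = s) (yh : forall k, (k < n)%N -> pi (y k) = h k).
Hypothesis into : forall u, U u -> U' (phi u).
Hypothesis ker : forall u, U u -> phi u = 0 -> exists2 v, U v & u = a *: v.
Hypothesis reg : forall u : V, a *: u = 0 -> u = 0.
Hypothesis phia : forall u, U u -> phi (a *: u) = 0.
Hypothesis pra : forall d u, prV d (a *: u) = a *: (if (0 < d)%N then prV d.-1 u else 0).
Let yN N k := y k ^+ N.
Let hN N k := h k ^+ N.
Hypothesis yhom : forall N, homogf prV (yN N) n N.
Hypothesis phom : forall M D (c : koz n V), kdeg 2 c ->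
  kmap (prV D) c = c -> kmap (prV (D + 2 * M)) (kpsi (yN M) c) = kpsi (yN M) c.
Hypothesis H2 : forall N, Hvan (hN N) n 2 U'.
Hypothesis local : forall w, U' w -> exists M, forall k, (k < n)%N ->
  exists2 u, U u & phi u = h k ^+ M *: w.
Hypothesis low : forall N D (c : koz n V), kin U c -> kdeg 2 c -> kd (yN N) c = 0 ->
  kmap (prV D) c = c -> (D.+1 < 2 * N)%N ->
  exists b : koz n V, [/\ kin U b, kdeg 1 b & kd (yN N) b = c].

Let im w := exists2 u, U u & phi u = w.
Let phi0 : phi 0 = 0. Proof. exact: kadd0 aphi. Qed.
Let im_submod : submod im.
Proof.
split; first by exists 0; [case: sU|].
move=> s u v [x xU <-] [z zU <-]; have [r <-] := pi_surj s.
have nz : U (- z) by apply: submodN.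
exists (r *: x - - z); first by apply: submodB => //; apply: submodZ.
rewrite aphi //; last exact: submodZ.
by rewrite pphi // -[- z]add0r aphi ?phi0 ?sub0r ?opprK //; case: sU.
Qed.

Let prV0 d : prV d 0 = 0. Proof. by case: grV => h' _ _; have := h' d 0 0; rewrite !subrr. Qed.

Let prVD d u v : prV d (u + v) = prV d u + prV d v.
Proof.
case: grV => prB _ _; rewrite -[v in LHS]opprK prB -[- v]sub0r prB prV0.
by rewrite sub0r opprK.
Qed.

Let akoz m (c : koz m V) : a *: c = 0 -> c = 0.
Proof.
by move=> e; apply: kget_ext => J; rewrite kget0; apply: reg; rewrite -kgetZ e kget0.
Qed.

Let kphi N (c : koz n V) : kin U c -> kmap phi (kd (yN N) c) = kd (hN N) (kmap phi c).
Proof.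
apply: kmap_kd2 => // k u kn uU; rewrite pphi // rmorphXn /= yh //.
Qed.

Let kphipsi N (c : koz n V) : kin U c -> kmap phi (kpsi (yN N) c) = kpsi (hN N) (kmap phi c).
Proof. by apply: (kmap_kpsi sU pphi) => k kn; rewrite rmorphXn yh. Qed.

Let yND N M (c : koz n V) : kd (fun k => yN N k * yN M k) c = kd (yN (N + M)) c.
Proof. by apply: kd_eqf => k _; rewrite /yN exprD. Qed.

Let klift p (c : koz n V) : kdeg p c -> kin U c -> kmap phi c = 0 ->
  exists d, [/\ kdeg p d, kin U d & c = a *: d].
Proof.
move=> cd cU c0; have := kmap_eq0 cU c0 => cK.
have h0 : a *: (0 : V) = 0 by rewrite scaler0.
have [d [dU dd de]] := kmap_lift (phi := *:%R a) sU.1 h0 (U' := kker U phi) (fun w wK => let: conj wU w0 := wK in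
  let: ex_intro2 v vU e := ker wU w0 in ex_intro2 _ _ v vU (esym e)) cK cd.
by exists d; split=> //; rewrite -de; apply: kget_ext => J; rewrite kget_kmap kgetZ.
Qed.

(** Passing to the powers N + M replaces D by D + 2 M and 2 N by 2 N + 2 M, so D + 1 - 2 N is
    preserved; each division by a lowers it by one. Once it is negative, [low] applies. This shows
    that the class of c dies in the direct limit over the powers of y. *)
Let star k : forall N D (c : koz n V), kin U c -> kdeg 2 c -> kd (yN N) c = 0 ->
  kmap (prV D) c = c -> (D.+1 < 2 * N + k)%N ->
  exists M (e : koz n V), [/\ kin U e, kdeg 1 e & kd (yN (N + M)) e = kpsi (yN M) c].
Proof.
elim: k => [|k IH] N D c cU cd c0 cD Dk.
  rewrite addn0 in Dk; have [b [bU bd be]] := low cU cd c0 cD Dk.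
  exists 0%N, b; split=> //; rewrite addn0 be; apply: kget_ext => J.
  by rewrite kget_kpsi big1 ?scale1r.
have [|b [bU bd be]] := H2 (kin_kmap into cU) (kdeg_kmap phi0 cd) (_ : kd (hN N) _ = 0).
  by rewrite -kphi // c0 kmap0.
have /choice[M0 M0E] : forall J : {set 'I_n}, exists M, forall k, (k < n)%N ->
    exists2 u, U u & phi u = h k ^+ M *: kget b J.
  by move=> J; apply: local; move/kin_kget: bU.
pose M := (\sum_J M0 J)%N.
have gi : kin im (kpsi (hN M) b).
  apply/kin_kget => J; rewrite kget_kpsi; case: (eqVneq #|J| 1%N) => [|J1].
    (* As b has degree 1, [kpsi] multiplies its component at j by h_j^M, enough to bring it into the
       image of [phi]. *)
    move/eqP/cards1P => [j ->]; rewrite big_set1 /hN /M (bigD1 [set j]) //= addnC exprD -scalerA.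
    by apply: submodZ => //; have [u uU <-] := M0E [set j] j (ltn_ord j); exists u.
  move/kdeg_kget: bd => -> //; rewrite scaler0; exact: im_submod.1.
have [g [gkU gd gE]] := kmap_lift sU.1 phi0 (fun w (wi : im w) => wi) gi (kpsi_kdeg _ bd).
have [|||d [dd dU dE]] := @klift 2 (kpsi (yN M) c - kd (yN (N + M)) g).
- by apply: kdegB; [apply: kpsi_kdeg|apply: kdeg_kd].
- by apply: kinB => //; [apply: kpsi_kin|apply: kin_kd].
- rewrite (kmap_sub aphi); [|exact: kpsi_kin|exact: kin_kd].
  rewrite kphipsi // kphi // gE -be kpsi_kd.
  apply/eqP; rewrite subr_eq0; apply/eqP; apply: kd_eqf => j _.
  by rewrite /hN exprD.
pose g' := kmap (prs prV (N + M) (D + 2 * M)) g.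
pose d' := kmap (fun u => if (0 < D + 2 * M)%N then prV (D + 2 * M).-1 u else 0) d.
have g'U : kin U g'.
  by rewrite /g' kmap_prs; case: ifP => _; [exact: (kin_kmap (gU _) gkU)|apply: kin0].
have g'd : kdeg 1 g'.
  by rewrite /g' kmap_prs; case: ifP => _; [exact: (kdeg_kmap (prV0 _) gd)|apply: kdeg0].
have E : kpsi (yN M) c = kd (yN (N + M)) g' + a *: d'.
  rewrite -(kmap_pr_kd grV) // -(phom _ cd cD) -[in LHS](subrK (kd (yN (N + M)) g) (kpsi (yN M) c)) dE.
  apply: kget_ext => J; rewrite !kgetD !kgetZ !kget_kmap kgetD kgetZ prVD pra addrC.
  by [].
have d'U : kin U d'.
  by apply: (kin_kmap _ dU) => u uU; case: ifP => _; [apply: gU|case: sU].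
have d'd : kdeg 2 d' by apply: (kdeg_kmap _ dd); case: ifP.
have d'0 : kd (yN (N + M)) d' = 0.
  apply: akoz; have := congr1 (@kd _ _ n (yN (N + M))) E.
  by rewrite kdD kd_dd add0r kdZ => <-; rewrite -yND -kpsi_kd c0 -[0](scale0r 0) kpsiZ !scale0r.
case: (posnP (D + 2 * M)%N) => [D0|Dpos].
  exists M, g'; split=> //; rewrite E.
  have -> : d' = 0 by apply: kget_ext => J; rewrite kget_kmap D0 kget0.
  by rewrite scaler0 addr0.
have [||M' [e [eU ed eE]]] := IH (N + M)%N (D + 2 * M).-1 d' d'U d'd d'0.
- by apply: kget_ext => J; rewrite !kget_kmap Dpos; case: grV => _ ->.
- by move: Dpos Dk; lia.
exists (M + M')%N, (kpsi (yN M') g' + a *: e); split.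
- by apply: kinD => //; [apply: kpsi_kin|apply: kinZ].
- by apply: kdegD; [apply: kpsi_kdeg|apply: kdegZ].
rewrite kdD kdZ addnA eE -(yND (N + M)) -kpsi_kd.
rewrite (@kpsi_eqf _ _ n (yN (M + M')) (fun k => yN M k * yN M' k)); last by move=> j _; rewrite /yN exprD.
by rewrite -kpsi_comp E -[kd _ g' in RHS]scale1r kpsi_lin scale1r kpsiZ.
Qed.

Let star_all N (c : koz n V) : kin U c -> kdeg 2 c -> kd (yN N) c = 0 ->
  exists M (e : koz n V), [/\ kin U e, kdeg 1 e & kd (yN (N + M)) e = kpsi (yN M) c].
Proof.
move=> cU cd c0; have [B cE] := kpart grV c.
have sd d : exists M (e : koz n V), [/\ kin U e, kdeg 1 e
    & kd (yN (N + M)) e = kpsi (yN M) (kmap (prV d) c)].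
  (* With k = d + 2 the bound d + 1 < 2 N + k holds whatever N is. *)
  apply: (@star (d.+2) N d).
  - exact: (kin_kmap (gU d) cU).
  - exact: (kdeg_kmap (prV0 d) cd).
  - have := kmap_pr_kd grV (d + N) c (yhom N); rewrite kmap_prs leq_addl addnK => <-.
    by rewrite c0 kmap0.
  - exact: (kmap_pr_id grV).
  - by lia.
have /choice[M ME] := sd; pose M1 := (\sum_(d < B) M d)%N.
have /choice[e eE] : forall d : 'I_B, exists e : koz n V, [/\ kin U e, kdeg 1 e
    & kd (yN (N + M1)) e = kpsi (yN M1) (kmap (prV d) c)].
  move=> d; have [e [eU ed eE]] := ME d; pose M2 := (M1 - M d)%N.
  have M12 : M1 = (M d + M2)%N by rewrite /M2 subnKC // /M1 (bigD1 d) //= leq_addr.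
  exists (kpsi (yN M2) e); split; [exact: kpsi_kin|exact: kpsi_kdeg|].
  rewrite M12 addnA -yND -kpsi_kd eE kpsi_comp; apply: kpsi_eqf => k _.
  by rewrite /yN exprD.
exists M1, (\sum_(d < B) e d); split.
- apply/kin_kget => J; rewrite kget_sum; apply: submod_sum => // d _.
  by have [/kin_kget] := eE d.
- by elim/big_ind: _ => [|u v|d _]; [apply: kdeg0|apply: kdegD|have [] := eE d].
rewrite linear_sum [in RHS]cE; apply: kget_ext => J; rewrite kget_kpsi !kget_sum scaler_sumr.
by apply: eq_bigr => d _; have [_ _ /= ->] := eE d; rewrite kget_kpsi.
Qed.

Hypothesis H1 : forall N, Hvan (yN N) n 1 U.
Hypothesis n0 : (0 < n)%N.
Hypothesis hreg : forall (w : W) N, h 0%N ^+ N *: w = 0 -> w = 0.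

(* If w is not in the image, d(h^M w) lifts to a cochain g with d g = a z, and z
   dies in the direct limit over powers of y by the degree induction. *)
Lemma local_surj w : U' w -> exists2 u, U u & phi u = w.
Proof.
move=> wU; have [M ME] := local wU.
pose c0 : koz n W := kset (fun J => if J == set0 then w else 0).
have c0d : kdeg 0 c0 by apply/kdeg_kget => J; rewrite kgetK cards_eq0 => /negPf ->.
have ci : kin im (kd (hN M) c0).
  apply/kin_kget => J; case: (eqVneq #|J| 1%N) => [|J1].
    move/eqP/cards1P => [j ->]; rewrite kget_kd1 kgetK eqxx.
    by have [u uU e] := ME j (ltn_ord j); exists u.
  have /kdeg_kget -> // := kdeg_kd (hN M) c0d; exact: im_submod.1.
have [g [gkU gd gE]] := kmap_lift sU.1 phi0 (fun w (wi : im w) => wi) ci (kdeg_kd _ c0d).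
have [|||z [zd zU zE]] := @klift 2 (kd (yN M) g).
- exact: kdeg_kd.
- exact: kin_kd.
- by rewrite kphi // gE kd_dd.
have z0 : kd (yN M) z = 0 by apply: akoz; rewrite -kdZ -zE kd_dd.
have [N [e [eU ed eE]]] := star_all zU zd z0.
have [|||u [uU /= ud uE]] := @H1 (M + N)%N (kpsi (yN N) g - a *: e).
- by apply: kinB => //; [apply: kpsi_kin|apply: kinZ].
- by apply: kdegB; [apply: kpsi_kdeg|apply: kdegZ].
- by rewrite kdB kdZ eE -yND -kpsi_kd zE kpsiZ subrr.
have := congr1 (kmap phi) uE; rewrite kphi // (kmap_sub aphi); [|exact: kpsi_kin|exact: kinZ].
have -> : kmap phi (a *: e) = 0.
  by apply: kget_ext => J; rewrite kget_kmap kgetZ kget0 phia //; move/kin_kget: eU.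
rewrite subr0 kphipsi // gE kpsi_kd.
have -> : kd (fun k => hN M k * hN N k) (kpsi (hN N) c0) = kd (hN (M + N)) (kpsi (hN N) c0).
  by apply: kd_eqf => k _; rewrite /hN exprD.
move/(congr1 (fun x => kget x [set Ordinal n0])); rewrite !kget_kd1 kget_kpsi big_set0 scale1r.
rewrite kgetK eqxx kget_kmap => /eqP; rewrite -subr_eq0 -scalerBr => /eqP /hreg /eqP.
by rewrite subr_eq0 => /eqP ue; exists (kget u set0) => //; move/kin_kget: uU.
Qed.

End Surjectivity.

Lemma homog_prod (K : fieldType) l (I : finType) (J : {set I}) (F : I -> {mpoly K[l]}) e :
  (forall j, F j \is e.-homog for mdeg) -> \prod_(j in J) F j \is (#|J| * e).-homog for mdeg.
Proof.
move=> hF; rewrite -sum_nat_const.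
elim/big_rec2: _ => [|i d q _ hq]; first exact: dhomog1.
exact: dhomogM.
Qed.

Section ZeroForms.
Variables (K : fieldType) (l : nat).
Local Notation S := {mpoly K[l]}.
Local Notation vsp := {vspace 'rV[K]_l}.
Local Notation hcz := (@hc K l l (fun=> 0%N)).
Variables (A : {fset vsp}).
Hypothesis hA : is_arrangement A.

(** U0 as a set of divisibility conditions. The index [None] is the contraction with the Euler
    field, which raises degrees by one and has divisor 0, so that divisibility means vanishing. *)
Let I := option (vsp * 'rV[K]_l).
Let P (i : I) : Prop := if i is Some (L, v) then L \in A /\ v \in L else True.
Let lam (i : I) (u : 'rV[S]_l) : S := if i is Some (L, v) then ev u v else ct (eul K l) u.
Let a (i : I) : S := if i is Some (L, v) then alpha L else 0.
Let dg (i : I) : nat := if i is Some (L, v) then 0%N else 1%N.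

Let U0P eta : U0 A eta <-> forall i, P i -> mdvd (a i) (lam i eta).
Proof.
split=> [[h1 h2] [[L v] /= [LA vL]|_]|h].
- exact: h1.
- by exists 0; rewrite /= h2 mulr0.
split=> [L LA v vL|]; first exact: (h (Some (L, v))).
by have [x] := h None Logic.I; rewrite /= mul0r.
Qed.

Let lam_lin i : P i -> forall r u v, lam i (r *: u + v) = r * lam i u + lam i v.
Proof. by move=> _ r u v; case: i => [[L w]|] /=; [rewrite evDl evZl|apply: ct_lin]. Qed.

Lemma ev_hc d u v : ev (hcz d u) v = pihomog mdeg d (ev u v).
Proof.
rewrite /ev [RHS]linear_sum; apply: eq_bigr => i _.
by rewrite linearZ mxE leq0n subn0.
Qed.

Lemma ct_eul_hc d u : ct (eul K l) (hcz d u) = pihomog mdeg d.+1 (ct (eul K l) u).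
Proof.
rewrite /ct [RHS]raddf_sum; apply: eq_bigr => i _.
rewrite /= [in RHS]mulrC (pihomogM _ _ (_ : _ \is 1.-homog for mdeg)).
  by rewrite ltnS leq0n subn1 mulrC !mxE leq0n subn0.
by rewrite mxE dhomogX /= mdeg1.
Qed.

Let lam_pr i : P i -> forall d u, lam i (hcz d u) = pihomog mdeg (d + dg i) (lam i u).
Proof. by move=> _ d u; case: i => [[L v]|] /=; rewrite ?addn0 ?addn1 (ev_hc, ct_eul_hc). Qed.

Let a_pr i : P i -> forall d x, mdvd (a i) x -> mdvd (a i) (pihomog mdeg d x).
Proof.
case: i => [[L v]|] _ d x [c ->]; last by rewrite mul0r raddf0; exists 0; rewrite mulr0.
rewrite mulrC (pihomogM _ _ (linear_form_homog _)); case: ifP => _; last by exists 0; rewrite mulr0.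
by rewrite mulrC; eexists; reflexivity.
Qed.

Lemma U0_graded d u : U0 A u -> U0 A (hcz d u).
Proof.
by move=> /U0P h; apply/U0P => i Pi; rewrite lam_pr //; apply: a_pr => //; apply: h.
Qed.

Lemma Hvan_U0_1 f n : good f n 2 -> Hvan f n 1 (U0 A).
Proof.
move=> gf; apply: (@Hvan_iff _ _ _ _ _ (fun u => True /\ forall i, P i -> mdvd (a i) (lam i u))).
  by move=> u; split=> [[_ /U0P]|/U0P].
apply: Hvan_div; first exact: submodT.
- exact: lam_lin.
- exact: (Hvan_rV (gf 1%N isT)).
- exact: gf.
- exact: gf.
Qed.

Lemma Hvan_U0_low f n N D (c : koz n 'rV[S]_l) :
  (forall k, (k < n)%N -> f k \is N.-homog for mdeg) -> good f n 3 ->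
  kin (U0 A) c -> kdeg 2 c -> kd f c = 0 ->
  kmap (hcz D) c = c -> (D.+1 < 2 * N)%N ->
  exists b : koz n 'rV[S]_l, [/\ kin (U0 A) b, kdeg 1 b & kd f b = c].
Proof.
move=> hf gf cU cd c0 cD DN.
have cU' : kin (fun u => forall i, P i -> mdvd (a i) (lam i u)) c by apply: kin_imp cU => u /U0P.
have [||b [bU bd be]] := @Hvan2_low _ _ _ _ _ P lam a dg (grading_rV K l l) (grading_S K l)
  lam_lin lam_pr _ a_pr f n N (homogf_rV (m := l) hf) (homogf_S hf) _ gf D c cU' cd c0 cD DN.
- by case=> [[L v]|].
- exact: (Hvan_rV (gf 2 isT)).
by exists b; split=> //; apply: kin_imp bU => u /U0P.
Qed.

End ZeroForms.

Section ZieglerSurjective.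
Variables (K : fieldType) (l : nat).
Local Notation S := {mpoly K[l]}.
Local Notation vsp := {vspace 'rV[K]_l}.
Local Notation hcz := (@hc K l l (fun=> 0%N)).
Variables (H : vsp) (A : {fset vsp}).
Hypotheses (hA : is_arrangement A) (HA : H \in A).
Let hH : is_hyperplane H := hA HA.
Local Notation n := (\dim H).
Local Notation T := {mpoly K[n]}.
Local Notation pi := (@hpi K l H).
Local Notation A' := (A `\ H).
Local Notation E := (UA (restriction A H) (ziegler_mult A H)).
Hypothesis lf : locally_free_along A H.
Hypothesis tZ : pd_le (Omega (restriction A H) (ziegler_mult A H) 1) 1.

Lemma Hvan_E h g p : good h n g -> (p.+1 < g)%N -> Hvan h n p E.
Proof.
move=> gh pg; apply: (Hvan_UA_pd _ gh tZ); last by rewrite addn1.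
exact: restriction_arrangement.
Qed.

(** Once x lies in X, all members of A over X pass through x, so localization at x does not change
    the multiplicity of X. *)
Lemma ziegler_mult_loc L x : x \in H -> L \in localization A x ->
  ziegler_mult (localization A x) H (restrict_hyperplane H L) = ziegler_mult A H (restrict_hyperplane H L).
Proof.
move=> xH /locP[LA xL].
rewrite /ziegler_mult; congr (size (enum_fset _)); apply/fsetP => M; rewrite !inE /=.
case: (eqVneq M H) => //= MH; case MA: (M \in A) => //=.
case: eqP => [e|]; rewrite ?andbF ?andbT //.
have [u uE] := hbas_surj xH.
have : u \in restrict_hyperplane H L.
  by rewrite (mem_restr _ (hA LA)) /pair /bcoef mulmxA -uE -/(pair _ _) -mem_hpair //; apply: hA.
rewrite -e (mem_restr _ (hA MA)) /pair /bcoef mulmxA -uE -/(pair _ _) -mem_hpair //.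
exact: hA.
Qed.

Let I e (s : S^o) : Prop := exists2 eta, U0 A eta & zieg H eta = pi s *: e.

Let sI e : submod (I e).
Proof.
split; first by exists 0; [case: (U0_submod A)|rewrite zieg0 // hpi0 scale0r].
move=> r u v [x xU xe] [y yU ye]; exists (r *: x + y); first exact: (U0_submod A).2.
have xL := U1_logH HA xU.1; have yL := U1_logH HA yU.1.
rewrite (zieg_lin hH _ xL yL) xe ye.
by rewrite -[r *: u + v]/(r * u + v : S) hpiD hpiM scalerDl scalerA.
Qed.

Let I_alpha e : I e (alpha H).
Proof. by exists 0; [case: (U0_submod A)|rewrite zieg0 // hpi_alpha // scale0r]. Qed.

(** A preimage for A_x becomes logarithmic along A after multiplication by the multiplier, and
    [U1_split] moves it into U0 without changing its restriction. *)
Let I_off e x : E e -> x != 0 -> x \in H -> I e (offprod A' x).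
Proof.
move=> eE x0 xH; have HAx : H \in localization A x by apply/locP.
have [|eta eU etaE] := @zieg_local _ _ H _ (loc_arr x hA) HAx e (arr_free_data (loc_arr x hA) (lf x0 xH)).
  move=> X /imfsetP[L /= /fsetD1P[LH LAx] ->] u uX; rewrite ziegler_mult_loc //.
  by apply: eE => //; apply: restr_mem; have /locP[LA _] := LAx; apply/fsetD1P.
have gU : U1 A (offprod A' x *: eta).
  by apply: off_U1 => // L LA xL; apply/fsetD1P; split=> //; apply: contraNneq xL => ->.
have [c cU cE] := U1_split hA HA gU.
exists (offprod A' x *: eta - c *: dalpha H A) => //.
by rewrite cE (ziegZ hH _ (U1_logH HAx eU)) etaE.
Qed.

Lemma zieg_local_pow e : E e -> exists M, forall k, (k < n)%N ->
  exists2 u, U0 A u & zieg H u = natf (fun j : 'I_n => 'X_j) k ^+ M *: e.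
Proof.
move=> eE; have [|N NE] := @yhat_radical K l H A hA HA (I e) (sI e) (I_alpha e).
  by move=> x x0 xH; exists 1%N; rewrite expr1; apply: I_off.
by exists N => k /NE[u uU uE]; exists u => //; rewrite uE hpiX hpi_yhat.
Qed.

Lemma yhat_homog N k : (k < n)%N -> yhat H k ^+ N \is N.-homog for mdeg.
Proof.
move=> kn; rewrite -[X in X.-homog]mul1n; apply: dhomogMn.
by rewrite (yhat_lf (Ordinal kn)); apply: linear_form_homog.
Qed.

Lemma good_yhat N : good (fun k => yhat H k ^+ N) n n.
Proof.
apply: (good_lift hH (yhat_homog N)); last exact: (@good_Xn K n N n (leqnn n)).
by move=> k kn; rewrite hpiX hpi_yhat.
Qed.

Hypothesis n4 : (4 <= n)%N.

(** This is where the dimension of H must be at least 4: the logarithmic 1-forms of the Ziegler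
    restriction have projective dimension at most 1, and H^2 of them vanishes when 2 + 1 is less
    than the length of the sequence. *)
Lemma zieg_onto e : E e -> exists2 eta, U0 A eta & zieg H eta = e.
Proof.
have U0l eta : U0 A eta -> logH H eta by move=> [/(U1_logH HA)].
have gy N m : (m <= 4)%N -> good (fun k => yhat H k ^+ N) n m.
  by move=> m4 p pm; apply: good_yhat; apply: leq_trans n4; apply: leq_trans m4.
have n0 : (0 < n)%N by apply: leq_trans n4.
apply: (@local_surj S T 'rV[S]_l 'rV[T]_n (lsub (hbas H)) hcz (U0 A) E (zieg H) (alpha H) (yhat H)
  (natf (fun j : 'I_n => 'X_j)) n (grading_rV K l l) (U0_submod A)).
- exact: U0_graded.
- by move=> u v /U0l hu /U0l hv; apply: ziegB.
- by move=> r u /U0l hu; apply: ziegZ.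
- by move=> s; exists (hsg s); apply: hsgK.
- by move=> k kn; apply: hpi_yhat.
- by move=> u [uU _]; apply: zieg_into.
- exact: zieg_ker.
- by move=> u; apply: rV_scale_inj; apply: alpha_neq0'.
- by move=> u /U0l hu; rewrite ziegZ // hpi_alpha // scale0r.
- move=> d u; case: d => [|d] /=.
    by rewrite (hc_scaleS_lt _ _ (linear_form_homog _)) // scaler0.
  by have := hc_scaleS (fun=> 0%N) d u (linear_form_homog (alpha_coef H)); rewrite addn1.
- by move=> N; apply: homogf_rV => k kn; apply: yhat_homog.
- move=> M D c cd cD; apply: kget_ext => J; rewrite kget_kmap kget_kpsi.
  case: (eqVneq #|J| 2%N) => J2; last first.
    by move/kdeg_kget: cd => ->; rewrite // scaler0 raddf0.
  have hp : \prod_(j in J) yhat H j ^+ M \is (2 * M)%N.-homog for mdeg.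
    by rewrite -J2; apply: homog_prod => j; apply: yhat_homog.
  by rewrite (hc_scaleS _ _ _ hp) -{2}cD kget_kmap.
- by move=> N; apply: (@Hvan_E _ 4); [move=> p p4; apply: good_Xn => //; apply: leq_trans n4|].
- exact: zieg_local_pow.
- move=> N D c; apply: Hvan_U0_low; first exact: yhat_homog.
  exact: gy.
- by move=> N; apply: Hvan_U0_1; apply: gy.
- exact: n0.
move=> w N; apply: rV_scale_inj; rewrite expf_neq0 // (natfE _ (Ordinal n0)).
apply/eqP => /mpolyP/(_ U_(Ordinal n0)%MM); rewrite mcoeffX mcoeff0 eqxx => /eqP.
by rewrite oner_eq0.
Qed.

End ZieglerSurjective.

(** * Exterior powers *)

Section KozPoint.
Variables (R : comNzRingType) (V : lmodType R).

Definition kpt n (w : V) : koz n V := kset (fun J => if J == set0 then w else 0).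

Lemma kdeg_kpt n w : kdeg 0 (kpt n w).
Proof. by apply/kdeg_kget => J; rewrite kgetK cards_eq0 => /negPf ->. Qed.

(* Sections over the punctured spectrum extend when H^1 vanishes. *)
Lemma Hvan_extend f n (U U' : V -> Prop) w : submod U -> submod U' ->
  (forall u, U' u -> U u) -> U w -> (forall k, (k < n)%N -> U' (f k *: w)) ->
  Hvan f n 0 U -> Hvan f n 1 U' -> U' w.
Proof.
move=> sU sU' sub wU fw h0 h1.
have [||u [uU' /= ud ue]] := h1 (kd f (kpt n w)) _ _ (kd_dd _ _).
- apply/kin_kget => J; case: (eqVneq #|J| 1%N) => [|J1].
    by move/eqP/cards1P => [j ->]; rewrite kget_kd1 kgetK eqxx; apply: fw.
  by have /kdeg_kget -> := kdeg_kd f (kdeg_kpt n w); rewrite //; case: sU'.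
- exact: kdeg_kd (kdeg_kpt n w).
have [|||v [_ /= v0 ve]] := h0 (kpt n w - u) _ _ (_ : kd f _ = 0).
- apply: kinB => //; last exact: kin_imp uU'.
  by apply/kin_kget => J; rewrite kgetK; case: ifP => _ //; case: sU.
- exact: kdegB (kdeg_kpt n w) ud.
- by rewrite kdB ue subrr.
have := congr1 (fun x => kget x set0) ve; rewrite v0 linear0 kget0 kget_sub kgetK eqxx.
by move/eqP; rewrite eq_sym subr_eq0 => /eqP ->; move/kin_kget: uU'.
Qed.

End KozPoint.

Lemma zmod_alg (V : zmodType) (x y z b : V) : - (x - (y - b)) = z + y - (x + z + b).
Proof.
rewrite opprB [x + z]addrC -[z + x + b]addrA opprD addrACA subrr add0r.
by rewrite opprD addrA addrAC.
Qed.

Section Contraction.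
Variables (R : comNzRingType) (V : lmodType R).

Fixpoint kcon n (rho : nat -> R) : koz n V -> koz n V :=
  match n return koz n V -> koz n V with
  | 0 => fun=> 0
  | n'.+1 => fun c => (@kcon n' (fun k => rho k.+1) c.1 + rho 0%N *: c.2,
                       - @kcon n' (fun k => rho k.+1) c.2)
  end.

Lemma kcon_lin n rho r (c d : koz n V) : kcon rho (r *: c + d) = r *: kcon rho c + kcon rho d.
Proof.
elim: n rho c d => [|n IH] rho c d /=; first by rewrite scaler0 addr0.
rewrite !IH; congr (_, _); rewrite /= ?scalerDr ?scalerA; last by rewrite opprD scalerN.
by rewrite [rho 0%N * r]mulrC addrACA.
Qed.

Lemma kcon0 n rho : kcon rho (0 : koz n V) = 0.
Proof. by have := kcon_lin rho (-1) (0 : koz n V) 0; rewrite scaler0 addr0 scaleN1r addNr. Qed.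
Lemma kconD n rho (c d : koz n V) : kcon rho (c + d) = kcon rho c + kcon rho d.
Proof. by rewrite -[c]scale1r kcon_lin !scale1r. Qed.
Lemma kconZ n rho r (c : koz n V) : kcon rho (r *: c) = r *: kcon rho c.
Proof. by rewrite -[r *: c]addr0 kcon_lin kcon0 addr0. Qed.
Lemma kconB n rho (c d : koz n V) : kcon rho (c - d) = kcon rho c - kcon rho d.
Proof. by rewrite addrC -scaleN1r kcon_lin scaleN1r addrC. Qed.

Lemma kcon_sum n rho I (r : seq I) (P : pred I) (F : I -> koz n V) :
  kcon rho (\sum_(i <- r | P i) F i) = \sum_(i <- r | P i) kcon rho (F i).
Proof. exact: (big_morph _ (@kconD n rho) (kcon0 n rho)). Qed.

(** The interior product with rho is an antiderivation; it is a contracting homotopy for [kd f] up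
    to the factor by which rho pairs with f. *)
Lemma kcon_kd n rho f (c : koz n V) :
  kcon rho (kd f c) = (\sum_(k < n) rho k * f k) *: c - kd f (kcon rho c).
Proof.
elim: n rho f c => [|n IH] rho f; first by move=> c; rewrite big_ord0 scale0r subr0.
have -> : \sum_(k < n.+1) rho k * f k = rho 0%N * f 0%N + \sum_(k < n) rho k.+1 * f k.+1.
  exact: big_ord_recl.
move=> [a' b']; pose a : koz n V := a'; pose b : koz n V := b'.
have pB (x y z t : koz n V) : ((x, y) : koz n.+1 V) - (z, t) = (x - z, y - t) by [].
have pZ q (x y : koz n V) : q *: ((x, y) : koz n.+1 V) = (q *: x, q *: y) by [].
pose f' k := f k.+1; pose r' k := rho k.+1; set s := \sum_(k < n) _.
have dN (x : koz n V) : kd f' (- x) = - kd f' x by apply: linearN.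
have e1 : kcon r' (kd f' a) + rho 0%N *: (f 0%N *: a - kd f' b) =
    (rho 0%N * f 0%N + s) *: a - kd f' (kcon r' a + rho 0%N *: b).
  rewrite IH -/s scalerBr scalerA kdD kdZ scalerDl opprD addrACA.
  by rewrite [X in X + _ = _]addrC.
have e2 : - kcon r' (f 0%N *: a - kd f' b) =
    (rho 0%N * f 0%N + s) *: b - (f 0%N *: (kcon r' a + rho 0%N *: b) + kd f' (kcon r' b)).
  rewrite kconB kconZ IH -/s scalerDl scalerDr scalerA [f 0%N * _]mulrC.
  exact: zmod_alg.
transitivity ((kcon r' (kd f' a) + rho 0%N *: (f 0%N *: a - kd f' b),
  - kcon r' (f 0%N *: a - kd f' b)) : koz n.+1 V); first by [].
rewrite e1 e2 -[kd f' (kcon r' b)]opprK -(dN (kcon r' b)) -pB -pZ.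
by congr (_ - _).
Qed.

Lemma kcon_deg n rho p (c : koz n V) : kdeg p c -> pdeg p (kcon rho c).
Proof.
elim: n rho p c => [|n IH] rho p c /=; first by move=> _; apply: pdeg0.
case: c => a b /= [da db]; have := IH (fun k => rho k.+1) p a da.
case: p da db => [|p] /= da db; first by move=> ->; rewrite db scaler0 kcon0 addr0 oppr0.
move=> h; split; first by apply: kdegD => //; apply: kdegZ.
have := IH (fun k => rho k.+1) p b db; rewrite -scaleN1r.
by case: p {da db h} => [->|p h]; [rewrite scaler0|apply: kdegZ].
Qed.

End Contraction.

Section Exterior.
Variable R : comNzRingType.

Lemma kd_f0 n (V : lmodType R) f (c : koz n V) : (forall k, (k < n)%N -> f k = 0) -> kd f c = 0.
Proof.
move=> h; rewrite (@kd_eqf _ _ n f (fun k => 0 * f k)); last by move=> k kn; rewrite h ?mulr0.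
by rewrite kd_scalef scale0r.
Qed.

Lemma kd_sumf n (V : lmodType R) m (F : nat -> nat -> R) (b : nat -> R) (c : koz n V) :
  kd (fun k => \sum_(j < m) b j * F j k) c = \sum_(j < m) b j *: kd (F j) c.
Proof.
elim: m => [|m IH].
  by rewrite big_ord0 kd_f0 // => k _; rewrite big_ord0.
rewrite big_ord_recr /= -IH -kd_scalef -kd_addf; apply: kd_eqf => k _.
by rewrite big_ord_recr.
Qed.

(* The exterior power of the linear map with matrix z, on row vectors. *)
Fixpoint kext l r (z : nat -> nat -> R) : koz r R^o -> koz l R^o :=
  match r return koz r R^o -> koz l R^o with
  | 0 => fun c => (c : R) *: kone R l
  | r'.+1 => fun c => @kext l r' (fun k => z k.+1) c.1
      + kd (z 0%N) (@kext l r' (fun k => z k.+1) c.2)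
  end.

Lemma kext_lin l r z s (c d : koz r R^o) :
  kext l z (s *: c + d) = s *: kext l z c + kext l z d.
Proof.
elim: r z c d => [|r IH] z c d /=; first by rewrite scalerDl scalerA.
by rewrite !IH kd_lin scalerDr addrACA.
Qed.

Lemma kext0 l r z : kext l z (0 : koz r R^o) = 0.
Proof. by have := kext_lin l z (-1) (0 : koz r R^o) 0; rewrite scaler0 addr0 scaleN1r addNr. Qed.
Lemma kextZ l r z s (c : koz r R^o) : kext l z (s *: c) = s *: kext l z c.
Proof. by rewrite -[s *: c]addr0 kext_lin kext0 addr0. Qed.
Lemma kextD l r z (c d : koz r R^o) : kext l z (c + d) = kext l z c + kext l z d.
Proof. by rewrite -[c]scale1r kext_lin !scale1r. Qed.
Lemma kextB l r z (c d : koz r R^o) : kext l z (c - d) = kext l z c - kext l z d.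
Proof. by rewrite addrC -scaleN1r kext_lin scaleN1r addrC. Qed.

Lemma kext_kone l r z : kext l z (kone R r) = kone R l.
Proof.
elim: r z => [|r IH] z /=; first by rewrite scale1r.
by rewrite IH kext0 linear0 addr0.
Qed.

Lemma kdeg_kext l r z p (c : koz r R^o) : kdeg p c -> kdeg p (kext l z c).
Proof.
elim: r z p c => [|r IH] z p c /=.
  by case=> [->|->]; [apply: kdegZ; apply: kdeg_kone|rewrite scale0r; apply: kdeg0].
move=> [d1 d2]; apply: kdegD; first exact: IH.
case: p d2 {d1} => [->|p d2]; first by rewrite kext0 linear0; apply: kdeg0.
by apply: kdeg_kd; apply: IH.
Qed.

Lemma kext_kd l r z f (c : koz r R^o) :
  kext l z (kd f c) = kd (fun j => \sum_(k < r) f k * z k j) (kext l z c).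
Proof.
elim: r z f c => [|r IH] z f c /=.
  by rewrite scale0r kd_f0 // => k _; rewrite big_ord0.
rewrite IH kextB kextZ IH kdB kdZ kdD.
have E (x : koz l R^o) : kd (fun j => \sum_(k < r.+1) f k * z k j) x =
    f 0%N *: kd (z 0%N) x + kd (fun j => \sum_(k < r) f k.+1 * z k.+1 j) x.
  rewrite -kd_scalef -kd_addf; apply: kd_eqf => k _; exact: big_ord_recl.
rewrite !E kd_dd scaler0 add0r [kd (z 0%N) (kd _ _)]kd_anti opprK.
by rewrite addrCA addrA.
Qed.

Lemma kext_eq l r z z' (c : koz r R^o) :
  (forall k j, (k < r)%N -> (j < l)%N -> z k j = z' k j) -> kext l z c = kext l z' c.
Proof.
elim: r z z' c => [|r IH] z z' c //= h.
rewrite !(IH _ (fun k => z' k.+1)); [|by move=> k j kr; apply: h..].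
by congr (_ + _); apply: kd_eqf => j jl; apply: h.
Qed.

Lemma kext_comp m l r z z' (c : koz r R^o) :
  kext m z' (kext l z c) = kext m (fun k j => \sum_(i < l) z k i * z' i j) c.
Proof.
elim: r z c => [|r IH] z c /=; first by rewrite kextZ kext_kone.
by rewrite kextD kext_kd !IH.
Qed.

(** The exterior algebra is spanned by products of 1-forms. This induction suits [kext], which is
    controlled through its effect on a product with a 1-form. *)
Lemma koz_ind r (P : nat -> koz r R^o -> Prop) : (forall p, submod (P p)) ->
  P 0%N (kone R r) -> (forall p u c, P p c -> P p.+1 (kd u c)) ->
  forall p c, kdeg p c -> P p c.
Proof.
elim: r P => [|r IH] P sP P1 PS p c.
  move=> [->|->]; last by case: (sP p).
  by have := submodZ (c : R) (sP 0%N) P1; rewrite /GRing.scale /= mulr1.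
case: c => a b /= [da db].
have incl q x : kdeg q x -> P q (x, 0).
  move: q x; apply: IH => [q|//|q u x].
    split; first by case: (sP q).
    move=> s x y hx hy; have := (sP q).2 s _ _ hx hy.
    by rewrite -[s *: (x, 0) + _]/(_, _) /= scaler0 addr0.
  move=> /(PS q (fun k => if k is k'.+1 then u k' else 0)) /=.
  by rewrite scale0r linear0 subr0.
have -> : ((a, b) : koz r.+1 R^o) = (a, 0) + (0, b).
  by rewrite -[RHS]/(_, _) /= addr0 add0r.
apply: submodD => //; first exact: incl.
case: p da db => [|p] da db; first by rewrite db; case: (sP 0%N).
have := PS p (fun k => if k is 0 then 1 else 0) _ (incl p b db).
by rewrite /= scale1r linear0 subr0 kd_f0.
Qed.

Lemma kext_diag r z g p (c : koz r R^o) :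
  (forall k j, (k < r)%N -> (j < r)%N -> z k j = g *+ (k == j)) -> kdeg p c ->
  kext r z c = g ^+ p *: c.
Proof.
move=> hz; move: p c; apply: koz_ind => [p||p u c e].
- split=> [|s x y hx hy]; first by rewrite kext0 scaler0.
  by rewrite kext_lin hx hy scalerDr !scalerA mulrC.
- by rewrite kext_kone scale1r.
rewrite kext_kd e kdZ (@kd_eqf _ _ r _ (fun j => g * u j)).
  by rewrite kd_scalef scalerA -exprSr.
move=> j jr; rewrite (bigD1 (Ordinal jr)) //= hz // eqxx mulr1n big1; first by rewrite addr0 mulrC.
by move=> i; rewrite -val_eqE /= => /negPf ij; rewrite hz // ij mulr0n mulr0.
Qed.

Lemma kext_scale l r z g p (c : koz r R^o) : kdeg p c ->
  kext l (fun k j => g * z k j) c = g ^+ p *: kext l z c.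
Proof.
move: p c; apply: koz_ind => [p||p u c e].
- split=> [|s x y hx hy]; first by rewrite !kext0 scaler0.
  by rewrite !kext_lin hx hy scalerDr !scalerA mulrC.
- by rewrite !kext_kone scale1r.
rewrite !kext_kd e kdZ (@kd_eqf _ _ l _ (fun j => g * \sum_(k < r) u k * z k j)).
  by rewrite kd_scalef scalerA -exprSr.
by move=> j _; rewrite mulr_sumr; apply: eq_bigr => k _; rewrite mulrCA.
Qed.

End Exterior.

Section Wedges.
Variables (R : comNzRingType) (r : nat) (v : nat -> nat -> R).

(* (v_0, ..., v_(k-1)) /\ Lambda^(p-1) inside Lambda^p. *)
Definition Uk k p (c : koz r R^o) : Prop :=
  exists w : nat -> koz r R^o, (forall j, pdeg p (w j)) /\ c = \sum_(j < k) kd (v j) (w j).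

Lemma Uk_submod k p : submod (Uk k p).
Proof.
split.
  by exists (fun=> 0); split=> [j|]; [apply: pdeg0|rewrite big1 // => j _; rewrite linear0].
move=> a x y [w [wd ->]] [z [zd ->]]; exists (fun j => a *: w j + z j); split.
  by move=> j; apply: pdeg_lin.
by rewrite scaler_sumr -big_split; apply: eq_bigr => j _; rewrite /= kd_lin.
Qed.

Lemma Uk_kdeg k p c : Uk k p c -> kdeg p c.
Proof.
move=> [w [wd ->]]; elim/big_ind: _ => [|x y|j _]; [exact: kdeg0|exact: kdegD|].
exact: pdeg_kd.
Qed.

Lemma Uk_kd k p u c : Uk k p c -> Uk k p.+1 (kd u c).
Proof.
move=> [w [wd ->]]; exists (fun j => - kd u (w j)); split.
  by move=> j; rewrite -scaleN1r; apply: kdegZ; apply: pdeg_kd.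
by rewrite linear_sum; apply: eq_bigr => j _; rewrite /= kd_anti linearN.
Qed.

Lemma Uk_succ k p c : Uk k.+1 p c <-> exists x w, [/\ Uk k p x, pdeg p w & c = x + kd (v k) w].
Proof.
split=> [[w [wd ->]]|[x [w [[z [zd ->]] wd ->]]]].
  by exists (\sum_(j < k) kd (v j) (w j)), (w k); split=> //; [exists w|rewrite big_ord_recr].
exists (fun j => if (j < k)%N then z j else w); split=> [j|]; first by case: ifP.
rewrite big_ord_recr /= ltnn; congr (_ + _); apply: eq_bigr => j _.
by rewrite ltn_ord.
Qed.

Lemma Uk_mem k p j w : (j < k)%N -> pdeg p w -> Uk k p (kd (v j) w).
Proof.
move=> jk wd; exists (fun i => if i == j then w else 0); split.
  by move=> i; case: eqP => _ //; apply: pdeg0.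
rewrite (bigD1 (Ordinal jk)) //= eqxx big1 ?addr0 // => i.
by rewrite -val_eqE /= => /negPf ->; rewrite linear0.
Qed.

Lemma Uk_weak k p c : Uk k p c -> Uk k.+1 p c.
Proof. by move=> cU; apply/Uk_succ; exists c, 0; rewrite linear0 addr0; split=> //; apply: pdeg0. Qed.

Lemma Uk0 p c : Uk 0 p c -> c = 0.
Proof. by move=> [w [_ ->]]; rewrite big_ord0. Qed.

Lemma Uk_deg0 k c : Uk k 0 c -> c = 0.
Proof. by move=> [w [wd ->]]; rewrite big1 // => j _; rewrite (wd j) linear0. Qed.

Variables (s n : nat) (f : nat -> R).
Hypothesis gf : good f n n.
(* Up to f i, the v_j are part of a basis. *)
Hypothesis dual : forall i, (i < n)%N -> exists rho : nat -> nat -> R,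
  forall j k, (j < s)%N -> (k < s)%N -> \sum_(m < r) rho j m * v k m = f i *+ (j == k).

(** If v_k /\ w lies in U_k, contraction with the dual vector rho_k puts f_i w into U_(k+1) for
    every i, and [Hvan_extend] removes the factors f_i. *)
Lemma Uk_colon k p w : (k < s)%N -> (p < n)%N -> Hvan f n 1 (Uk k.+1 p) ->
  kdeg p w -> Uk k p.+1 (kd (v k) w) -> Uk k.+1 p w.
Proof.
move=> ks pn hv wd; move=> [z [zd kw]].
have sk : submod (fun c : koz r R^o => kdeg p c) by split; [apply: kdeg0|apply: kdeg_lin].
apply: (@Hvan_extend _ _ f n _ _ w sk (Uk_submod _ _) (@Uk_kdeg k.+1 p) wd _ _ hv); last first.
  by apply: Hvan_kdeg; apply: gf; apply: leq_ltn_trans pn.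
move=> i i_n; have [rho rhoE] := dual i_n.
have := kcon_kd (rho k) (v k) w; rewrite rhoE // eqxx mulr1n => e.
have -> : f i *: w = kcon (rho k) (kd (v k) w) + kd (v k) (kcon (rho k) w) by rewrite e subrK.
apply: submodD; first exact: Uk_submod; last by apply: Uk_mem => //; apply: kcon_deg.
apply: Uk_weak; rewrite kw kcon_sum; refine (@submod_sum _ _ (Uk k p) 'I_k _ xpredT
  (fun j => kcon (rho k) (kd (v j) (z j))) (Uk_submod _ _) _) => j _.
have js : (j < s)%N by apply: ltn_trans (ltn_ord j) ks.
rewrite kcon_kd rhoE // (_ : (k == j) = false) ?mulr0n ?scale0r ?sub0r; last first.
  by apply/negbTE; rewrite neq_ltn ltn_ord orbT.
apply: submodN; first exact: Uk_submod.
by apply: Uk_mem (ltn_ord j) _; apply: kcon_deg; apply: (zd j).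
Qed.

(* Induction along 0 -> U_(k+1)^(p-1) -> U_k^p + Lambda^(p-1) -> U_(k+1)^p -> 0. *)
Lemma Hvan_Uk p : (p <= n)%N -> forall k, (k <= s)%N -> forall h m G, good h m G ->
  forall p', (p' + p <= G)%N -> Hvan h m p' (Uk k p).
Proof.
elim: p => [|p IHp] pn k ks h m G gh p' pG.
  by apply: Hvan_zero; [apply: Uk_submod|apply: Uk_deg0].
elim: k ks p' pG => [|k IHk] ks p' pG.
  by apply: Hvan_zero; [apply: Uk_submod|apply: Uk0].
pose phi (x : (koz r R^o * koz r R^o)%type) : koz r R^o := x.1 + kd (v k) x.2.
pose U (x : (koz r R^o * koz r R^o)%type) := Uk k p.+1 x.1 /\ kdeg p x.2.
have sk : submod (fun c : koz r R^o => kdeg p c) by split; [apply: kdeg0|apply: kdeg_lin].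
have sU : submod U.
  split; first by split; [case: (Uk_submod k p.+1)|apply: kdeg0].
  by move=> a x y [x1 x2] [y1 y2]; split; [apply: (Uk_submod k p.+1).2|apply: kdeg_lin].
apply: (@Hvan_coker _ _ _ _ m h h U (Uk k.+1 p.+1) phi sU _ _ _ _ p').
- by move=> x y _ _; rewrite /phi /= kdB opprD addrACA.
- by move=> i x _ _; rewrite /phi /= kdZ scalerDr.
- by move=> c /Uk_succ[x [w [xU wd ->]]]; exists (x, w).
- by move=> [x w] [xU wd]; apply/Uk_succ; exists x, w.
- apply: Hvan_prod; [exact: Uk_submod|exact: sk|apply: IHk => //; exact: ltnW|].
  by apply: Hvan_kdeg; apply: gh; lia.
apply: (@Hvan_iso _ _ _ _ m h h (Uk k.+1 p) (kker U phi)
  (fun w => (- kd (v k) w, w) : (koz r R^o * koz r R^o)%type)).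
- exact: Uk_submod.
- by move=> x y _ _; rewrite kdB opprD.
- by move=> i u _ _; rewrite kdZ -scalerN.
- move=> [x w] [[/= xU wd]]; rewrite /phi /= => /eqP; rewrite addr_eq0 => /eqP xE.
  exists w; last by rewrite xE.
  apply: Uk_colon => //; first exact: (IHp (ltnW pn) k.+1 ks f n n gf 1%N pn).
  by rewrite -[kd _ w]opprK -xE; apply: submodN; [apply: Uk_submod|].
- move=> w /[dup] wU /Uk_kdeg wd; split; last by rewrite /phi /= addNr.
  split=> //=; have [x [z [xU zd wE]]] := (Uk_succ k p w).1 wU.
  apply: submodN; first exact: Uk_submod.
  by rewrite wE kdD kd_dd addr0; apply: Uk_kd.
- by move=> w _ /(congr1 snd).
by apply: (IHp (ltnW pn) k.+1 ks h m G gh); lia.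
Qed.

End Wedges.

Section MatrixFunctions.
Variable R : comNzRingType.

Definition mxf r l (M : 'M[R]_(r, l)) (k : nat) : nat -> R :=
  natf (fun j => natf (fun i => M i j) k).

Lemma mxfE r l (M : 'M[R]_(r, l)) (i : 'I_r) (j : 'I_l) : mxf M i j = M i j.
Proof. by rewrite /mxf !natfE. Qed.

Lemma mxf_lt r l (M : 'M[R]_(r, l)) k j (kr : (k < r)%N) (jl : (j < l)%N) :
  mxf M k j = M (Ordinal kr) (Ordinal jl).
Proof. exact: (mxfE M (Ordinal kr) (Ordinal jl)). Qed.

Lemma kext_mul m l r (A : 'M[R]_(r, l)) (B : 'M[R]_(l, m)) (c : koz r R^o) :
  kext m (mxf B) (kext l (mxf A) c) = kext m (mxf (A *m B)) c.
Proof.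
rewrite kext_comp; apply: kext_eq => k j kr jm; rewrite (mxf_lt _ kr jm) mxE.
by apply: eq_bigr => i _; rewrite (mxf_lt _ kr (ltn_ord i)) (mxf_lt _ (ltn_ord i) jm); congr (A _ _ * B _ _); apply: val_inj.
Qed.

Lemma kext_scalar r (g : R) p (c : koz r R^o) : kdeg p c -> kext r (mxf (g%:M : 'M_r)) c = g ^+ p *: c.
Proof. by apply: kext_diag => k j kr jr; rewrite (mxf_lt _ kr jr) mxE -val_eqE. Qed.

Lemma kext_scalemx r l g (A : 'M[R]_(r, l)) p (c : koz r R^o) : kdeg p c ->
  kext l (mxf (g *: A)) c = g ^+ p *: kext l (mxf A) c.
Proof.
move=> cd; rewrite -(kext_scale _ _ _ cd); apply: kext_eq => k j kr jl.
by rewrite !(mxf_lt _ kr jl) mxE.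
Qed.

Lemma kext_kd_mx r l (A : 'M[R]_(r, l)) u (c : koz r R^o) :
  kext l (mxf A) (kd u c) = kd (natf (fun j => ((\row_(i < r) u i) *m A) 0 j)) (kext l (mxf A) c).
Proof.
rewrite kext_kd; apply: kd_eqf => j jl; rewrite natf_lt mxE.
by apply: eq_bigr => i _; rewrite mxE (mxf_lt _ (ltn_ord i) jl); congr (_ * A _ _); apply: val_inj.
Qed.

Lemma kd_natf_lin (V : lmodType R) n g (u v : 'rV[R]_n) (c : koz n V) :
  kd (natf (fun i => (g *: u + v) 0 i)) c = g *: kd (natf (fun i => u 0 i)) c + kd (natf (fun i => v 0 i)) c.
Proof.
rewrite -kd_scalef -kd_addf; apply: kd_eqf => k kn.
by rewrite !natf_lt !mxE.
Qed.

Lemma kd_natf_comb (V : lmodType R) n a b (u v : 'rV[R]_n) (c : koz n V) :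
  kd (natf (fun i => (a *: u + b *: v) 0 i)) c =
  a *: kd (natf (fun i => u 0 i)) c + b *: kd (natf (fun i => v 0 i)) c.
Proof.
rewrite kd_natf_lin; congr (_ + _); rewrite -kd_scalef; apply: kd_eqf => k kn.
by rewrite !natf_lt mxE.
Qed.

End MatrixFunctions.

Lemma wedge_alg (R : idomainType) l (q a s c : R) (da e k : nat -> R) (z xi y : koz l R^o) :
  a != 0 -> q = a * s -> kd da z = a *: y -> kd e z = q *: xi ->
  (forall x : koz l R^o, kd e x = c *: kd da x + a *: kd k x) ->
  s *: kd da xi = a *: kd k (- y).
Proof.
move=> a0 qE yE xE eE; apply/eqP; rewrite -subr_eq0; apply/eqP; apply: (koz_regular a0).
have kN (x : koz l R^o) : kd k (- x) = - kd k x by apply: linearN.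
rewrite scalerBr scalerA -qE -kdZ -xE eE kdD !kdZ kd_dd scaler0 add0r kd_anti yE kdZ kN.
by rewrite !scalerN subrr.
Qed.

(** * Products of logarithmic forms *)

Section WedgeClosure.
Variables (K : fieldType) (l : nat).
Local Notation S := {mpoly K[l]}.
Local Notation vsp := {vspace 'rV[K]_l}.
Local Notation Q A := (defpoly A (fun=> 1%N)).
Local Notation wd eta := (natf (fun i => (eta : 'rV[S]_l) 0 i)).
Variables (A : {fset vsp}).
Hypothesis hA : is_arrangement A.
Local Notation Ulog p := (Ulog A (fun=> 1%N) p).

Lemma acoefE c : @kd S S^o l (acoef c) = kd (wd (dl c)).
Proof. by apply: functional_extensionality_dep => z; apply: kd_eqf => k kl; rewrite /acoef !natf_lt mxE. Qed.

Lemma U1_dlog L eta : L \in A -> U1 A eta ->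
  exists c kap, eta = c *: dl (alpha_coef L) + alpha L *: kap.
Proof.
move=> LA eU; have hL := hA LA.
have [|kap kE] := @ev_all_dvd K l (alpha L) (eta - ev eta (hz hL) *: dl (alpha_coef L)).
  move=> v; rewrite addrC -scaleNr evDl evZl ev_dl.
  have -> : - ev eta (hz hL) * (pair v (alpha_coef L))%:MP + ev eta v = ev eta (v - pair v (alpha_coef L) *: hz hL).
    by rewrite -scaleNr evD evZ addrC scaleNr -mul_mpolyC mulNr mulrC.
  apply: eU => //; rewrite (mem_hpair hL) pairBl pairZl hzP mulr1 subrr //.
by exists (ev eta (hz hL)), kap; rewrite -kE addrC subrK.
Qed.

Lemma alpha_dvd_prod L (s : seq vsp) x : is_hyperplane L ->
  (forall M, M \in s -> is_hyperplane M /\ M != L) ->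
  mdvd (alpha L) ((\prod_(M <- s) alpha M ^+ 1) * x) -> mdvd (alpha L) x.
Proof.
move=> hL; elim: s => [|M s IH] hs; first by rewrite big_nil mul1r.
have [hM ML] := hs M (mem_head _ _); rewrite big_cons expr1 -mulrA eq_sym in ML *.
move/(alpha_dvd_mull hM hL ML); apply: IH => N Ns.
by apply: hs; rewrite inE Ns orbT.
Qed.

(** Near L the numerator eta is c d alpha_L modulo alpha_L, and alpha_L divides d alpha_L /\ z. Thus
    of the two denominators Q(A) in a product of logarithmic forms one cancels. *)
Lemma wedge_Ulog p eta (z : koz l S^o) : U1 A eta -> Ulog p z ->
  exists2 xi, Ulog p.+1 xi & kd (wd eta) z = Q A *: xi.
Proof.
move=> eU [zd zA]; have wdd : kdeg p.+1 (kd (wd eta) z) by apply: kdeg_kd.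
have [xi xd xE] : exists2 xi : koz l S^o, kdeg p.+1 xi & kd (wd eta) z = Q A *: xi.
  apply: kin_mdvd_lift => //; apply/kin_kget => J; apply: defpoly_dvd => // L LA.
  have [c [kap eE]] := U1_dlog LA eU.
  have := zA L LA; rewrite expr1 acoefE => /kin_kget/(_ J) h.
  rewrite eE kd_natf_comb kgetD !kgetZ; apply: mdvdD; first exact: mdvdMl.
  by eexists; reflexivity.
exists xi => //; split=> // L LA; rewrite expr1 acoefE.
have [c [kap eE]] := U1_dlog LA eU.
have := zA L LA; rewrite expr1 acoefE => h.
have [y yd yE] := kin_mdvd_lift (kdeg_kd _ zd) h.
have eE' (x : koz l S^o) : kd (wd eta) x = c *: kd (wd (dl (alpha_coef L))) x + alpha L *: kd (wd kap) x.
  by rewrite eE; apply: kd_natf_comb.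
have e := wedge_alg (alpha_neq0' (hA LA)) (defpolyD1 LA) yE xE eE'.
apply/kin_kget => J; have := congr1 (fun x => kget x J) e; rewrite !kgetZ => eJ.
apply: (@alpha_dvd_prod L (A `\ L)); first exact: hA.
  by move=> M /fsetD1P[ML MA]; split=> //; apply: hA.
by exists (kget (kd (wd kap) (- y)) J); apply: eJ.
Qed.

Variables (r : nat) (Um : 'M[S]_(r, l)).
Hypothesis UmU : forall i, U1 A (row i Um).

Lemma kext_Ulog p (c : koz r S^o) : kdeg p.+1 c ->
  exists2 z, Ulog p.+1 z & kext l (mxf Um) c = Q A ^+ p *: z.
Proof.
(* Degree 0 is set apart, since the exponent of Q(A) would be -1 there. *)
pose P q (c : koz r S^o) := if q is p.+1 then exists2 z, Ulog p.+1 z & kext l (mxf Um) c = Q A ^+ p *: z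
  else kdeg 0 c.
move=> cd; apply: (@koz_ind S r P _ _ _ p.+1 c cd) => [[|q]||[|q] u x hx].
- by split; [apply: kdeg0|apply: kdeg_lin].
- split; first by exists 0; [case: (Ulog_submod A (fun=> 1%N) q.+1)|rewrite kext0 scaler0].
  move=> s x y [z zU ze] [t tU te]; exists (s *: z + t); first exact: (Ulog_submod A (fun=> 1%N) q.+1).2.
  by rewrite kext_lin ze te scalerDr !scalerA mulrC.
- exact: kdeg_kone.
- have [s ->] := kdeg0E hx; rewrite /P kext_kd_mx kextZ kext_kone kdZ.
  set eta := _ *m Um; have eU : U1 A eta by apply: U1_mulmx.
  exists (s *: kvec eta); last by rewrite expr0 scale1r.
  apply: (submodZ _ (Ulog_submod A (fun=> 1%N) 1)).
  by apply/Ulog_kvec => //; apply/U1E.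
- have [z zU zE] := hx; rewrite /P kext_kd_mx zE.
  set eta := _ *m Um; have eU : U1 A eta by apply: U1_mulmx.
  have [xi xiU xiE] := wedge_Ulog eU zU; exists xi => //.
  by rewrite kdZ xiE scalerA -exprSr.
Qed.

End WedgeClosure.

(** * Exterior powers of a presentation that splits up to a multiplier *)

Section LocalSplitting.
Variable R : idomainType.

(** With rho(a) = 1 one has z = al (rho contracted with y) + a /\ (rho contracted with z), and T
    sends a to a multiple of al. *)
Lemma kext_dvd l k (T : 'M[R]_(l, k)) (a : 'rV[R]_l) (rho : nat -> R) al (y z : koz l R^o) c0 :
  kd (natf (fun i => a 0 i)) z = al *: y ->
  \sum_(m < l) rho m * natf (fun i => a 0 i) m = 1 -> a *m T = al *: c0 ->
  exists x, @kext R k l (mxf T) z = al *: x.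
Proof.
move=> yE r1 aT; set da := natf _ in yE r1.
have zE : z = al *: kcon rho y + kd da (kcon rho z).
  by rewrite -kconZ -yE kcon_kd r1 scale1r subrK.
rewrite zE kextD kextZ kext_kd_mx.
have -> : (\row_(i < l) da i) = a by apply/rowP => i; rewrite mxE /da natfE.
rewrite aT -[al *: c0]addr0 kd_natf_lin.
exists (kext k (mxf T) (kcon rho y) + kd (natf (fun i => c0 0 i)) (kext k (mxf T) (kcon rho z))).
rewrite scalerDr; congr (_ + _); rewrite [X in _ + X]kd_f0 ?addr0 // => m mk.
by rewrite natf_lt mxE.
Qed.

Variables (r s k l : nat) (C : 'M[R]_(r, k)) (D : 'M[R]_(k, r)) (B : 'M[R]_(r, s))
  (Vm : 'M[R]_(s, r)) (g : R).
Hypothesis split1 : g%:M = C *m D + B *m Vm.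

Lemma kd_rowmul (b : 'rV[R]_s) p (y : koz r R^o) : kdeg p y ->
  Uk (mxf Vm) s p.+1 (kd (natf (fun j => (b *m Vm) 0 j)) y).
Proof.
move=> yd; exists (fun j => (natf (fun i => b 0 i) j) *: y); split; first by move=> j; apply: kdegZ.
rewrite (@kd_eqf _ _ r _ (fun m => \sum_(j < s) (natf (fun i => b 0 i) j) * mxf Vm j m)).
  by rewrite kd_sumf; apply: eq_bigr => j _; rewrite kdZ.
move=> m mr; rewrite natf_lt mxE; apply: eq_bigr => j _; rewrite natfE.
by rewrite (mxf_lt _ (ltn_ord j) mr); congr (_ * Vm _ _); apply: val_inj.
Qed.

(** Modulo the rows of [Vm], multiplication by g is the map C D; the exterior powers of both maps
    then agree modulo the submodule generated by these rows. *)
Lemma kext_split p (c : koz r R^o) : kdeg p c ->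
  Uk (mxf Vm) s p (g ^+ p *: c - kext r (mxf (C *m D)) c).
Proof.
move=> cd; suff [] : kdeg p c /\ Uk (mxf Vm) s p (g ^+ p *: c - kext r (mxf (C *m D)) c) by [].
move: p c cd; apply: koz_ind => [p||p u c [cd cU]].
- split; first by split; [apply: kdeg0|rewrite scaler0 kext0 subr0; case: (Uk_submod r (mxf Vm) s p)].
  move=> a x y [xd xU] [yd yU]; split; first exact: kdeg_lin.
  rewrite kext_lin scalerDr opprD addrACA scalerA mulrC -scalerA -scalerBr.
  exact: (Uk_submod r (mxf Vm) s p).2.
- split; first exact: kdeg_kone.
  by rewrite kext_kone scale1r subrr; case: (Uk_submod r (mxf Vm) s 0).
split; first exact: kdeg_kd.
set X := kext r (mxf (C *m D)) in cU *; set ur : 'rV[R]_r := \row_i u i.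
have gu (y : koz r R^o) : g *: kd u y = kd (natf (fun j => (ur *m (C *m D)) 0 j)) y
    + kd (natf (fun j => (ur *m B *m Vm) 0 j)) y.
  rewrite -kd_scalef -kd_addf; apply: kd_eqf => j jr; rewrite !natf_lt.
  have e : g *: ur = ur *m (C *m D) + ur *m B *m Vm.
    by rewrite -[X in _ + X]mulmxA -mulmxDr -split1 mul_mx_scalar.
  have <- : (g *: ur) 0 (Ordinal jr) = g * u j by rewrite !mxE.
  by rewrite e [LHS]mxE.
have -> : g ^+ p.+1 *: kd u c - X (kd u c) =
    g *: kd u (g ^+ p *: c - X c) + kd (natf (fun j => (ur *m B *m Vm) 0 j)) (X c).
  have XE : X (kd u c) = kd (natf (fun j => (ur *m (C *m D)) 0 j)) (X c) by apply: kext_kd_mx.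
  rewrite XE kdB scalerBr [g *: kd u (X c)]gu kdZ scalerA -exprS opprD addrA.
  by rewrite subrK.
apply: submodD; first exact: Uk_submod.
  by apply: submodZ; [apply: Uk_submod|apply: Uk_kd].
by apply: kd_rowmul; apply: kdeg_kext.
Qed.

Variables (Um : 'M[R]_(r, l)) (N : 'M[R]_(k, l)) (T : 'M[R]_(l, k)) (q : R).
Hypotheses (UmE : Um = C *m N) (NT : N *m T = q%:M) (TN : T *m N = q%:M) (DU : D *m Um = g *: N).
Hypothesis q0 : q != 0.

Lemma kext_kernel p (c : koz r R^o) : kdeg p c -> kext l (mxf Um) c = 0 ->
  Uk (mxf Vm) s p (g ^+ p *: c).
Proof.
move=> cd c0; have C0 : kext k (mxf C) c = 0.
  apply: (koz_regular (expf_neq0 p q0)).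
  rewrite -(kext_scalar _ (kdeg_kext _ _ cd)) -NT -(kext_mul N T).
  by rewrite [kext l _ _]kext_mul -UmE c0 kext0.
have := kext_split cd; rewrite -[kext r _ c]kext_mul C0 kext0 subr0.
exact.
Qed.

Lemma kext_local p (z : koz l R^o) y : kdeg p.+1 z -> @kext R k l (mxf T) z = q *: y ->
  exists2 c : koz r R^o, kdeg p.+1 c & kext l (mxf Um) c = (g ^+ p.+1 * q ^+ p) *: z.
Proof.
move=> zd zE; have yd : kdeg p.+1 y.
  apply/kdeg_kget => J Jp; apply: (mulfI q0); rewrite mulr0.
  have /kdeg_kget/(_ J Jp) := kdeg_kext k (mxf T) zd.
  by rewrite zE kgetZ.
exists (kext r (mxf D) y); first exact: kdeg_kext.
rewrite kext_mul DU (kext_scalemx _ _ yd) -scalerA; congr (_ *: _).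
apply/eqP; rewrite -subr_eq0; apply/eqP; apply: (koz_regular q0).
rewrite scalerBr -kextZ -zE kext_mul TN (kext_scalar _ zd) scalerA -exprS.
exact: subrr.
Qed.

End LocalSplitting.

Section LocalData.
Variables (K : fieldType) (l : nat).
Local Notation S := {mpoly K[l]}.
Local Notation vsp := {vspace 'rV[K]_l}.
Local Notation Q A := (defpoly A (fun=> 1%N)).
Variables (A : {fset vsp}).
Hypothesis hA : is_arrangement A.
Local Notation Ulog p := (Ulog A (fun=> 1%N) p).
Variables (r s : nat) (Um : 'M[S]_(r, l)) (Vm : 'M[S]_(s, r)).
Hypotheses (UmU : forall i, U1 A (row i Um)) (Umgen : forall eta, U1 A eta -> exists c, eta = c *m Um).
Hypotheses (VU : Vm *m Um = 0) (Vgen : forall c : 'rV_r, c *m Um = 0 -> exists b, c = b *m Vm)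
  (Vfree : forall b : 'rV_s, b *m Vm = 0 -> b = 0).
Variable x : 'rV[K]_l.
Hypothesis fx : arr_free (localization A x).
Local Notation g := (offprod A x).
Local Notation Ax := (localization A x).

Lemma Q_loc : Q A = g * Q Ax.
Proof.
have e (B : {fset vsp}) : Q B = \prod_(L <- B) alpha L by apply: eq_bigr => L _; apply: expr1.
rewrite !e [LHS](bigID (fun L : vsp => x \notin L)) /=; congr (_ * _).
rewrite -big_filter; apply: perm_big; apply: uniq_perm => [||L].
- by rewrite filter_uniq ?fset_uniq.
- exact: fset_uniq.
by rewrite mem_filter negbK andbC; apply/andP/locP.
Qed.

(** The generators of U1(A) are logarithmic along A_x, which gives C; multiples of the basis of A_x
    by g are logarithmic along A, which gives D. Then D C = g, and g - C D maps into the relations,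
    which gives B. Freeness of the relations turns this into V B = g. *)
Lemma local_split : exists k (N : 'M[S]_(k, l)) (T : 'M[S]_(l, k)) (C : 'M[S]_(r, k))
    (D : 'M[S]_(k, r)) (B : 'M[S]_(r, s)),
  [/\ g%:M = C *m D + B *m Vm, Vm *m B = g%:M, Um = C *m N & D *m Um = g *: N] /\
  [/\ N *m T = (Q Ax)%:M, T *m N = (Q Ax)%:M &
    forall L, L \in Ax -> exists c, dl (alpha_coef L) *m T = alpha L *: c].
Proof.
have [k [N [T [NU TN NT span]]]] := arr_free_data (loc_arr x hA) fx.
have Q0 : Q Ax != 0 by apply: defpoly_neq0 (loc_arr x hA).
have Ninj m (M : 'M[S]_(m, k)) : M *m N = 0 -> M = 0.
  move=> e; apply/row_matrixP => i; rewrite row0; apply: (rV_scale_inj Q0).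
  by rewrite -mul_mx_scalar -NT mulmxA -row_mul e row0 mul0mx.
have /choice[c cE] : forall i, exists c, row i Um = c *m N.
  by move=> i; apply: span => L /locP[LA _]; apply: UmU.
have /choice[d dE] : forall i, exists d, g *: row i N = d *m Um.
  by move=> i; apply: Umgen; apply: off_U1 => //; apply: NU.
pose C := \matrix_i c i; pose D := \matrix_i d i.
have UE : Um = C *m N by apply/row_matrixP => i; rewrite row_mul rowK.
have DE : D *m Um = g *: N.
  by apply/row_matrixP => i; rewrite row_mul rowK -dE; apply/rowP => j; rewrite !mxE.
have DC : D *m C = g%:M.
  apply/eqP; rewrite -subr_eq0; apply/eqP; apply: Ninj.
  by rewrite mulmxBl -mulmxA -UE DE mul_scalar_mx subrr.
have /choice[b bE] : forall i, exists b, row i (g%:M - C *m D) = b *m Vm.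
  move=> i; apply: Vgen; rewrite -row_mul mulmxBl -mulmxA DE mul_scalar_mx.
  by rewrite -scalemxAr -UE subrr row0.
pose B := \matrix_i b i.
have BE : g%:M - C *m D = B *m Vm by apply/row_matrixP => i; rewrite row_mul rowK.
have VC : Vm *m C = 0 by apply: Ninj; rewrite -mulmxA -UE.
have VB : Vm *m B = g%:M.
  apply/eqP; rewrite -subr_eq0; apply/eqP/row_matrixP => i; rewrite row0; apply: Vfree.
  rewrite -row_mul mulmxBl -mulmxA -BE mulmxBr mulmxA VC mul0mx subr0.
  by rewrite mul_scalar_mx mul_mx_scalar subrr row0.
exists k, N, T, C, D, B; split; split=> //; first by rewrite -BE addrC subrK.
by move=> L LAx; apply: theta_alpha (loc_arr x hA) LAx NT span.
Qed.

Lemma local_dual : exists rho : nat -> nat -> S, forall j k, (j < s)%N -> (k < s)%N ->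
  \sum_(m < r) rho j m * mxf Vm k m = g *+ (j == k).
Proof.
have [k0 [N [T [C [D [B [[_ VB _ _] _]]]]]]] := local_split.
exists (fun j m => mxf B m j) => j k js ks.
have := congr1 (fun M : 'M_s => M (Ordinal ks) (Ordinal js)) VB; rewrite !mxE -val_eqE /= eq_sym => <-.
apply: eq_bigr => m _; rewrite (mxf_lt _ (ltn_ord m) js) (mxf_lt _ ks (ltn_ord m)) mulrC.
by congr (Vm _ _ * B _ _); apply: val_inj.
Qed.

Lemma local_kernel p (c : koz r S^o) : kdeg p c -> kext l (mxf Um) c = 0 ->
  Uk (mxf Vm) s p (g ^+ p *: c).
Proof.
have [k [N [T [C [D [B [[sp VB UE DE] [NT TN _]]]]]]]] := local_split.
have Q0 : Q Ax != 0 by apply: defpoly_neq0 (loc_arr x hA).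
exact: (kext_kernel sp UE NT Q0).
Qed.

(** The exterior power of the dual basis T computes the coefficients of z. For each L through x,
    [kext_dvd] makes alpha_L divide them, so Q(A_x) does. *)
Lemma local_onto p z : Ulog p.+1 z ->
  exists2 c : koz r S^o, kdeg p.+1 c & kext l (mxf Um) c = g *: (Q A ^+ p *: z).
Proof.
move=> [zd zA]; have [k [N [T [C [D [B [[sp VB UE DE] [NT TN th]]]]]]]] := local_split.
have Q0 : Q Ax != 0 by apply: defpoly_neq0 (loc_arr x hA).
have [y _ yE] : exists2 y : koz k S^o, kdeg p.+1 y & kext k (mxf T) z = Q Ax *: y.
  apply: kin_mdvd_lift; first exact: kdeg_kext.
  apply/kin_kget => J; apply: (defpoly_dvd (loc_arr x hA)) => L LAx; have /locP[LA _] := LAx.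
  have := zA L LA; rewrite expr1 acoefE => h.
  have [y yd yE] := kin_mdvd_lift (kdeg_kd _ zd) h.
  have [c cE] := th L LAx.
  have r1 : \sum_(m < l) natf (fun i => (hz (hA LA) 0 i)%:MP) m *
      natf (fun i => (dl (alpha_coef L) : 'rV[S]_l) 0 i) m = 1.
    rewrite -[RHS](congr1 (fun c : K => c%:MP_[l]) (hzP (hA LA))) /pair mxE rmorph_sum.
    by apply: eq_bigr => m _; rewrite !natfE mxE -mpolyCM.
  have [w ->] := kext_dvd yE r1 cE.
  by rewrite kgetZ; eexists; reflexivity.
have [c cd cE] := kext_local TN DE Q0 zd yE; exists c => //.
by rewrite cE Q_loc exprMn scalerA mulrA exprS.
Qed.

End LocalData.

(** * Lifted coordinates of H that vanish on the lines of A off H *)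

Section CoordinateLifts.
Variables (K : fieldType) (l : nat).
Local Notation S := {mpoly K[l]}.
Local Notation vsp := {vspace 'rV[K]_l}.
Variables (H : vsp) (A : {fset vsp}).
Hypotheses (hA : is_arrangement A) (HA : H \in A).
Let hH : is_hyperplane H := hA HA.
Local Notation n := (\dim H).
Local Notation T := {mpoly K[n]}.
Local Notation pi := (@hpi K l H).
Local Notation a := (alpha_coef H).

(** The point with alpha_H = 1 on the line cut out by B. It is unique when the members of B and H
    have only 0 in common, the case for which the factor indexed by B is made. *)
Definition flat_vec (B : {fset vsp}) : 'rV[K]_l :=
  if pselect (exists z, (forall L, L \in B -> z \in L) /\ pair z a = 1) is left h
  then projT1 (cid h) else 0.

Definition flat_form (j : 'I_n) (B : {fset vsp}) : S :=
  linear_form (col j (hdual H) - pair (flat_vec B) (col j (hdual H)) *: a).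

(* Lifts of powers of the coordinates of H vanishing on every line which is an
   intersection of members of A and is not contained in H. *)
Definition fpar (k : nat) : S := natf (fun j => \prod_(B <- fpowerset A) flat_form j B) k.

Lemma hpi_flat_form j B : pi (flat_form j B) = 'X_j.
Proof.
rewrite hpi_lf mulmxBr -scalemxAr hbas_alpha // scaler0 subr0.
have -> : hbas H *m col j (hdual H) = delta_mx j 0.
  apply/colP => i; have := congr1 (fun M : 'M_n => M i j) (@hbas_dual K l H).
  by rewrite !mxE eqxx andbT => <-; apply: eq_bigr => m _; rewrite !mxE.
rewrite /linear_form (bigD1 j) //= mxE !eqxx scale1r big1 ?addr0 // => i ij.
by rewrite mxE (negPf ij) scale0r.
Qed.

Lemma hpi_fpar (j : 'I_n) : pi (fpar j) = 'X_j ^+ size (fpowerset A).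
Proof.
rewrite /fpar natfE hpi_prod; elim: (enum_fset _) => [|B s IH].
  by rewrite big_nil.
by rewrite big_cons hpi_flat_form IH exprS.
Qed.

Lemma fpar_homog N k : (k < n)%N -> fpar k ^+ N \is (size (fpowerset A) * N).-homog for mdeg.
Proof.
move=> kn; apply: dhomogMn; rewrite /fpar (natf_lt _ kn); elim: (enum_fset _) => [|B s IH].
  by rewrite big_nil; apply: dhomog1.
by rewrite big_cons; exact: (dhomogM (linear_form_homog _) IH).
Qed.

Lemma good_fpar N : good (fun k => fpar k ^+ N) n n.
Proof.
apply: (good_lift hH (fpar_homog N)); last exact: (@good_Xn K n (size (fpowerset A) * N) n (leqnn n)).
by move=> k kn; rewrite hpiX (hpi_fpar (Ordinal kn)) -exprM /Xn (natf_lt _ kn).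
Qed.

(** Here alpha_H is not assumed to lie in I. Members of A that have only 0 in common with H meet in
    0 or in a line off H; the factor of [fpar] indexed by the set B of these members vanishes there,
    so it is a combination of their linear forms. *)
Lemma fpar_radical (I : S^o -> Prop) : submod I ->
  (forall x, x != 0 -> x \in H -> exists k, I (offprod A x ^+ k)) ->
  exists N, forall k, (k < n)%N -> I (fpar k ^+ N).
Proof.
move=> sI hx; have hN (j : 'I_n) : exists N, I (fpar j ^+ N).
  apply: (@radical_offprod K l (A : seq vsp) H I (fpar j) sI hx).
  move=> s us sA hs; pose B := [fset L in A | L \in s].
  have BP L : (L \in B) = (L \in s).
    by rewrite /B in_fset /= inE /=; case: (boolP (L \in s)) => [/sA ->|]; rewrite ?andbF.
  have [||d dE] := @span_alpha K l s (col j (hdual H) - pair (flat_vec B) (col j (hdual H)) *: a) us.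
  - by move=> L /sA/hA.
  (* A common vector v in H is zero. Off H, it is a multiple of [flat_vec B], at which the linear
     form was made to vanish. *)
  - move=> v hv; case: (eqVneq (pair v a) 0) => va.
      rewrite (hs v) ?(mem_hpair hH) ?va //; by rewrite /pair mul0mx mxE.
    set z := (pair v a)^-1 *: v.
    have zB : forall L, L \in B -> z \in L by move=> L; rewrite BP => Ls; apply: memvZ; apply: hv.
    have za : pair z a = 1 by rewrite pairZl mulVf.
    have ez : flat_vec B = z.
      rewrite /flat_vec; case: pselect => [h|[]]; last by exists z.
      case: cid => z' /= [z'B z'a]; apply/eqP; rewrite -subr_eq0; apply/eqP; apply: hs.
        by rewrite (mem_hpair hH) pairBl z'a za subrr.
      by move=> L Ls; apply: memvB; [apply: z'B|apply: zB]; rewrite BP.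
    rewrite ez pairBr pairZr pairZl mulrAC mulVf // mul1r subrr //.
  have Bp : B \in fpowerset A by rewrite fpowersetE; apply/fsubsetP => L; rewrite BP => /sA.
  exists 0, (fun L => (d L)%:MP * \prod_(C <- (fpowerset A) `\ B) flat_form j C); split.
    by case: sI.
  rewrite add0r /fpar natfE (big_fsetD1 B Bp) /= {1}/flat_form dE mulr_suml.
  by apply: eq_bigr => L _; rewrite mulrAC.
have /choice[N NE] := hN; exists (\sum_j N j)%N => k kn.
rewrite (bigD1 (Ordinal kn)) //= exprD mulrC.
exact: (@submodZ S S^o _ _ _ sI) (NE (Ordinal kn)).
Qed.

End CoordinateLifts.

Lemma Hvan_unscale (R : idomainType) l f n p (U : koz l R^o -> Prop) a : a != 0 -> submod U ->
  Hvan f n p (fun u => exists2 z, U z & u = a *: z) -> Hvan f n p U.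
Proof.
move=> a0 sU h c cU cd c0.
have inj (x : koz n (koz l R^o)) : a *: x = 0 -> x = 0.
  move=> e; apply: kget_ext => J; rewrite kget0; apply: (koz_regular a0).
  by rewrite -kgetZ e kget0.
have [|||b [bU bd be]] := h (a *: c).
- by apply/kin_kget => J; rewrite kgetZ; exists (kget c J) => //; move/kin_kget: cU.
- exact: kdegZ.
- by rewrite kdZ c0 scaler0.
have s0 : a *: (0 : koz l R^o) = 0 by rewrite scaler0.
have hs (w : koz l R^o) : (exists2 z, U z & w = a *: z) -> exists2 u, U u & a *: u = w.
  by move=> [z zU ->]; exists z.
have [b' [b'U b'd b'E]] := kmap_lift_p sU.1 s0 hs bU bd.
have bE : b = a *: b' by rewrite -b'E; apply: kget_ext => J; rewrite kget_kmap kgetZ.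
exists b'; split=> //; apply/eqP; rewrite -subr_eq0; apply/eqP; apply: inj.
by rewrite scalerBr -kdZ -bE be subrr.
Qed.

(** * Forms of degree up to l - 3 *)

Section MiddleForms.
Variables (K : fieldType) (l : nat).
Local Notation S := {mpoly K[l]}.
Local Notation vsp := {vspace 'rV[K]_l}.
Local Notation Q A := (defpoly A (fun=> 1%N)).
Variables (H : vsp) (A : {fset vsp}).
Hypotheses (hA : is_arrangement A) (HA : H \in A).
Let hH : is_hyperplane H := hA HA.
Local Notation n := (\dim H).
Hypothesis nl : n.+1 = l.
Hypothesis lf : locally_free_along A H.
Local Notation Ulog p := (Ulog A (fun=> 1%N) p).
Local Notation t := (tcoord H 1).

Lemma good_t : good t l l.
Proof. by have := (@good_tcoord _ _ _ hH 1); rewrite nl; apply. Qed.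

Hypothesis hU1 : forall p, (p < n)%N -> Hvan t l p (U1 A).

Lemma U1_graded : graded (fun=> 0%N) (U1 A).
Proof.
move=> d u uU L LA v vL; rewrite ev_hc; have [c ->] := uU L LA v vL.
rewrite mulrC (pihomogM _ _ (linear_form_homog _)); case: ifP => _; last by exists 0; rewrite mulr0.
by rewrite mulrC; eexists; reflexivity.
Qed.

(** Minimal relations generate freely because H^(l-1) of the module of relations is controlled by
    H^(l-2) of U1(A), which vanishes. The resolution is kept as a pair of matrices for the exterior
    powers. *)
Lemma U1_resolution : exists r s (Um : 'M[S]_(r, l)) (Vm : 'M[S]_(s, r)),
  [/\ forall i, U1 A (row i Um) & forall eta, U1 A eta -> exists c, eta = c *m Um] /\
  [/\ Vm *m Um = 0, forall c : 'rV_r, c *m Um = 0 -> exists b, c = b *m Vm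
    & forall b : 'rV_s, b *m Vm = 0 -> b = 0].
Proof.
have [r [u [dg [uU ug usp _]]]] := graded_gens (U1_submod A) U1_graded.
have lE k m (w : 'I_k -> 'rV[S]_m) c : lincomb w c = c *m \matrix_i w i.
  by rewrite mulmx_sum_row; apply: eq_bigr => i _; rewrite rowK.
pose N (c : 'rV[S]_r) := lincomb u c = 0.
have sN : submod N.
  split; first by rewrite /N linear0.
  by move=> a x y xN yN; rewrite /N lincombP xN yN scaler0 addr0.
have gN : graded dg N by move=> d c cN; rewrite /N -(hc_lincomb _ _ ug) cN raddf0.
have [s [v [dv [vN vg vsp vmin]]]] := graded_gens sN gN.
have NE c : N c <-> exists b, c = lincomb v b.
  split; first exact: vsp.
  move=> [b ->]; refine (@submod_sum S _ N 'I_s _ xpredT (fun j => b 0 j *: v j) sN _) => j _.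
  exact: (submodZ _ sN).
have l0 : (0 < l)%N by rewrite -nl.
have vfree : forall c, lincomb v c = 0 -> c = 0.
  apply: (@min_gens_free K l l t l0 _ _ r s v vmin).
  - exact: tcoord_coef0.
  - by move=> f /(tcoord_gen hH); rewrite nl.
  apply: (@Hvan_iff _ _ _ _ _ (kker (fun _ : 'rV[S]_r => True) (lincomb u))).
    by move=> c; rewrite -NE; split=> [[]|].
  apply: (@Hvan_ker _ _ _ _ l t t (fun _ : 'rV[S]_r => True) (U1 A) (lincomb u)).
  - exact: submodT.
  - by move=> x y _ _; rewrite linearB.
  - by move=> k x _ _; rewrite linearZ.
  - by move=> w /usp[c ->]; exists c.
  - move=> x _; refine (@submod_sum S _ (U1 A) 'I_r _ xpredT (fun j => x 0 j *: u j) (U1_submod A) _) => j _.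
    exact: (submodZ _ (U1_submod A)).
  - by apply: Hvan_rV; apply: good_t; rewrite prednK.
  - by move=> p' e; apply: hU1; move: e nl; lia.
exists r, s, (\matrix_i u i), (\matrix_i v i); split; split.
- by move=> i; rewrite rowK.
- by move=> eta /usp[c ->]; exists c; rewrite lE.
- by apply/row_matrixP => i; rewrite row_mul rowK row0 -lE; apply: vN.
- by move=> c; rewrite -lE => /NE[b ->]; exists b; rewrite lE.
- by move=> b; rewrite -lE; apply: vfree.
Qed.

(** The image M' of the exterior power of degree p + 1 is compared with Q(A)^p times the numerators.
    They agree locally along H, and to extend this H^1 of M' must vanish along the n elements
    [fpar]; that requires 1 + (p + 2) <= n, the bound assumed. *)
Lemma Hvan_Ulog_mid p : (p.+3 <= n)%N -> forall p', (p' + p.+1 < l)%N -> Hvan t l p' (Ulog p.+1).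
Proof.
move=> pn p' pp'.
have [r [s [Um [Vm [[UmU Umgen] [VU Vgen Vfree]]]]]] := U1_resolution.
(* The factors up to which the rows of [Vm] have a dual family form an ideal, which contains
   [offprod A x] for every x in H other than 0. *)
have [N0 dual] : exists N0, forall i, (i < n)%N -> exists rho : nat -> nat -> S,
    forall j k, (j < s)%N -> (k < s)%N ->
    \sum_(m < r) rho j m * mxf Vm k m = (fpar H A i ^+ N0) *+ (j == k).
  apply: (fpar_radical hA HA (I := fun g : S^o => exists rho : nat -> nat -> S,
    forall j k, (j < s)%N -> (k < s)%N -> \sum_(m < r) rho j m * mxf Vm k m = (g : S) *+ (j == k))).
    split; first by exists (fun _ _ => 0) => j k _ _; rewrite mul0rn big1 // => m _; rewrite mul0r.
    move=> c x y [rho rE] [sg sE]; exists (fun j m => c * rho j m + sg j m) => j k js ks.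
    rewrite mulrnDl -[c *: x]/(c * x : S) -mulrnAr -rE // -sE // mulr_sumr -big_split.
    by apply: eq_bigr => m _; rewrite /= mulrDl mulrA.
  move=> x x0 xH; exists 1%N; rewrite expr1.
  exact: (local_dual hA UmU Umgen VU Vgen Vfree (lf x0 xH)).
have hUk q : (q <= n)%N -> forall h m G, good h m G -> forall i, (i + q <= G)%N ->
    Hvan h m i (Uk (r := r) (mxf Vm) s q).
  move=> qn h m G gh i iG; exact: (Hvan_Uk (@good_fpar K l H A hA HA N0) dual qn (leqnn s) gh iG).
have pn1 : (p.+1 <= n)%N by apply: leq_trans pn; rewrite !ltnS; apply: leqW.
have sk m : submod (fun c : koz m S^o => kdeg p.+1 c) by split; [apply: kdeg0|apply: kdeg_lin].
have ext N m (U U' : koz m S^o -> Prop) w : submod U -> submod U' -> (forall u, U' u -> U u) ->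
    (forall u, U u <-> kdeg p.+1 u) -> U w ->
    (forall k, (k < n)%N -> U' (fpar H A k ^+ N *: w)) ->
    Hvan (fun k => fpar H A k ^+ N) n 1 U' -> U' w.
  move=> sU sU' sub UE wU fw; apply: (Hvan_extend sU sU' sub wU fw).
  apply: (Hvan_iff (fun u => iff_sym (UE u))); apply: Hvan_kdeg.
  by apply: good_fpar => //; apply: leq_trans pn1.
(* Locally a multiple of a kernel element lies in the submodule generated by the rows of [Vm]; since
   H^1 of that submodule vanishes along [fpar], the element itself does. The converse is [VU]. *)
have kerE c : kker (fun c : koz r S^o => kdeg p.+1 c) (kext l (mxf Um)) c <-> Uk (mxf Vm) s p.+1 c.
  split.
    move=> [cd c0].
    have [|x x0 xH|N NE] := @fpar_radical K l H A hA HA (fun g : S^o => Uk (mxf Vm) s p.+1 ((g : S) *: c)).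
    - split; first by rewrite scale0r; case: (Uk_submod r (mxf Vm) s p.+1).
      move=> g x y xU yU; rewrite -[g *: x + y]/(g * x + y : S) scalerDl -scalerA.
      exact: (Uk_submod r (mxf Vm) s p.+1).2.
    - exists p.+1; exact: (local_kernel hA UmU Umgen VU Vgen Vfree (lf x0 xH)).
    apply: (@ext N r (fun c => kdeg p.+1 c)) => //.
    + exact: Uk_submod.
    + by move=> u /Uk_kdeg.
    by apply: (hUk _ pn1 _ _ n (@good_fpar K l H A hA HA N)); apply: leq_trans pn; rewrite add1n ltnW.
  move=> /[dup] cU /Uk_kdeg cd; split=> //; have [w [wd ->]] := cU.
  rewrite (big_morph _ (@kextD _ l r (mxf Um)) (kext0 l r (mxf Um))) big1 // => j _.
  rewrite kext_kd kd_f0 // => m ml.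
  transitivity ((Vm *m Um) j (Ordinal ml)); last by rewrite VU mxE.
  rewrite mxE.
  apply: eq_bigr => i _; rewrite (mxf_lt _ (ltn_ord j) (ltn_ord i)) (mxf_lt _ (ltn_ord i) ml).
  by congr (Vm _ _ * Um _ _); apply: val_inj.
pose M' (u : koz l S^o) := exists2 c : koz r S^o, kdeg p.+1 c & kext l (mxf Um) c = u.
have hM h m G : good h m G -> forall i, (i + p.+2 <= G)%N -> Hvan h m i M'.
  move=> gh i iG; apply: (@Hvan_coker _ _ _ _ m h h (fun c : koz r S^o => kdeg p.+1 c) M' (kext l (mxf Um))).
  - exact: sk.
  - by move=> u v _ _; apply: kextB.
  - by move=> k u _ _; apply: kextZ.
  - by move=> w [c cd <-]; exists c.
  - by move=> u ud; exists u.
  - by apply: Hvan_kdeg; apply: gh; apply: leq_trans iG; rewrite addnS ltnS leq_addr.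
  apply: (Hvan_iff (fun u => iff_sym (kerE u))); apply: (hUk _ pn1 _ _ G gh).
  by rewrite addSnnS.
have sM : submod M'.
  split; first by exists 0; [apply: kdeg0|apply: kext0].
  move=> c u v [x xd <-] [y yd <-]; exists (c *: x + y); first exact: kdeg_lin.
  exact: kext_lin.
have Q0 : Q A ^+ p != 0 by rewrite expf_neq0 //; apply: defpoly_neq0 hA.
(* A product of p + 1 numerators is Q(A)^p times a numerator. Conversely [local_onto] reaches such
   multiples up to [offprod A x], and depth along [fpar] removes the multiplier. *)
have ME u : M' u <-> exists2 z, Ulog p.+1 z & u = Q A ^+ p *: z.
  split; first by move=> [c cd <-]; exact: (kext_Ulog hA UmU cd).
  move=> [z zU ->].
  have [|x x0 xH|N NE] := @fpar_radical K l H A hA HA (fun g : S^o => M' ((g : S) *: (Q A ^+ p *: z))).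
  - split; first by rewrite scale0r; case: sM.
    move=> g x y xU yU; rewrite -[g *: x + y]/(g * x + y : S) scalerDl -scalerA.
    exact: sM.2.
  - exists 1%N; rewrite expr1; have [c cd cE] := local_onto hA UmU Umgen VU Vgen Vfree (lf x0 xH) zU.
    by exists c.
  apply: (@ext N l (fun c => kdeg p.+1 c)) => //.
  - by move=> v [c cd <-]; apply: kdeg_kext.
  - by apply: kdegZ; case: zU.
  exact: (hM _ _ n (@good_fpar K l H A hA HA N)).
apply: (Hvan_unscale Q0 (Ulog_submod A (fun=> 1%N) p.+1)).
apply: (Hvan_iff ME); apply: (hM _ _ _ good_t).
by rewrite addnS.
Qed.

End MiddleForms.

Lemma scale_pair (R : comNzRingType) (V : lmodType R) (c : R) (x : (V * R^o)%type) (d : V) :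
  (c *: x).1 + (c *: x).2 *: d = c *: (x.1 + x.2 *: d).
Proof. by rewrite scalerDr scalerA. Qed.

(** * Tameness from the Ziegler restriction *)

Section TameZiegler.
Variables (K : fieldType) (l : nat).
Local Notation S := {mpoly K[l]}.
Local Notation vsp := {vspace 'rV[K]_l}.
Local Notation Q A := (defpoly A (fun=> 1%N)).
Variables (H : vsp) (A : {fset vsp}).
Hypotheses (hA : is_arrangement A) (HA : H \in A).
Let hH : is_hyperplane H := hA HA.
Local Notation n := (\dim H).
Hypotheses (nl : n.+1 = l) (n4 : (4 <= n)%N).
Hypothesis lf : locally_free_along A H.
Hypothesis tZ : pd_le (Omega (restriction A H) (ziegler_mult A H) 1) 1.
Local Notation t := (tcoord H 1).

(** By [zieg_ker] and [zieg_onto], U0 modulo alpha_H is the module of logarithmic 1-forms of the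
    Ziegler restriction, whose cohomology vanishes below degree n - 1; adding alpha_H to the
    sequence shifts this by one. *)
Lemma Hvan_U0_ziegler p : (p < n)%N -> Hvan t l p (U0 A).
Proof.
move=> pn; suff : Hvan t n.+1 p (U0 A) by rewrite nl.
have U0l eta : U0 A eta -> logH H eta by move=> [/(U1_logH HA)].
apply: (@Hvan_cone _ _ _ _ n (fun k => yhat H k ^+ 1) (@Xn K n 1) (U0 A)
  (UA (restriction A H) (ziegler_mult A H)) (zieg H)).
- exact: U0_submod.
- by move=> u v /U0l hu /U0l hv; apply: ziegB.
- by move=> k u kn /U0l hu; rewrite ziegZ // hpiX hpi_yhat.
- exact: zieg_onto.
- by move=> u [uU _]; apply: zieg_into.
- by move=> u _; apply: rV_scale_inj; apply: alpha_neq0'.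
- by move=> u /U0l hu; rewrite ziegZ // hpi_alpha // scale0r.
- exact: zieg_ker.
- move=> p' e; apply: (Hvan_E hA HA tZ (@good_Xn K n 1 n (leqnn n))).
  by rewrite -e.
Qed.

Lemma Hvan_U1_ziegler p : (p < n)%N -> Hvan t l p (U1 A).
Proof.
move=> pn; have gt := good_t hA HA nl.
pose U (x : ('rV[S]_l * S^o)%type) := U0 A x.1 /\ True.
have sU : submod U by split=> [|r u v [u1 _] [v1 _]]; split=> //; [case: (U0_submod A)|apply: (U0_submod A).2].
apply: (@Hvan_iso _ _ _ _ l t t U (U1 A) (fun x => x.1 + x.2 *: dalpha H A)).
- exact: sU.
- by move=> u v _ _; rewrite /= scalerBl opprD addrACA.
- by move=> k u _ _; apply: scale_pair.
- move=> eta /(U1_split hA HA)[c cU _]; exists (eta - c *: dalpha H A, c) => //.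
  by rewrite /= subrK.
- move=> [u c] [[/= uU _] _].
  exact: (submodD (U1_submod A) uU (submodZ c (U1_submod A) (dalpha_U1 hA HA))).
- move=> [u c] [[/= uU u0] _] e.
  have c0 : c = 0.
    have := congr1 (ct (eul K l)) e; rewrite addrC ct_lin u0 addr0 (dalpha_eul HA).
    have -> : ct (eul K l) 0 = 0 by rewrite /ct big1 // => i _; rewrite [X in _ * X]mxE mulr0.
    have Q0 : Q A != 0 by apply: defpoly_neq0 hA.
    by move/eqP; rewrite mulf_eq0 (negPf Q0) orbF => /eqP.
  by move: e; rewrite c0 scale0r addr0 => ->.
apply: (Hvan_prod (U0_submod A) (@submodT S S^o)); first exact: Hvan_U0_ziegler.
by apply: gt; rewrite -[X in (_ < X)%N]nl ltnS ltnW.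
Qed.

Lemma tame_ziegler : tame A.
Proof.
have gt := good_t hA HA nl.
move=> p pl; apply: (tame_of_Hvan hH hA nl) => p' pp'.
have l5 : (4 < l)%N by move: nl n4; lia.
case: p pl pp' => [|[|p]] pl pp'.
- by apply: (Hvan_Ulog0 hA gt); lia.
- apply/Hvan_Ulog1 => //; apply: (@Hvan_iff _ _ _ _ _ (U1 A)); first by move=> u; rewrite U1E.
  by apply: Hvan_U1_ziegler; move: nl pp'; lia.
(* Forms of degree p + 2 at most l - 3 are the middle ones. Beyond that, p' + p + 2 < l leaves only
   p' = 0 and p' = 1. *)
case: (leqP p.+4 n) => pn; first exact: (Hvan_Ulog_mid hA HA nl lf Hvan_U1_ziegler pn).
by apply: Hvan_Ulog_low; [move=> q q2; apply: gt; lia|move: nl pn pp'; lia].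
Qed.

End TameZiegler.

Theorem theorem1p10 (K : fieldType) (l : nat) (A : {fset {vspace 'rV[K]_l}})
    (hA : is_arrangement A) :
  (l = 4%N ->
     (exists H : {vspace 'rV[K]_l},
        [/\ H \in A, tame (A `\ H) & locally_free_along (A `\ H) H]) ->
     tame A) /\
  ((5 <= l)%N ->
     forall H : {vspace 'rV[K]_l}, H \in A ->
       multi_tame (restriction A H) (ziegler_mult A H) ->
       locally_free_along A H ->
       tame A).
Proof.
split=> [l4|l5 H HA tZ lf].
  by move: A hA; rewrite l4 => B hB [H [HB tB lf]]; apply: (tame_addition hB HB).
have hH : (\dim H).+1 = l := hA _ HA.
have n4 : (4 <= \dim H)%N by move: hH l5; lia.
by apply: (tame_ziegler hA HA hH n4 lf); apply: tZ; apply: leq_trans n4.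
Qed.
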